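(* Let $E=\{0,1,\dots,K\}$ and let $X=(X_i)_{i\ge0}$ be an aperiodic, irreducible, stationary Markov chain on $E$. Let $Y_0,Y_1,\dots$ be integer-valued random variables, conditionally independent given $X$, such that the conditional law of $Y_i$ given $X$ depends only on $X_i$, and for each $k\in E$ the law $\mathcal{L}(Y_i\mid X_i=k)$ does not depend on $i$ and has finite variance. Let $W:=\sum_{i=1}^nY_i$. Assume that (i) the distribution of $\sum_{i=1}^{S_1}Y_i$, under $X_0=0$, is strongly aperiodic, and (ii) there is a positive integer-valued random variable $Z$ with $\mathbb{E}Z^3<\infty$ such that for all $r\ge0$ and all $l\in E$, \[ \max\{\mathbb{P}(Y_1\ge r\mid X_1=l),\ \mathbb{P}(Y_1\le -r\mid X_1=l)\}\le\mathbb{P}(Z\ge r). \] Then, if $\mathrm{Var}\,W>0$, \[ \|\mathcal{L}(W)-\mathrm{TP}(\mathbb{E}W,\mathrm{Var}\,W)\|\le 4\bigl(1+14\,n\,\varphi(n)\,\mathbb{E}\tau^2\,\mathbb{E}Z^3\bigr)/\mathrm{Var}\,W, \] where $\varphi(n):=\tilde\beta(n/4)+(C\vee\bar C)\,n\,\rho^{-n/4}$.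
   Context: $S_1:=\min\{m\ge1:X_m=0\}$ for the chain started at $X_0=0$. An integer-valued random variable $V$ is strongly aperiodic if $\gcd\{k+i:\mathbb{P}(V=i)>0\}=1$ for every integer $k$. Translated Poisson law: for $\mu\in\mathbb{R}$, $\sigma^2\ge0$, let $\gamma=\lfloor\mu-\sigma^2\rfloor$, $\lambda'=\sigma^2+(\mu-\sigma^2-\gamma)$, and $\mathrm{TP}(\mu,\sigma^2)\{j\}:=\mathrm{Po}(\lambda')\{j-\gamma\}$, $j\in\mathbb{Z}$, with $\mathrm{Po}(\lambda)$ the Poisson law of mean $\lambda$. For laws $Q,Q'$ on $\mathbb{Z}$, $\|Q-Q'\|:=\sum_i|Q(i)-Q'(i)|$. Let $\pi$ be the stationary law, $\bar X$ the time-reversed chain (transitions $\pi(j)p(j,k)/\pi(k)$), with associated $Y$-variables drawn from the same conditional laws. $\beta(n):=\bigl\|\mathbb{P}^0[(X_n,1+\sum_{i=1}^nY_i)\in\cdot]-\mathbb{P}^0[(X_n,\sum_{i=1}^nY_i)\in\cdot]\bigr\|$ (total variation norm on $E\times\mathbb{Z}$, chain started at $X_0=0$), $\bar\beta(n)$ the same for $\bar X$, $\tilde\beta(n):=\max\{\beta(n),\bar\beta(n)\}$, and $\tilde\beta(x):=\tilde\beta(\lfloor x\rfloor)$ for non-integer $x$. Let $X'$ be an independent copy of $X$; the pair chain $((X_i,X_i'))$ is an irreducible finite Markov chain on $E\times E$. For a Markov chain $X^*$ with reference state $s_0$, let $D_j:=\min\{m-j:m\ge j,\ X^*_m=s_0\}$.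 The constants $\rho>1$, $C$, $\bar C$ are such that $\max_{s}\mathbb{P}(D_j\ge m\mid X^*_j=s)\le C\rho^{-m}$ for all $m$ when $X^*$ is the pair chain $((X_i,X'_i))$ with reference state $(0,0)$, and $\le\bar C\rho^{-m}$ for the corresponding pair of time-reversed chains. Finally, extending the stationary independent chains $X,X'$ to all times $i\in\mathbb{Z}$, let $\tau:=\sigma^+-\sigma^-+1$ where $\sigma^-:=\max\{k\le0:X_k=X'_k=0\}$, $\sigma^+:=\min\{k\ge0:X_k=X'_k=0\}$. *)

(* Defs.v *)
From HB Require Import structures.
From mathcomp Require Import all_boot all_order all_algebra.
From mathcomp Require Import all_classical all_reals all_analysis.
Set Implicit Arguments. Unset Strict Implicit. Unset Printing Implicit Defensive.
Import Order.TTheory GRing.Theory Num.Theory.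
Local Open Scope ring_scope.
Local Open Scope classical_set_scope.

Section Defs.
Variable R : realType.

Definition poisson_pmf (lam : R) (k : nat) : R :=
  expR (- lam) * lam ^+ k / (k`!)%:R.

Definition TP (mu s2 : R) (j : int) : R :=
  let g := Num.floor (mu - s2) in
  let lam := s2 + (mu - s2 - g%:~R) in
  match (j - g)%R with
  | Posz k => poisson_pmf lam k
  | Negz _ => 0
  end.

Definition int_pmf (f : int -> R) : Prop :=
  (forall y, 0 <= f y) /\ (\esum_(y in [set: int]) (f y)%:E = 1)%E.

Definition finite_variance (f : int -> R) : Prop :=
  (\esum_(y in [set: int]) (((y%:~R : R) ^+ 2) * f y)%:E < +oo)%E.

Definition nat_pmf (f : nat -> R) : Prop :=
  (forall k, 0 <= f k) /\ (\esum_(k in [set: nat]) (f k)%:E = 1)%E.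

Definition tail_ge (f : nat -> R) (r : R) : \bar R :=
  \esum_(k in [set k : nat | r <= k%:R]) (f k)%:E.
Definition third_moment (f : nat -> R) : \bar R :=
  \esum_(k in [set: nat]) ((k%:R : R) ^+ 3 * f k)%:E.

Definition stochastic (S : finType) (Q : S -> S -> R) : Prop :=
  (forall x y, 0 <= Q x y) /\ (forall x, \sum_(y : S) Q x y = 1).

Definition irreducible (K : nat) (P : 'M[R]_K.+1) : Prop :=
  forall j k, exists m : nat, 0 < (P ^+ m) j k.

Definition aperiodic (K : nat) (P : 'M[R]_K.+1) : Prop :=
  forall k (d : nat),
    (forall m : nat, (0 < m)%N -> 0 < (P ^+ m) k k -> (d %| m)%N) -> d = 1%N.

Definition stationary_law (K : nat) (P : 'M[R]_K.+1) (pi : 'I_K.+1 -> R) :=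
  [/\ forall k, 0 <= pi k, \sum_k pi k = 1 &
      forall k, \sum_j pi j * P j k = pi k].

Definition rev_kernel (K : nat) (P : 'M[R]_K.+1) (pi : 'I_K.+1 -> R)
  (k j : 'I_K.+1) : R := pi j * P j k / pi k.

Definition pair_kernel (S : finType) (Q : S -> S -> R) (a b : S * S) : R :=
  Q a.1 b.1 * Q a.2 b.2.

(* One step of the joint law of (X_m, Y_1 + ... + Y_m), restricted to the
   paths whose state at time m satisfies [ok]:
   a'(x', s) = sum_y sum_{x | ok x} a(x, s - y) Q(x, x') q(x', y). *)
Definition sum_step (S : finType) (Q : S -> S -> R) (q : S -> int -> R)
  (ok : S -> bool) (a : S -> int -> R) : S -> int -> R :=
  fun x' s => fine (\esum_(y in [set: int])
    ((\sum_(x : S | ok x) a x (s - y) * Q x x') * q x' y)%:E).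

(* law0 Q q x0 m x s = P^{x0}[X_m = x, Y_1 + ... + Y_m = s] *)
Fixpoint law0 (S : finType) (Q : S -> S -> R) (q : S -> int -> R) (x0 : S)
  (m : nat) : S -> int -> R :=
  match m with
  | 0 => fun x s => ((x == x0) && (s == 0))%:R
  | m'.+1 => sum_step Q q xpredT (law0 Q q x0 m')
  end.

Definition beta (S : finType) (Q : S -> S -> R) (q : S -> int -> R) (x0 : S)
  (m : nat) : \bar R :=
  \esum_(p in [set: S * int])
    (`| law0 Q q x0 m p.1 (p.2 - 1) - law0 Q q x0 m p.1 p.2 |)%:E.

(* taboo_law Q q x0 m x s
     = P^{x0}[X_m = x, X_1 <> x0, ..., X_{m-1} <> x0, Y_1 + ... + Y_m = s] *)
Fixpoint taboo_law (S : finType) (Q : S -> S -> R) (q : S -> int -> R)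
  (x0 : S) (m : nat) : S -> int -> R :=
  match m with
  | 0 => fun x s => ((x == x0) && (s == 0))%:R
  | m'.+1 => sum_step Q q (fun x => (m' == 0)%N || (x != x0))
                       (taboo_law Q q x0 m')
  end.

(* law of V = Y_1 + ... + Y_{S_1} under X_0 = x0, S_1 = first return time *)
Definition return_sum_law (S : finType) (Q : S -> S -> R) (q : S -> int -> R)
  (x0 : S) (v : int) : \bar R :=
  \esum_(m in [set m : nat | (0 < m)%N]) (taboo_law Q q x0 m x0 v)%:E.

Definition strongly_aperiodic (law : int -> \bar R) : Prop :=
  forall (k : int) (d : nat),
    (forall i : int, (0 < law i)%E -> (d%:Z %| k + i)%Z) -> d = 1%N.

(* avoid Q s0 m s = P_s[X_0 <> s0, ..., X_{m-1} <> s0]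
   = P(D_j >= m | X_j = s) for a time-homogeneous chain *)
Fixpoint avoid (S : finType) (Q : S -> S -> R) (s0 : S) (m : nat) (s : S) : R :=
  match m with
  | 0 => 1
  | m'.+1 => (s != s0)%:R * \sum_(s' : S) Q s s' * avoid Q s0 m' s'
  end.

Definition hitting_tail_bound (S : finType) (Q : S -> S -> R) (s0 : S)
  (C rho : R) : Prop :=
  forall (m : nat) (s : S), avoid Q s0 m s <= C * rho ^- m.

Definition window_prob (S : finType) (pi0 : S -> R) (Q : S -> S -> R)
  (N : nat) (w : N.+1.-tuple S) : R :=
  pi0 (thead w) * \prod_(i < N) Q (nth (thead w) w i) (nth (thead w) w i.+1).

(* window of times -a..b (index i <-> time i - a):
   {sigma^- = -a, sigma^+ = b} *)
Definition tau_event (S : finType) (z0 : S) (a b : nat)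
  (w : (a + b).+1.-tuple S) : bool :=
  [&& nth z0 w 0 == z0, nth z0 w (a + b) == z0 &
      [forall i : 'I_(a + b).+1,
        (((0 < i) && (i <= a)) || ((a <= i) && (i < a + b)))%N ==>
          (nth z0 w i != z0)]].

(* E tau^2, tau = sigma^+ - sigma^- + 1, for the pair of independent
   stationary two-sided chains with state 0 as reference *)
Definition E_tau2 (K : nat) (P : 'M[R]_K.+1) (pi : 'I_K.+1 -> R) : \bar R :=
  let z0 := (0 : 'I_K.+1, 0 : 'I_K.+1) in
  \esum_(ab in [set: nat * nat])
    ((((ab.1 + ab.2).+1)%:R : R) ^+ 2 *
     \sum_(w : (ab.1 + ab.2).+1.-tuple ('I_K.+1 * 'I_K.+1)
            | tau_event z0 w)
        window_prob (fun z => pi z.1 * pi z.2)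
                    (pair_kernel (fun i j => P i j)) w)%:E.

Definition phi (K : nat) (P : 'M[R]_K.+1) (pi : 'I_K.+1 -> R)
  (q : 'I_K.+1 -> int -> R) (C Cb rho : R) (n : nat) : \bar R :=
  (Order.max (beta (fun i j => P i j) q ord0 (n %/ 4))
             (beta (rev_kernel P pi) q ord0 (n %/ 4))
   + (Num.max C Cb * n%:R * powR rho (- (n%:R / 4)))%:E)%E.

End Defs.

(* Main.v *)
(*
Put L f = E f(W).  By Stein's method for the Poisson law it suffices to bound, for every g with
|g(j+1) - g(j)| <= 1,
   |E[W g(W)] - E W E g(W) - Var W E[g(W+1) - g(W)]|,
which splits into a sum over i of Cov(Y_i, g(W)) - Cov(Y_i, W) E[g(W+1) - g(W)].
Run an independent copy (X', Y') beside (X, Y) and let the two chains exchange their paths at the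
last time before i and the first time after i at which both are at 0.  Then Cov(Y_i, g(W)) becomes
the mean of Y_i (g(A + V) - g(A' + V)), where A and A' are the sums of the Y and of the Y'
over the span between these two times and V is the sum outside of it.  Up to |A - A'| terms, the
difference is a combination of E[g(t+V+1) - g(t+V)]; replacing this by E[g(W+1) - g(W)] is a
coupling argument with a third chain, whose error is controlled by beta or its reversed analogue,
because a quarter of the window lies on one side of the span or else the span is itself long.
With z^3 = 2 E Z^3 bounding E|Y_i|^3, the error for each i is at most
14 z^3 max(beta, betabar) E tau^2.

The argument runs with laws of finite support.  Values of Y_i outside [-M, M] are replaced by 0,
and M tends to infinity at the end: at most a mass of order 1 - (1 - eps)^m is lost in beta, and
quadratic functionals of W converge by dominated convergence.
*)
Require Import Defs.
From HB Require Import structures.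
From mathcomp Require Import all_boot all_order all_algebra.
From mathcomp Require Import zify ring lra.
From mathcomp Require Import finmap.
From mathcomp Require Import all_classical all_reals all_analysis measurable_realfun.
(* again, since [poisson_pmf] and [beta] also name constants of the library *)
Import Defs.
Set Implicit Arguments. Unset Strict Implicit. Unset Printing Implicit Defensive.
Import Order.TTheory GRing.Theory Num.Theory.
Import numFieldNormedType.Exports.
Local Open Scope ring_scope.
Local Open Scope classical_set_scope.

(** * Finitely supported laws *)

(** The obstacle is a span which, together with the runs of the third chain up to its meetings,
    leaves fewer than n/4 values on either side. No smoothing is then available, and only the
    trivial bound 2 for a difference of two means is left. It is paid out of [b] itself: a sum of
    n/4 values has mean modulus at most [n z / 4], so it cannot be spread over many more than [n z]
    integers, and a law with so little spread changes by at least a fixed multiple of [1 / (n z)]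
    when it is shifted by one. Hence [b z n] is bounded below, and as the span and the runs fill
    half of the window, 2 is at most a constant times [b z] times their length, which is the order
    of the other errors. Finite supports turn conditioning, time reversal and the strong Markov
    property at a meeting into algebra with finite sums, where means may be exchanged freely. *)

Section FiniteLaws.
Variable R : realType.

(* A law with finite support, as a list of weighted atoms (repetitions allowed).  Two laws are
   compared only through [Ex]. *)
Record flaw (A : Type) := Flaw {
  atoms : seq (R * A);
  atoms_ge0 : all (fun p => 0 <= p.1) atoms;
  atoms_sum : \sum_(p <- atoms) p.1 = 1 }.

Definition Ex A (d : flaw A) (f : A -> R) : R :=
  \sum_(p <- atoms d) p.1 * f p.2.

Lemma eq_Ex A (d : flaw A) f g : f =1 g -> Ex d f = Ex d g.
Proof. by move=> fg; apply: eq_bigr => p _; rewrite fg. Qed.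

Lemma Ex_cst A (d : flaw A) c : Ex d (fun=> c) = c.
Proof. by rewrite /Ex -mulr_suml atoms_sum mul1r. Qed.

Lemma ExD A (d : flaw A) f g : Ex d (fun a => f a + g a) = Ex d f + Ex d g.
Proof. by rewrite /Ex -big_split; apply: eq_bigr => p _; rewrite mulrDr. Qed.

Lemma ExZ A (d : flaw A) c f : Ex d (fun a => c * f a) = c * Ex d f.
Proof. by rewrite /Ex big_distrr; apply: eq_bigr => p _; rewrite mulrCA. Qed.

Lemma ExZr A (d : flaw A) c f : Ex d (fun a => f a * c) = Ex d f * c.
Proof. by rewrite mulrC -ExZ; apply: eq_Ex => a; rewrite mulrC. Qed.

Lemma ExN A (d : flaw A) f : Ex d (fun a => - f a) = - Ex d f.
Proof. by rewrite -mulN1r -ExZ; apply: eq_Ex => a; rewrite mulN1r. Qed.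

Lemma ExB A (d : flaw A) f g : Ex d (fun a => f a - g a) = Ex d f - Ex d g.
Proof. by rewrite ExD ExN. Qed.

Lemma Ex_le A (d : flaw A) f g : (forall a, f a <= g a) -> Ex d f <= Ex d g.
Proof.
move=> fg; rewrite /Ex; have := atoms_ge0 d.
elim: (atoms d) => [|p s IH] /=; first by rewrite !big_nil.
by move=> /andP[p0 s0]; rewrite !big_cons lerD ?IH ?ler_wpM2l.
Qed.

Lemma Ex_ge0 A (d : flaw A) f : (forall a, 0 <= f a) -> 0 <= Ex d f.
Proof. by move=> f0; rewrite -(Ex_cst d 0) Ex_le. Qed.

Lemma Ex_norm A (d : flaw A) f : `|Ex d f| <= Ex d (fun a => `|f a|).
Proof.
rewrite ler_norml -ExN; apply/andP; split; apply: Ex_le => a.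
  by rewrite lerNl -normrN ler_norm.
exact: ler_norm.
Qed.

Lemma Ex_norm_le A (d : flaw A) f c : (forall a, `|f a| <= c) -> `|Ex d f| <= c.
Proof.
by move=> fc; rewrite (le_trans (Ex_norm _ _)) // -[leRHS](Ex_cst d) Ex_le.
Qed.

Lemma Ex_swap A B (d : flaw A) (e : flaw B) (f : A -> B -> R) :
  Ex d (fun a => Ex e (f a)) = Ex e (fun b => Ex d (fun a => f a b)).
Proof.
rewrite /Ex; under eq_bigr do rewrite big_distrr /=.
rewrite exchange_big /=; apply: eq_bigr => p _; rewrite big_distrr /=.
by apply: eq_bigr => r _; rewrite mulrCA.
Qed.

Lemma Ex_sqr A (d : flaw A) f : Ex d f ^+ 2 <= Ex d (fun a => f a ^+ 2).
Proof.
have: 0 <= Ex d (fun a => (f a - Ex d f) ^+ 2) by apply: Ex_ge0 => a; apply: sqr_ge0.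
rewrite (eq_Ex d (g := fun a => f a ^+ 2 + (- 2 * Ex d f) * f a + Ex d f ^+ 2)).
  by rewrite !ExD ExZ Ex_cst; move: (Ex d f) => c; nra.
by move=> a; ring.
Qed.

Section Monad.
Variables A B : Type.

Fact fret_ge0 (a : A) : all (fun p => 0 <= p.1 :> R) [:: (1, a)].
Proof. by rewrite /= ler01. Qed.
Fact fret_sum (a : A) : \sum_(p <- [:: (1 : R, a)]) p.1 = 1.
Proof. by rewrite big_seq1. Qed.
Definition fret (a : A) := Flaw (fret_ge0 a) (fret_sum a).

Definition bind_atoms (d : flaw A) (k : A -> flaw B) : seq (R * B) :=
  [seq (p.1 * r.1, r.2) | p <- atoms d, r <- atoms (k p.2)].

Lemma sum_bind_atoms d k (f : B -> R) :
  \sum_(p <- bind_atoms d k) p.1 * f p.2 = Ex d (fun a => Ex (k a) f).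
Proof.
rewrite /bind_atoms big_allpairs_dep /=; apply: eq_bigr => p _.
by rewrite /Ex big_distrr /=; apply: eq_bigr => r _; rewrite mulrA.
Qed.

Fact fbind_ge0 d k : all (fun p => 0 <= p.1) (bind_atoms d k).
Proof.
rewrite /bind_atoms; have := atoms_ge0 d; elim: (atoms d) => //= p s IH /andP[p0 s0].
rewrite all_cat IH // andbT all_map.
by apply: sub_all (atoms_ge0 (k p.2)) => r r0 /=; rewrite mulr_ge0.
Qed.
Fact fbind_sum d k : \sum_(p <- bind_atoms d k) p.1 = 1.
Proof.
transitivity (\sum_(p <- bind_atoms d k) p.1 * (fun=> 1) p.2).
  by apply: eq_bigr => p _; rewrite mulr1.
by rewrite (sum_bind_atoms d k (fun=> 1)) (eq_Ex d (g := fun=> 1)) ?Ex_cst // => a; rewrite Ex_cst.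
Qed.
Definition fbind d k := Flaw (fbind_ge0 d k) (fbind_sum d k).

Lemma Ex_ret (a : A) f : Ex (fret a) f = f a.
Proof. by rewrite /Ex big_seq1 mul1r. Qed.

Lemma Ex_bind d k f : Ex (fbind d k) f = Ex d (fun a => Ex (k a) f).
Proof. exact: sum_bind_atoms. Qed.
End Monad.

Definition fmap A B (h : A -> B) (d : flaw A) := fbind d (fun a => fret (h a)).

Lemma Ex_map A B (h : A -> B) d f : Ex (fmap h d) f = Ex d (f \o h).
Proof. by rewrite Ex_bind; apply: eq_Ex => a; rewrite Ex_ret. Qed.
End FiniteLaws.

(** * The chain and its first meeting with an independent copy *)

Section Chains.
Variables (R : realType) (S : eqType) (o : S) (q : S -> flaw R int).

(** The value at [x] is not counted, so a backward sum, a forward sum and the value at their common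
    starting state add up to a window without overlap. *)
Fixpoint sum_from (st : S -> flaw R S) (r : nat) (x : S) : flaw R int :=
  if r is r'.+1 then
    fbind (st x) (fun x' => fbind (q x') (fun y =>
      fmap (fun s => y + s) (sum_from st r' x')))
  else fret R 0.

(* The pair states visited after [z], until the first visit to (o, o) and for at most [r] steps. *)
Fixpoint meeting (st : S -> flaw R S) (r : nat) (z : S * S) : flaw R (seq (S * S)) :=
  if r is r'.+1 then
    if z == (o, o) then fret R [::] else
    fbind (st z.1) (fun x => fbind (st z.2) (fun x' =>
      fmap (cons (x, x')) (meeting st r' (x, x'))))
  else fret R [::].

Fixpoint pair_sums (ls : seq (S * S)) : flaw R (int * int) :=
  if ls is z :: ls' then
    fbind (q z.1) (fun y => fbind (q z.2) (fun y' =>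
      fmap (fun a => (y + a.1, y' + a.2)) (pair_sums ls')))
  else fret R (0, 0).

Arguments sum_from : simpl never.
Arguments meeting : simpl never.
Arguments pair_sums : simpl never.

Variable st : S -> flaw R S.

Lemma Ex_sum_from0 x F : Ex (sum_from st 0 x) F = F 0.
Proof. exact: Ex_ret. Qed.

Lemma Ex_meeting0 z F : Ex (meeting st 0 z) F = F [::].
Proof. exact: Ex_ret. Qed.

Lemma Ex_meeting_oo r F : Ex (meeting st r (o, o)) F = F [::].
Proof. by case: r => [|r]; rewrite /meeting ?eqxx Ex_ret. Qed.

Lemma Ex_pair_sums_nil F : Ex (pair_sums [::]) F = F (0, 0).
Proof. exact: Ex_ret. Qed.

Lemma Ex_sum_fromS r x F : Ex (sum_from st r.+1 x) F =
  Ex (st x) (fun x' => Ex (q x') (fun y => Ex (sum_from st r x') (fun s => F (y + s)))).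
Proof.
by rewrite [LHS]Ex_bind; apply: eq_Ex => x'; rewrite Ex_bind; apply: eq_Ex => y; rewrite Ex_map.
Qed.

Lemma Ex_meetingS r z F : z != (o, o) -> Ex (meeting st r.+1 z) F =
  Ex (st z.1) (fun x => Ex (st z.2) (fun x' =>
    Ex (meeting st r (x, x')) (fun ls => F ((x, x') :: ls)))).
Proof.
move=> /negPf zo; rewrite /meeting zo -/(meeting st) [LHS]Ex_bind; apply: eq_Ex => x'.
by rewrite Ex_bind; apply: eq_Ex => y; rewrite Ex_map.
Qed.

Lemma Ex_pair_sums_cons z ls F : Ex (pair_sums (z :: ls)) F =
  Ex (q z.1) (fun y => Ex (q z.2) (fun y' => Ex (pair_sums ls)
    (fun a => F (y + a.1, y' + a.2)))).
Proof.
by rewrite [LHS]Ex_bind; apply: eq_Ex => x'; rewrite Ex_bind; apply: eq_Ex => y; rewrite Ex_map.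
Qed.

(** Strong Markov property at the meeting. If the chains have not met after [r] steps, then
    [size ls = r] and the sum restarted in [o] is empty, so restarting in [o] is right in all cases.
    The restarted sum is the same in [sum_from_meeting2], which is what allows the two chains to be
    exchanged. *)
Lemma sum_from_meeting1 r x x' F : Ex (sum_from st r x) F =
  Ex (meeting st r (x, x')) (fun ls => Ex (pair_sums ls) (fun a =>
    Ex (sum_from st (r - size ls) o) (fun t => F (a.1 + t)))).
Proof.
elim: r x x' F => [|r IH] x x' F; first by rewrite Ex_sum_from0 Ex_meeting0 Ex_pair_sums_nil Ex_sum_from0.
have [/eqP zo|zo] := boolP ((x, x') == (o, o)).
  move: zo => [-> ->]; rewrite Ex_meeting_oo Ex_pair_sums_nil subn0.
  by apply: eq_Ex => t; rewrite add0r.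
rewrite Ex_meetingS // Ex_sum_fromS; apply: eq_Ex => x1 /=.
(* The left side does not involve the second chain, so it may be averaged over the first step of
   that chain. *)
rewrite -[LHS](Ex_cst (st x')); apply: eq_Ex => x1'.
under [RHS]eq_Ex => ls do rewrite /= Ex_pair_sums_cons /= subSS.
rewrite [RHS]Ex_swap; apply: eq_Ex => y; rewrite [RHS]Ex_swap.
rewrite -[LHS](Ex_cst (q x1')); apply: eq_Ex => y'; rewrite (IH x1 x1').
by apply: eq_Ex => ls; apply: eq_Ex => a; apply: eq_Ex => t; rewrite addrA.
Qed.

Lemma sum_from_meeting2 r x x' F : Ex (sum_from st r x') F =
  Ex (meeting st r (x, x')) (fun ls => Ex (pair_sums ls) (fun a =>
    Ex (sum_from st (r - size ls) o) (fun t => F (a.2 + t)))).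
Proof.
elim: r x x' F => [|r IH] x x' F; first by rewrite Ex_sum_from0 Ex_meeting0 Ex_pair_sums_nil Ex_sum_from0.
have [/eqP zo|zo] := boolP ((x, x') == (o, o)).
  move: zo => [-> ->]; rewrite Ex_meeting_oo Ex_pair_sums_nil subn0.
  by apply: eq_Ex => t; rewrite add0r.
rewrite Ex_meetingS // Ex_sum_fromS /= -[LHS](Ex_cst (st x)); apply: eq_Ex => x1.
apply: eq_Ex => x1'.
under [RHS]eq_Ex => ls do rewrite /= Ex_pair_sums_cons /= subSS.
rewrite [RHS]Ex_swap -[LHS](Ex_cst (q x1)); apply: eq_Ex => y; rewrite [RHS]Ex_swap.
apply: eq_Ex => y'; rewrite (IH x1 x1').
by apply: eq_Ex => ls; apply: eq_Ex => a; apply: eq_Ex => t; rewrite addrA.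
Qed.

Section Moments.
Variable z : R.
Hypothesis z0 : 0 <= z.
Hypothesis q1 : forall k, Ex (q k) (fun y => `|y%:~R|) <= z.
Hypothesis q2 : forall k, Ex (q k) (fun y => `|y%:~R| ^+ 2) <= z ^+ 2.

(** With [c ^+ 2] as the bound on the second moment, the property is additive over independent
    variables: the cross term is at most [2 * c1 * c2]. *)
Definition moments_le A (d : flaw R A) (f : A -> R) (c : R) :=
  [/\ (forall a, 0 <= f a), Ex d f <= c & Ex d (fun a => f a ^+ 2) <= c ^+ 2].

(** Only domination of [h] by [f + g] in mean is asked, because the modulus of a sum is merely at
    most the sum of the moduli. *)
Lemma moments_le_add A B C (d : flaw R A) (k : flaw R B) (f : A -> R) (g : B -> R)
    (e : flaw R C) (h : C -> R) c1 c2 : moments_le d f c1 -> moments_le k g c2 ->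
  (forall x, 0 <= h x) ->
  Ex e h <= Ex d (fun a => Ex k (fun b => f a + g b)) ->
  Ex e (fun x => h x ^+ 2) <= Ex d (fun a => Ex k (fun b => (f a + g b) ^+ 2)) ->
  moments_le e h (c1 + c2).
Proof.
move=> [f0 f1 f2] [g0 g1 g2] h0 h1 h2; split=> //.
  apply: le_trans h1 _; rewrite (eq_Ex d (g := fun a => f a + Ex k g)).
    by rewrite ExD Ex_cst lerD.
  by move=> a; rewrite ExD Ex_cst.
apply: le_trans h2 _.
rewrite (eq_Ex d (g := fun a => f a ^+ 2 + (2 * Ex k g) * f a + Ex k (fun b => g b ^+ 2))).
  rewrite !ExD ExZ Ex_cst.
  have := Ex_ge0 d f0; have := Ex_ge0 k g0.
  move: (Ex d f) (Ex k g) f1 g1 => u v f1 g1 v0 u0.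
  have : u * v <= c1 * c2 by apply: ler_pM.
  by move: f2 g2; nra.
move=> a; rewrite (eq_Ex k (g := fun b => f a ^+ 2 + (2 * f a) * g b + g b ^+ 2)).
  by rewrite !ExD ExZ Ex_cst; ring.
by move=> b; ring.
Qed.

Lemma q_moments k : moments_le (q k) (fun y => `|y%:~R|) z.
Proof. by split => // a; rewrite normr_ge0. Qed.

Lemma pair_sums_moments ls :
  moments_le (pair_sums ls) (fun a => `|a.1%:~R| + `|a.2%:~R|) (2 * (size ls)%:R * z).
Proof.
have H a : 0 <= `|a.1%:~R| + `|a.2%:~R| :> R by rewrite addr_ge0.
elim: ls => [|[x x'] ls IH].
  by split => //; rewrite Ex_pair_sums_nil /= normr0 ?mulr0 ?mul0r ?addr0 ?expr0n.
have e : 2 * (size ((x, x') :: ls))%:R * z = (z + z) + (2 * (size ls)%:R * z) by rewrite /= -natr1; ring.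
rewrite e.
have qq : moments_le (fbind (q x) (fun y => fmap (fun y' => (y, y')) (q x')))
    (fun p => `|p.1%:~R| + `|p.2%:~R|) (z + z).
  apply: (moments_le_add (q_moments x) (q_moments x')) => //; rewrite Ex_bind le_eqVlt;
  by apply/orP; left; apply/eqP; apply: eq_Ex => y; rewrite Ex_map.
apply: (moments_le_add qq IH) => //; rewrite Ex_pair_sums_cons Ex_bind; apply: Ex_le => y;
  rewrite Ex_map; apply: Ex_le => y' /=; apply: Ex_le => a;
  rewrite ?lerXn2r ?nnegrE ?addr_ge0 //= !rmorphD /=;
  have := ler_normD (y%:~R : R) (a.1)%:~R; have := ler_normD (y'%:~R : R) (a.2)%:~R; lra.
Qed.

Lemma sum_from_moment r x : Ex (sum_from st r x) (fun s => `|s%:~R|) <= r%:R * z.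
Proof.
elim: r x => [|r IH] x; first by rewrite Ex_sum_from0 normr0 mul0r.
rewrite Ex_sum_fromS -[leRHS](Ex_cst (st x)); apply: Ex_le => x'.
apply: (@le_trans _ _ (Ex (q x') (fun y => `|y%:~R| + Ex (sum_from st r x') (fun s => `|s%:~R|)))).
  apply: Ex_le => y; rewrite -[X in _ <= X + _](Ex_cst (sum_from st r x')) -ExD.
  by apply: Ex_le => s; rewrite rmorphD /= ler_normD.
by rewrite ExD Ex_cst -natr1 mulrDl mul1r addrC lerD.
Qed.

End Moments.

Definition mean_size r z := Ex (meeting st r z) (fun ls => (size ls)%:R).

Lemma mean_sizeS r z : z != (o, o) -> mean_size r.+1 z =
  1 + Ex (st z.1) (fun x => Ex (st z.2) (fun x' => mean_size r (x, x'))).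
Proof.
move=> zo; rewrite /mean_size Ex_meetingS // -[X in X + _](Ex_cst (st z.1) 1) -ExD.
apply: eq_Ex => x; rewrite -[X in X + _](Ex_cst (st z.2) 1) -ExD.
apply: eq_Ex => x'; rewrite -[X in X + _](Ex_cst (meeting st r (x, x')) 1) -ExD.
by apply: eq_Ex => ls; rewrite /= -natr1 addrC.
Qed.

Lemma mean_size_oo r : mean_size r (o, o) = 0.
Proof. by rewrite /mean_size Ex_meeting_oo. Qed.

Lemma mean_size_ge0 r z : 0 <= mean_size r z.
Proof. by apply: Ex_ge0 => ls. Qed.

Lemma mean_size_mono r z : mean_size r z <= mean_size r.+1 z <= 1 + mean_size r z.
Proof.
elim: r z => [|r IH] z.
  rewrite [mean_size 0 z]/mean_size Ex_meeting0 /= mean_size_ge0 addr0 /=.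
  have [/eqP ->|zo] := boolP (z == (o, o)); first by rewrite mean_size_oo.
  rewrite mean_sizeS // -[leRHS]addr0 lerD2l.
  rewrite (eq_Ex _ (g := fun=> 0)) ?Ex_cst // => x.
  by rewrite (eq_Ex _ (g := fun=> 0)) ?Ex_cst // => x'; rewrite /mean_size Ex_meeting0.
have [/eqP ->|zo] := boolP (z == (o, o)); first by rewrite !mean_size_oo; lra.
rewrite !(mean_sizeS _ zo); apply/andP; split; rewrite lerD2l.
  by apply: Ex_le => x; apply: Ex_le => x'; case/andP: (IH (x, x')).
rewrite -[X in _ <= X + _](Ex_cst (st z.1)) -ExD; apply: Ex_le => x.
rewrite -[X in _ <= X + _](Ex_cst (st z.2)) -ExD; apply: Ex_le => x'.
by case/andP: (IH (x, x')).
Qed.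

Lemma mean_size_le r r' z : (r <= r')%N -> mean_size r z <= mean_size r' z.
Proof.
move=> /subnK <-; elim: (r' - r)%N => // k IH.
by rewrite (le_trans IH) // addSn; case/andP: (mean_size_mono (k + r) z).
Qed.

Variable pi : flaw R S.
Hypothesis statio : forall F, Ex pi (fun x => Ex (st x) F) = Ex pi F.

(* X' is still stationary when X first reaches [o], so starting X in [o] rather than
   in another state can only shorten the wait for the pair. *)
Lemma mean_size_pi_o r x :
  Ex pi (fun v => mean_size r (o, v)) <= Ex pi (fun v => mean_size r (x, v)).
Proof.
elim: r x => [|r IH] x; first by apply: Ex_le => v; rewrite /mean_size !Ex_meeting0.
have [-> //|xo] := eqVneq x o.
(* The 1 spent by the first move from [x] pays for the extra step allowed on the left, and after
   that move the second chain is stationary again. *)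
apply: (@le_trans _ _ (1 + Ex pi (fun v => mean_size r (o, v)))).
  rewrite -[X in _ <= X + _](Ex_cst pi) -ExD; apply: Ex_le => v.
  by case/andP: (mean_size_mono r (o, v)).
rewrite [leRHS](eq_Ex pi (g := fun v => 1 + Ex (st v) (fun v' => Ex (st x) (fun x1 => mean_size r (x1, v'))))).
  rewrite ExD Ex_cst lerD2l statio Ex_swap -[leLHS](Ex_cst (st x)).
  exact: Ex_le.
by move=> v; rewrite mean_sizeS ?xpair_eqE ?(negPf xo) //= Ex_swap.
Qed.

End Chains.
Arguments sum_from : simpl never.
Arguments meeting : simpl never.
Arguments pair_sums : simpl never.

(** * Lipschitz functions and the coupling of windows *)

Section IntLipschitz.
Variable R : realType.

Lemma int_lipschitz_nat (G : int -> R) (H B : R) (j : int) (p : nat) :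
  (forall t, j <= t < j + p%:Z -> `|G (t + 1) - G t - H| <= B) ->
  `|G (j + p%:Z) - G j - p%:R * H| <= p%:R * B.
Proof.
elim: p => [|p IH] GB; first by rewrite addr0 subrr !mul0r subr0 normr0.
have {}IH := IH _; rewrite -natr1 !mulrDl !mul1r.
have -> : G (j + p.+1%:Z) - G j - (p%:R * H + H) =
  (G (j + p%:Z) - G j - p%:R * H) + (G (j + p%:Z + 1) - G (j + p%:Z) - H).
  by rewrite (_ : j + p.+1%:Z = j + p%:Z + 1); [ring | lia].
rewrite (le_trans (ler_normD _ _)) // lerD //; first by apply: IH => t Ht; apply: GB; lia.
by apply: GB; lia.
Qed.

(** The slope condition is asked only on a ball containing the interval between [j] and [k], because
    the slope error in [near_stationary] grows with the modulus of the point. *)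
Lemma int_lipschitz (G : int -> R) (H B : R) (k j : int) :
  (forall t, `|t| <= `|k| + `|j| -> `|G (t + 1) - G t - H| <= B) ->
  `|G k - G j - (k - j)%:~R * H| <= `|(k - j)%:~R| * B.
Proof.
wlog jk : k j / j <= k => [hw GB|GB].
  have [jk|kj] := leP j k; first exact: hw.
  rewrite -normrN; have -> : - (G k - G j - (k - j)%:~R * H) = G j - G k - (j - k)%:~R * H.
    by rewrite -[j - k]opprB rmorphN /=; ring.
  rewrite -[k - j]opprB rmorphN normrN /=; apply: hw => [|t Ht]; first exact: ltW.
  by apply: GB; rewrite addrC.
have [p kE] : exists p : nat, k = j + p%:Z by exists `|k - j|%N; lia.
have -> : k - j = p%:Z by lia.
rewrite kE -pmulrn normr_nat; apply: int_lipschitz_nat => t Ht; apply: GB; lia.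
Qed.
End IntLipschitz.

Section TwoSided.
Variables (R : realType) (S : eqType) (o : S) (q : S -> flaw R int).
Variables (pi : flaw R S) (fw bw : S -> flaw R S).
Hypothesis reversal : forall F : S -> S -> R,
  Ex pi (fun x => Ex (fw x) (F x)) = Ex pi (fun x' => Ex (bw x') (fun x => F x x')).

Local Notation SF := (sum_from q).
Local Notation PS := (pair_sums q).
Local Notation ME := (meeting o).

Lemma stationary_fw F : Ex pi (fun x => Ex (fw x) F) = Ex pi F.
Proof. by rewrite (reversal (fun _ => F)); apply: eq_Ex => x; rewrite Ex_cst. Qed.

Lemma stationary_bw F : Ex pi (fun x => Ex (bw x) F) = Ex pi F.
Proof. by rewrite -(reversal (fun x _ => F x)); apply: eq_Ex => x; rewrite Ex_cst. Qed.

(* The state at the distinguished time has law [pi]; [l] values precede it and [r] follow it.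
   [F] is applied to the value at that time and to the sum of all [l + r + 1] values. *)
Definition window l r (F : int -> int -> R) :=
  Ex pi (fun x => Ex (q x) (fun y => Ex (SF bw l x) (fun s =>
    Ex (SF fw r x) (fun t => F y (s + y + t))))).

(** By [reversal], a stationary state followed by a step back is a step forward read from its end,
    so the mark can move by one position while the total keeps its law. *)
Lemma window_shift l r f : window l.+1 r (fun=> f) = window l r.+1 (fun=> f).
Proof.
transitivity (Ex pi (fun x' => Ex (bw x') (fun x => Ex (q x') (fun y' => Ex (q x) (fun y =>
   Ex (SF bw l x) (fun s => Ex (SF fw r x') (fun t => f (y + s + y' + t)))))))).
  apply: eq_Ex => x'; rewrite [RHS]Ex_swap; apply: eq_Ex => y'.
  by rewrite Ex_sum_fromS.
rewrite -(reversal (fun x x' => Ex (q x') (fun y' => Ex (q x) (fun y =>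
   Ex (SF bw l x) (fun s => Ex (SF fw r x') (fun t => f (y + s + y' + t))))))).
apply: eq_Ex => x; under [RHS]eq_Ex do under eq_Ex do rewrite Ex_sum_fromS.
under [RHS]eq_Ex do rewrite Ex_swap; rewrite [RHS]Ex_swap; apply: eq_Ex => x'.
under [RHS]eq_Ex do rewrite Ex_swap; rewrite [RHS]Ex_swap; apply: eq_Ex => y'.
apply: eq_Ex => y; apply: eq_Ex => s; apply: eq_Ex => t; congr f; ring.
Qed.

Lemma window_eq l r l' r' f : (l + r = l' + r')%N ->
  window l r (fun=> f) = window l' r' (fun=> f).
Proof.
have E k p : window k p (fun=> f) = window 0 (k + p) (fun=> f).
  by elim: k p => // k IH p; rewrite window_shift IH addnS addSn.
by move=> e; rewrite E e -E.
Qed.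

(** Once both ends of the span are known to be at [o], the sums on its two sides are independent by
    the Markov property. *)
Definition outer l r : flaw R int :=
  fbind (SF bw l o) (fun s => fmap (fun t => s + t) (SF fw r o)).

Lemma Ex_outer l r F : Ex (outer l r) F =
  Ex (SF bw l o) (fun s => Ex (SF fw r o) (fun t => F (s + t))).
Proof. by rewrite Ex_bind; apply: eq_Ex => s; rewrite Ex_map. Qed.

(* Two chains are run up to their meetings on either side; [p] selects the chain whose values are
   summed inside, and the values outside are common to both. *)
Definition coupling zl zr l r (p : int * int -> int) (F : int -> R) :=
  Ex (ME bw l zl) (fun ll => Ex (ME fw r zr) (fun rr =>
    Ex (PS ll) (fun a => Ex (PS rr) (fun c =>
      Ex (outer (l - size ll) (r - size rr)) (fun v => F (p a + p c + v)))))).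

Lemma couplingE zl zr l r x x' p (F : int -> R) :
  (forall G, Ex (SF bw l x) G = Ex (ME bw l zl) (fun ls => Ex (PS ls) (fun a =>
    Ex (SF bw (l - size ls) o) (fun t => G (p a + t))))) ->
  (forall G, Ex (SF fw r x') G = Ex (ME fw r zr) (fun ls => Ex (PS ls) (fun a =>
    Ex (SF fw (r - size ls) o) (fun t => G (p a + t))))) ->
  Ex (SF bw l x) (fun s => Ex (SF fw r x') (fun t => F (s + t))) = coupling zl zr l r p F.
Proof.
move=> El Er; rewrite El; apply: eq_Ex => ll; rewrite [RHS]Ex_swap; apply: eq_Ex => a.
under eq_Ex do rewrite Er; rewrite Ex_swap; apply: eq_Ex => rr.
rewrite Ex_swap; apply: eq_Ex => c; rewrite Ex_outer; apply: eq_Ex => s; apply: eq_Ex => t.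
by congr F; ring.
Qed.

Lemma coupling1 zl zr l r F :
  Ex (SF bw l zl.1) (fun s => Ex (SF fw r zr.1) (fun t => F (s + t))) =
  coupling zl zr l r fst F.
Proof.
case: zl zr => [xl xl'] [xr xr']; apply: couplingE => G; exact: sum_from_meeting1.
Qed.

Lemma coupling2 zl zr l r F :
  Ex (SF bw l zl.2) (fun s => Ex (SF fw r zr.2) (fun t => F (s + t))) =
  coupling zl zr l r snd F.
Proof.
case: zl zr => [xl xl'] [xr xr']; apply: couplingE => G; exact: sum_from_meeting2.
Qed.

(** Unlike in [sum_from], the final state is kept, since the right end of the window continues from
    it. *)
Fixpoint walk d (u : S) : flaw R (S * int) :=
  if d is d'.+1 then fbind (fw u) (fun x => fbind (q x) (fun y =>
    fmap (fun p => (p.1, y + p.2)) (walk d' x)))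
  else fret R (u, 0).
Arguments walk : simpl never.

Lemma Ex_walk0 u F : Ex (walk 0 u) F = F (u, 0).
Proof. exact: Ex_ret. Qed.

Lemma Ex_walkS d u F : Ex (walk d.+1 u) F =
  Ex (fw u) (fun x => Ex (q x) (fun y => Ex (walk d x) (fun p => F (p.1, y + p.2)))).
Proof.
by rewrite [LHS]Ex_bind; apply: eq_Ex => x; rewrite Ex_bind; apply: eq_Ex => y; rewrite Ex_map.
Qed.

Lemma sum_from_walk d r u f : Ex (SF fw (d + r) u) f =
  Ex (walk d u) (fun p => Ex (SF fw r p.1) (fun s => f (p.2 + s))).
Proof.
elim: d u f => [|d IH] u f; first by rewrite Ex_walk0; apply: eq_Ex => s; rewrite add0r.
rewrite addSn Ex_sum_fromS Ex_walkS; apply: eq_Ex => x; apply: eq_Ex => y; rewrite IH.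
by apply: eq_Ex => p; apply: eq_Ex => s; rewrite addrA.
Qed.

Lemma walk_stationary d G : Ex pi (fun u => Ex (walk d u) (fun p => G p.1)) = Ex pi G.
Proof.
elim: d G => [|d IH] G; first by apply: eq_Ex => u; rewrite Ex_walk0.
rewrite -[RHS]IH -[RHS]stationary_fw; apply: eq_Ex => u; rewrite Ex_walkS.
by apply: eq_Ex => x; rewrite /= Ex_cst.
Qed.

Variable z : R.
Hypothesis z_ge1 : 1 <= z.
Hypothesis q1 : forall k, Ex (q k) (fun y => `|y%:~R|) <= z.
Hypothesis q2 : forall k, Ex (q k) (fun y => `|y%:~R| ^+ 2) <= z ^+ 2.
Hypothesis q3 : forall k, Ex (q k) (fun y => `|y%:~R| ^+ 3) <= z ^+ 3.

Let z_ge0 : 0 <= z. Proof. exact: le_trans z_ge1. Qed.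

(** Given the states, the values are independent of the weight and each has mean modulus at most
    [z]. The weight will be the probability that enough values remain outside after the meetings. *)
Lemma walk_moment d u phi : (forall v, 0 <= phi v) ->
  Ex (walk d u) (fun p => `|p.2%:~R| * phi p.1) <=
  d%:R * z * Ex (walk d u) (fun p => phi p.1).
Proof.
move=> phi0; elim: d u => [|d IH] u; first by rewrite !Ex_walk0 normr0 !mul0r.
rewrite !Ex_walkS -ExZ; apply: Ex_le => x; rewrite /= Ex_cst.
apply: (@le_trans _ _ (Ex (q x) (fun y => `|y%:~R| * Ex (walk d x) (fun p => phi p.1)) +
    Ex (walk d x) (fun p => `|p.2%:~R| * phi p.1))).
  rewrite -[X in _ <= _ + X](Ex_cst (q x)) -ExD; apply: Ex_le => y.
  rewrite -ExZ -ExD; apply: Ex_le => p /=; rewrite -mulrDl ler_wpM2r // rmorphD /=.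
  exact: ler_normD.
rewrite ExZr -natr1 2!mulrDl mul1r addrC lerD // ler_wpM2r //.
exact: Ex_ge0.
Qed.

Variables (b : R) (m : nat).

(** A bound on [beta] in dual form. All lengths [r >= m] are covered because values added later
    cannot increase the distance. *)
Definition smooth (st : S -> flaw R S) := forall r (h : int -> R), (m <= r)%N ->
  (forall j, `|h j| <= 1) ->
  `|Ex (SF st r o) (fun s => h (s + 1)) - Ex (SF st r o) h| <= b.

Hypotheses (smooth_fw : smooth fw) (smooth_bw : smooth bw).

Let b_ge0 : 0 <= b.
Proof.
apply: le_trans (normr_ge0 _) (smooth_fw (h := fun=> 0) (leqnn m) _) => j.
by rewrite normr0.
Qed.

Lemma smooth_shift st r h k j : smooth st -> (m <= r)%N -> (forall j, `|h j| <= 1) ->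
  `|Ex (SF st r o) (fun s => h (k + s)) - Ex (SF st r o) (fun s => h (j + s))|
    <= b * `|(k - j)%:~R|.
Proof.
move=> sm mr h1.
have := @int_lipschitz R (fun t => Ex (SF st r o) (fun s => h (t + s))) 0 b k j.
rewrite mulr0 subr0 mulrC; apply => t _; rewrite subr0.
rewrite (eq_Ex _ (g := fun s => h (t + (s + 1)))); first exact: (sm _ (fun s => h (t + s))).
by move=> s; congr h; ring.
Qed.

(** One long side suffices: given the sum on the other side, the test function is only
    translated. *)
Lemma outer_shift l r h k j : (m <= l)%N || (m <= r)%N -> (forall j, `|h j| <= 1) ->
  `|Ex (outer l r) (fun s => h (k + s)) - Ex (outer l r) (fun s => h (j + s))|
    <= b * `|(k - j)%:~R|.
Proof.
move=> /orP[ml|mr] h1; rewrite !Ex_outer.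
  have := smooth_shift (h := fun s => Ex (SF fw r o) (fun t => h (s + t))) k j smooth_bw ml.
  under eq_Ex do under eq_Ex do rewrite -addrA.
  under [X in `|_ - X|]eq_Ex do under eq_Ex do rewrite -addrA.
  by apply => i; apply: Ex_norm_le.
rewrite -ExB; apply: Ex_norm_le => s.
have := smooth_shift (h := fun t => h (s + t)) k j smooth_fw mr.
under eq_Ex do rewrite addrCA; under [X in `|_ - X|]eq_Ex do rewrite addrCA.
exact.
Qed.

(* The atoms of the law of [S_m] weigh at most [b / 2], while [E |S_m| <= m z]. *)
Lemma smooth_lower_bound n : (4 * m <= n)%N -> (3 < n)%N -> 4 <= 5 / 2 * b * z * n%:R.
Proof.
move=> mn n3.
pose p k := Ex (SF fw m o) (fun s => (s == k)%:R : R).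
have pb k : p k <= b / 2.
  (* The sign function that jumps just after [k] increases by 2 from [s] to [s + 1] when [s = k],
     and is unchanged otherwise. *)
  have := smooth_fw (h := fun j => if k < j then 1 else -1) (leqnn m).
  rewrite -ExB (eq_Ex _ (g := fun s => 2 * (s == k)%:R)).
    rewrite ExZ -/(p k) => /(_ _) H.
    have /H : forall j : int, `|if k < j then 1 else -1 : R| <= 1.
      by move=> j; case: ifP; rewrite ?normrN normr1.
    have := ler_norm (2 * p k); lra.
  move=> s; rewrite ltzD1; case: (ltgtP k s) => //= _; rewrite ?mulr0 ?mulr1; ring.
pose p0 t := Ex (SF fw m o) (fun s => (`|s| <= t%:Z)%R%:R : R).
have p0b t : p0 t <= (2 * t + 1)%:R * (b / 2).
  elim: t => [|t IH].
    rewrite mul1r; apply: le_trans (pb 0); apply: Ex_le => s.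
    by rewrite normr_le0.
  apply: (@le_trans _ _ (p0 t + p t.+1%:Z + p (- t.+1%:Z))).
    rewrite -!ExD; apply: Ex_le => s; rewrite -!natrD ler_nat.
    by lia.
  have := pb t.+1%:Z; have := pb (- t.+1%:Z); move: IH.
  rewrite !natrD !natrM -natr1; lra.
(* The mean modulus is at least the sum over [i < t] of the probabilities that the modulus exceeds
   [i]. The [2 i + 1] atoms in [[-i, i]] weigh at most [b / 2] each, and the odd numbers add up to
   [t ^ 2]. *)
have low t : t%:R - t%:R ^+ 2 * (b / 2) <= m%:R * z.
  apply: le_trans _ (sum_from_moment fw q1 m o).
  apply: (@le_trans _ _ (Ex (SF fw m o) (fun s => \sum_(i < t) (1 - (`|s| <= i%:Z)%R%:R)))).
    rewrite /Ex; under eq_bigr do rewrite big_distrr /=.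
    rewrite exchange_big /=.
    apply: (@le_trans _ _ (\sum_(i < t) (1 - (2 * i + 1)%:R * (b / 2)))).
      rewrite big_split /= sumr_const card_ord sumrN -mulr_suml -natr_sum.
      suff -> : (\sum_(i < t) (2 * i + 1) = t ^ 2)%N by rewrite natrX.
      by elim: t => [|t IH]; rewrite ?big_ord0 // big_ord_recr /= IH -!mulnn; nia.
    apply: ler_sum => i _; have := p0b i; rewrite -/(Ex _ (fun s => 1 - (`|s| <= i%:Z)%R%:R)).
    by rewrite ExB Ex_cst /p0; lra.
  apply: Ex_le => s; rewrite -intr_norm -abszE -pmulrn.
  apply: (@le_trans _ _ (\sum_(i < t) (i < `|s|)%N%:R)).
    apply: ler_sum => i _; rewrite abszE lez_nat leqNgt; case: (_ < _)%N => /=; lra.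
  rewrite -natr_sum ler_nat; apply: (@leq_trans (minn t `|s|)); last exact: geq_minr.
  elim: t => [|t IH]; first by rewrite big_ord0.
  by move: IH; rewrite big_ord_recr /=; move: (absz s) => u; case: (ltnP t u) => /=; lia.
pose w : R := n%:R * z / 4.
have w1 : 1 <= w.
  have : (4%:R : R) <= n%:R by rewrite ler_nat.
  by move=> n4; have : 4 * 1 <= n%:R * z; [apply: ler_pM | rewrite /w; lra].
(* For [w >= 1] and [t] in [[2 w, 2 w + 1]] one has [t ^ 2 <= 5 w (t - w)], so that
   [2 (t - w) <= t ^ 2 b] yields [2 <= 5 w b]. *)
have [t [t1 t2]] : exists t : nat, 2 * w <= t%:R /\ t%:R <= 2 * w + 1.
  exists (Num.truncn (2 * w)).+1.
  have /andP[h1 h2] : (Num.truncn (2 * w))%:R <= 2 * w < (Num.truncn (2 * w)).+1%:R by apply: truncn_itv; lra.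
  by rewrite -natr1 in h2 *; split; lra.
have mw : m%:R * z <= w.
  have : (4 * m)%:R <= n%:R :> R by rewrite ler_nat.
  rewrite natrM /w => h; have : 4 * m%:R * z <= n%:R * z by rewrite ler_wpM2r.
  lra.
have := low t; move: (t%:R) t1 t2 => T t1 t2 lowT.
have TT : T ^+ 2 <= 5 * w * (T - w) by nra.
have bT : 2 * (T - w) <= T ^+ 2 * b by lra.
have {}bT : 2 * (T - w) <= 5 * w * (T - w) * b by apply: le_trans bT _; rewrite ler_wpM2r.
have : 2 <= 5 * w * b by rewrite -(@ler_pM2l _ (T - w)); [lra|lra].
rewrite /w; lra.
Qed.

Lemma window_walk l d r f : window l (d + r) (fun=> f) =
  Ex pi (fun u => Ex (q u) (fun y => Ex (walk d u) (fun p =>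
    Ex (SF bw l u) (fun s => Ex (SF fw r p.1) (fun t => f (y + p.2 + (s + t))))))).
Proof.
apply: eq_Ex => u; apply: eq_Ex => y; rewrite [RHS]Ex_swap; apply: eq_Ex => s.
rewrite sum_from_walk; apply: eq_Ex => p; apply: eq_Ex => t; congr f; ring.
Qed.

(** The window of [n] values is cut into [l] values, a gap of [n - l - r] values and [r] values. On
    each side a chain started in [o] runs to its meeting with the stationary chain of the window,
    and from there on the two share their values. The totals then differ by [t], the gap and the
    values before the meetings, and [b] bounds the effect of such a shift. *)
Lemma near_stationary n l r t h : m = (n %/ 4)%N -> (l + r < n)%N ->
  (forall j, `|h j| <= 1) ->
  `|Ex (outer l r) (fun v => h (t + v)) - window l (n.-1 - l) (fun=> h)| <=
  b * `|t%:~R| + 5 / 2 * b * z * ((n - l - r)%:R + Ex pi (fun u => mean_size o bw l (o, u))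
    + Ex pi (fun v => mean_size o fw r (o, v))).
Proof.
move=> mE lrn h1; pose d := (n.-1 - l - r)%N.
have -> : (n.-1 - l = d + r)%N by rewrite /d; lia.
have -> : (n - l - r = d.+1)%N by rewrite /d; lia.
rewrite window_walk.
pose diff u y (p : S * int) := coupling (o, u) (o, p.1) l r fst (fun v => h (t + v)) -
  coupling (o, u) (o, p.1) l r snd (fun v => h (y + p.2 + v)).
have -> : Ex (outer l r) (fun v => h (t + v)) - Ex pi (fun u => Ex (q u) (fun y =>
    Ex (walk d u) (fun p => Ex (SF bw l u) (fun s => Ex (SF fw r p.1)
      (fun t => h (y + p.2 + (s + t))))))) =
  Ex pi (fun u => Ex (q u) (fun y => Ex (walk d u) (diff u y))).
  rewrite -[X in X - _](Ex_cst pi) -ExB; apply: eq_Ex => u.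
  rewrite -[X in X - _](Ex_cst (q u)) -ExB; apply: eq_Ex => y.
  rewrite -[X in X - _](Ex_cst (walk d u)) -ExB; apply: eq_Ex => p.
  rewrite /diff -coupling1 -(coupling2 _ _ _ _ (fun v => h (y + p.2 + v))) /=.
  by rewrite Ex_outer.
(* [chi] marks the good case, in which at least [m] values remain on one side after the meetings, so
   that [outer_shift] applies. *)
pose chi (ll rr : seq (S * S)) : R := ((m <= l - size ll) || (m <= r - size rr))%N%:R.
pose phi u v := Ex (ME bw l (o, u)) (fun ll => Ex (ME fw r (o, v)) (chi ll)).
have phi01 u v : 0 <= phi u v <= 1.
  rewrite Ex_ge0 => [|ll]; last by apply: Ex_ge0 => rr; exact: ler0n.
  rewrite -[X in _ <= X](Ex_cst (ME bw l (o, u))); apply: Ex_le => ll.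
  rewrite -[X in _ <= X](Ex_cst (ME fw r (o, v))); apply: Ex_le => rr.
  by rewrite /chi; case: (_ || _).
pose tau : R := d.+1%:R.
pose msl u := mean_size o bw l (o, u); pose msr v := mean_size o fw r (o, v).
have diff_le u y p : `|diff u y p| <= b * `|t%:~R| + b * (`|y%:~R| + `|p.2%:~R|) * phi u p.1
    + 5 / 2 * b * z * tau * (1 - phi u p.1) + 5 / 2 * b * z * (msl u + msr p.1).
  pose Q (ll rr : seq (S * S)) : R := b * `|t%:~R| + b * (`|y%:~R| + `|p.2%:~R|) * chi ll rr
    + 5 / 2 * b * z * tau * (1 - chi ll rr) + 5 / 2 * b * z * ((size ll)%:R + (size rr)%:R).
  apply: (@le_trans _ _ (Ex (ME bw l (o, u)) (fun ll => Ex (ME fw r (o, p.1)) (Q ll)))).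
    rewrite /diff /coupling -ExB; apply: le_trans (Ex_norm _ _) _; apply: Ex_le => ll.
    rewrite -ExB; apply: le_trans (Ex_norm _ _) _; apply: Ex_le => rr.
    rewrite /Q /chi; have [good|bad] := boolP ((m <= l - size ll) || (m <= r - size rr))%N.
      apply: (@le_trans _ _ (b * (`|t%:~R| + `|y%:~R| + `|p.2%:~R|) +
          b * (2 * (size ll)%:R * z + 2 * (size rr)%:R * z))).
        have [_ Ml _] := pair_sums_moments q1 q2 ll; have [_ Mr _] := pair_sums_moments q1 q2 rr.
        pose fA (a : int * int) : R := `|a.1%:~R| + `|a.2%:~R|.
        apply: le_trans (lerD (lexx _) (ler_wpM2l b_ge0 (lerD Ml Mr))).
        rewrite -/fA.
        have -> : b * (`|t%:~R| + `|y%:~R| + `|p.2%:~R|) + b * (Ex (PS ll) fA + Ex (PS rr) fA) =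
            Ex (PS ll) (fun a => Ex (PS rr) (fun c =>
              b * (`|t%:~R| + `|y%:~R| + `|p.2%:~R|) + b * (fA a + fA c))).
          rewrite [RHS](eq_Ex (PS ll) (g := fun a => b * (`|t%:~R| + `|y%:~R| + `|p.2%:~R|) +
            b * (fA a + Ex (PS rr) fA))); first by rewrite [RHS]ExD Ex_cst ExZ [in RHS]ExD Ex_cst.
          by move=> a; rewrite [LHS]ExD Ex_cst ExZ [in LHS]ExD Ex_cst.
        rewrite -ExB; apply: le_trans (Ex_norm _ _) _; apply: Ex_le => a.
        rewrite -ExB; apply: le_trans (Ex_norm _ _) _; apply: Ex_le => c.
        have := outer_shift (t + (a.1 + c.1)) (y + p.2 + (a.2 + c.2)) good h1.
        under eq_Ex do rewrite -addrA; under [X in `|_ - X|]eq_Ex do rewrite -addrA.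
        move=> /le_trans; apply; rewrite -mulrDr ler_wpM2l // !rmorphB !rmorphD /=.
        have := ler_normB (t%:~R + (a.1%:~R + c.1%:~R) : R) (y%:~R + p.2%:~R + (a.2%:~R + c.2%:~R)).
        have := ler_normD (t%:~R : R) (a.1%:~R + c.1%:~R).
        have := ler_normD (a.1%:~R : R) (c.1%:~R).
        have := ler_normD (y%:~R + p.2%:~R : R) (a.2%:~R + c.2%:~R).
        have := ler_normD (a.2%:~R : R) (c.2%:~R).
        have := ler_normD (y%:~R : R) (p.2%:~R).
        by rewrite /fA; lra.
      rewrite subrr mulr0 addr0 mulr1.
      have : 0 <= b * z * ((size ll)%:R + (size rr)%:R) by rewrite !mulr_ge0 ?addr_ge0.
      lra.
    rewrite mulr0 subr0 mulr1 addr0; move: bad; rewrite negb_or -!ltnNge => /andP[bl br].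
    have n3 : (3 < n)%N by move: bl; rewrite mE; lia.
    have lb := @smooth_lower_bound n _ n3.
    have {}lb : 4 <= 5 / 2 * b * z * n%:R by apply: lb; rewrite mE; lia.
    (* Fewer than a quarter of the values remain on either side, so the gap and the two runs make up
       at least half of them. With [lb] this absorbs the trivial bound 2. *)
    have len : (n%:R : R) <= 2 * (tau + (size ll)%:R + (size rr)%:R).
      by rewrite /tau -!natrD -natrM ler_nat /d; move: bl br; rewrite mE; lia.
    apply: (@le_trans _ _ 2).
      have -> : (2 : R) = 1 + 1 by [].
      apply: le_trans (ler_normB _ _) _; apply: lerD; apply: Ex_norm_le => a;
      by apply: Ex_norm_le => c; apply: Ex_norm_le => v.
    have bz : 0 <= 5 / 2 * b * z by have : 0 <= b * z; [rewrite mulr_ge0 | lra].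
    have := ler_wpM2l bz len; have := mulr_ge0 b_ge0 (normr_ge0 (t%:~R : R)); lra.
  rewrite le_eqVlt; apply/orP; left; apply/eqP; rewrite /Q.
  transitivity (Ex (ME bw l (o, u)) (fun ll => b * `|t%:~R| + b * (`|y%:~R| + `|p.2%:~R|) *
    Ex (ME fw r (o, p.1)) (chi ll) + 5 / 2 * b * z * tau * (1 - Ex (ME fw r (o, p.1)) (chi ll))
    + 5 / 2 * b * z * ((size ll)%:R + msr p.1))).
    by apply: eq_Ex => ll; rewrite !ExD !ExZ ExB ExD !Ex_cst.
  by rewrite !ExD !ExZ ExB ExD !Ex_cst.
apply: (@le_trans _ _ (Ex pi (fun u => b * `|t%:~R| + 5 / 2 * b * z * tau
    + 5 / 2 * b * z * (msl u + Ex (walk d u) (fun p => msr p.1))))).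
  apply: le_trans (Ex_norm _ _) _; apply: Ex_le => u.
  pose Phi := Ex (walk d u) (fun p => phi u p.1).
  have /andP[Phi0 Phi1] : 0 <= Phi <= 1.
    rewrite Ex_ge0 => [|p]; last by case/andP: (phi01 u p.1).
    by rewrite -[X in _ <= X](Ex_cst (walk d u)); apply: Ex_le => p; case/andP: (phi01 u p.1).
  pose M2 := Ex (walk d u) (fun p => `|p.2%:~R| * phi u p.1).
  pose Mr := Ex (walk d u) (fun p => msr p.1).
  (* The gap costs at most [b z tau] in the good case and [5 / 2 b z tau] in the bad one. Keeping
     the weight [phi] inside the moment of the walk makes the total an average of the two costs, not
     their sum. *)
  have M2le : M2 <= d%:R * z * Phi.
    by apply: walk_moment => v; case/andP: (phi01 u v).
  apply: (@le_trans _ _ (Ex (q u) (fun y => b * `|t%:~R| + (b * Phi) * `|y%:~R| + b * M2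
    + 5 / 2 * b * z * tau * (1 - Phi) + 5 / 2 * b * z * (msl u + Mr)))).
    apply: le_trans (Ex_norm _ _) _; apply: Ex_le => y.
    apply: le_trans (Ex_norm _ _) _; apply: le_trans (Ex_le _ (diff_le u y)) _.
    rewrite (eq_Ex _ (g := fun p : S * int => b * `|t%:~R| + (b * `|y%:~R|) * phi u p.1 +
       b * (`|p.2%:~R| * phi u p.1) + 5 / 2 * b * z * tau * (1 - phi u p.1)
       + 5 / 2 * b * z * (msl u + msr p.1))).
      rewrite !ExD !ExZ ExB ExD !Ex_cst -/Phi -/M2 -/Mr; lra.
    by move=> p; ring.
  rewrite !ExD (ExZ _ (b * Phi)) !Ex_cst -/Mr.
  have bPhi : 0 <= b * Phi by rewrite mulr_ge0.
  have H1 := ler_wpM2l bPhi (q1 u); have H2 := ler_wpM2l b_ge0 M2le.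
  have : 0 <= b * z * (d%:R + 1) * Phi by rewrite !mulr_ge0 ?addr_ge0.
  have tauE : tau = d%:R + 1 by rewrite /tau -natr1.
  rewrite tauE; lra.
rewrite !ExD !ExZ ExD !Ex_cst (walk_stationary d msr) -/tau; lra.
Qed.

(** The law of [tau], with the search for the meetings cut off at the ends of the window. *)
Definition span_law l r : flaw R nat :=
  fbind pi (fun x => fbind pi (fun x' => fbind (ME bw l (x, x')) (fun ll =>
    fmap (fun rr => (size ll + size rr).+1) (ME fw r (x, x'))))).

Lemma Ex_span_law l r F : Ex (span_law l r) F = Ex pi (fun x => Ex pi (fun x' =>
  Ex (ME bw l (x, x')) (fun ll => Ex (ME fw r (x, x')) (fun rr =>
    F (size ll + size rr).+1)))).
Proof.
rewrite Ex_bind; apply: eq_Ex => x; rewrite Ex_bind; apply: eq_Ex => x'.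
by rewrite Ex_bind; apply: eq_Ex => ll; rewrite Ex_map.
Qed.

Lemma Ex_mul A B (d : flaw R A) (e : flaw R B) f g :
  Ex d f * Ex e g = Ex d (fun a => Ex e (fun c => f a * g c)).
Proof. by rewrite -ExZr; apply: eq_Ex => a; rewrite ExZ. Qed.

(* Inside the span of the meetings nearest to the distinguished time, [F] receives the values of
   the two chains at that time, the lengths of the span to the left and to the right, and the two sums. *)
Definition swapped l r (F : int -> int -> nat -> nat -> int -> int -> R) :=
  Ex pi (fun x => Ex pi (fun x' => Ex (ME bw l (x, x')) (fun ll =>
    Ex (ME fw r (x, x')) (fun rr => Ex (q x) (fun y => Ex (q x') (fun y' =>
      Ex (PS ll) (fun a => Ex (PS rr) (fun c =>
        F y y' (size ll) (size rr) (a.1 + c.1) (a.2 + c.2))))))))).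

(** The product of the means is a mean over an independent copy. Rewriting the original by
    [coupling1] and the copy by [coupling2] gives both the same sum outside the span. *)
Lemma window_cov l r g :
  window l r (fun y w => y%:~R * g w) - window l r (fun y _ => y%:~R) * window l r (fun=> g) =
  swapped l r (fun y y' k p s s' => y%:~R * (Ex (outer (l - k) (r - p)) (fun v => g (y + s + v))
     - Ex (outer (l - k) (r - p)) (fun v => g (y' + s' + v)))).
Proof.
pose I x y := Ex (SF bw l x) (fun s => Ex (SF fw r x) (fun t => g (y + (s + t)))).
have gI : window l r (fun=> g) = Ex pi (fun x => Ex (q x) (I x)).
  apply: eq_Ex => x; apply: eq_Ex => y; apply: eq_Ex => s; apply: eq_Ex => t.
  by congr g; ring.
have -> : window l r (fun y w => y%:~R * g w) = Ex pi (fun x => Ex (q x) (fun y => y%:~R * I x y)).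
  apply: eq_Ex => x; apply: eq_Ex => y; rewrite /I -ExZ; apply: eq_Ex => s; rewrite -ExZ.
  by apply: eq_Ex => t; congr (_ * g _); ring.
have -> : window l r (fun y _ => y%:~R) = Ex pi (fun x => Ex (q x) (fun y => y%:~R)).
  by apply: eq_Ex => x; apply: eq_Ex => y; rewrite !Ex_cst.
rewrite gI Ex_mul -ExB; apply: eq_Ex => x.
under [X in _ - X]eq_Ex do rewrite Ex_mul.
rewrite -[X in X - _](Ex_cst pi) -ExB; apply: eq_Ex => x'.
transitivity (Ex (q x) (fun y => Ex (q x') (fun y' => y%:~R * (I x y - I x' y')))).
  rewrite -ExB; apply: eq_Ex => y; rewrite -[X in X - _](Ex_cst (q x')) -ExB.
  by apply: eq_Ex => y'; rewrite mulrBr.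
under [RHS]eq_Ex do rewrite Ex_swap; rewrite [RHS]Ex_swap; apply: eq_Ex => y.
under [RHS]eq_Ex do rewrite Ex_swap; rewrite [RHS]Ex_swap; apply: eq_Ex => y'.
rewrite /I (coupling1 (x, x') (x, x') l r (fun v => g (y + v))).
rewrite (coupling2 (x, x') (x, x') l r (fun v => g (y' + v))) /coupling.
rewrite -ExB -ExZ; apply: eq_Ex => ll; rewrite -ExB -ExZ; apply: eq_Ex => rr.
rewrite -ExB -ExZ; apply: eq_Ex => a; rewrite -ExB -ExZ; apply: eq_Ex => c.
by congr (_ * (_ - _)); apply: eq_Ex => v; rewrite addrA.
Qed.
End TwoSided.
Arguments walk : simpl never.

(** * The covariance bound *)

Section CovarianceBound.
Variables (R : realType) (S : eqType) (o : S) (q : S -> flaw R int).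
Variables (pi : flaw R S) (fw bw : S -> flaw R S).
Hypothesis reversal : forall F : S -> S -> R,
  Ex pi (fun x => Ex (fw x) (F x)) = Ex pi (fun x' => Ex (bw x') (fun x => F x x')).
Variable z : R.
Hypothesis z_ge1 : 1 <= z.
Hypothesis q1 : forall k, Ex (q k) (fun y => `|y%:~R|) <= z.
Hypothesis q2 : forall k, Ex (q k) (fun y => `|y%:~R| ^+ 2) <= z ^+ 2.
Hypothesis q3 : forall k, Ex (q k) (fun y => `|y%:~R| ^+ 3) <= z ^+ 3.

Local Notation PS := (pair_sums q).
Local Notation ME := (meeting o).
Local Notation outer := (outer o q fw bw).
Local Notation swapped := (swapped o q pi fw bw).
Local Notation window := (window q pi fw bw).
Local Notation span_law := (span_law o pi fw bw).

Lemma swapped_le l r F G :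
  (forall x x' ll rr,
    `|Ex (q x) (fun y => Ex (q x') (fun y' => Ex (PS ll) (fun a => Ex (PS rr) (fun c =>
        F y y' (size ll) (size rr) (a.1 + c.1) (a.2 + c.2)))))| <= G (size ll + size rr).+1) ->
  `|swapped l r F| <= Ex (span_law l r) G.
Proof.
move=> FG; rewrite Ex_span_law.
do 4 (apply: le_trans (Ex_norm _ _) _; apply: Ex_le => ?); exact: FG.
Qed.

Lemma swappedBZ l r F G c : swapped l r F - swapped l r G * c =
  swapped l r (fun y y' k p s s' => F y y' k p s s' - G y y' k p s s' * c).
Proof. by rewrite /swapped; do 8 (rewrite -ExZr -ExB; apply: eq_Ex => ?). Qed.

Lemma moments_le_pair A B (d : flaw R A) (e : flaw R B) f g c1 c2 :
  moments_le d f c1 -> moments_le e g c2 ->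
  moments_le (fbind d (fun a => fmap (fun b => (a, b)) e)) (fun p => f p.1 + g p.2) (c1 + c2).
Proof.
move=> df eg; have [f0 _ _] := df; have [g0 _ _] := eg.
by apply: (moments_le_add df eg) => [p||]; rewrite ?addr_ge0 // Ex_bind le_eqVlt;
  apply/orP; left; apply/eqP; apply: eq_Ex => a; rewrite Ex_map.
Qed.

(** Expanding the product leaves moments of the modulus of [y] up to order three and of [f] up to
    order two, each bounded as if these variables were the constants [z] and [c]. *)
Lemma cubic_moment A k (d : flaw R A) f c b K : 0 <= b -> 0 <= K -> 0 <= c -> moments_le d f c ->
  Ex (q k) (fun y => Ex d (fun a => `|y%:~R| * (`|y%:~R| + f a) * (b * (`|y%:~R| + f a) + K)))
    <= b * (z * (z + c) ^+ 2) + K * (z * (z + c)).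
Proof.
move=> b0 K0 c0 [f0 f1 f2].
rewrite (eq_Ex (q k) (g := fun y : int => b * `|y%:~R| ^+ 3 + (2 * b * Ex d f + K) * `|y%:~R| ^+ 2
   + (b * Ex d (fun a => f a ^+ 2) + K * Ex d f) * `|y%:~R|)); last first.
  move=> y; rewrite (eq_Ex d (g := fun a => (b * `|y%:~R|) * f a ^+ 2
    + (2 * b * `|y%:~R| ^+ 2 + K * `|y%:~R|) * f a + (b * `|y%:~R| ^+ 3 + K * `|y%:~R| ^+ 2))).
    by rewrite !ExD !ExZ !Ex_cst; ring.
  by move=> a; ring.
rewrite !ExD !ExZ.
have u0 := Ex_ge0 d f0; have v0 : 0 <= Ex d (fun a => f a ^+ 2).
  by apply: Ex_ge0 => a; apply: sqr_ge0.
move: (Ex d f) (Ex d (fun a => f a ^+ 2)) f1 f2 u0 v0 => u v f1 f2 u0 v0.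
have z0 : 0 <= z by apply: le_trans z_ge1.
have H3 := ler_wpM2l b0 (q3 k).
have H2 : (2 * b * u + K) * Ex (q k) (fun y => `|y%:~R| ^+ 2) <= (2 * b * c + K) * z ^+ 2.
  apply: ler_pM => //; first by rewrite addr_ge0 ?mulr_ge0.
    by apply: Ex_ge0 => y; rewrite exprn_ge0.
  by rewrite lerD2r ler_wpM2l ?mulr_ge0.
have H1 : (b * v + K * u) * Ex (q k) (fun y => `|y%:~R|) <= (b * c ^+ 2 + K * c) * z.
  apply: ler_pM => //; first by rewrite addr_ge0 ?mulr_ge0.
    by apply: Ex_ge0.
  by rewrite lerD // ler_wpM2l.
by apply: le_trans (lerD (lerD H3 H2) H1) _; rewrite le_eqVlt; apply/orP; left; apply/eqP; ring.
Qed.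

Variables (b : R) (m n l r : nat).
Hypotheses (smooth_fw : smooth o q b m fw) (smooth_bw : smooth o q b m bw).
Hypotheses (mE : m = (n %/ 4)%N) (nE : n = (l + r).+1).

Let z_ge0 : 0 <= z. Proof. exact: le_trans z_ge1. Qed.
Let b_ge0 : 0 <= b.
Proof.
have H := @smooth_fw m (fun=> 0) (leqnn m).
by apply: le_trans (normr_ge0 _) (H _) => j; rewrite normr0.
Qed.

Definition mean_wait st k := Ex pi (fun x => Ex pi (fun x' => mean_size o st k (x, x'))).

Lemma mean_wait_o st k k' : (forall F, Ex pi (fun x => Ex (st x) F) = Ex pi F) -> (k <= k')%N ->
  Ex pi (fun v => mean_size o st k (o, v)) <= mean_wait st k'.
Proof.
move=> statio kk'; rewrite -[leLHS](Ex_cst pi); apply: Ex_le => x.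
apply: le_trans (mean_size_pi_o o statio k x) _; apply: Ex_le => v.
exact: mean_size_le.
Qed.

Lemma span_lawE : Ex (span_law l r) (fun t => t%:R) = 1 + mean_wait bw l + mean_wait fw r.
Proof.
rewrite Ex_span_law /mean_wait -[X in X + _ + _](Ex_cst pi 1) -!ExD; apply: eq_Ex => x.
rewrite -[X in X + _ + _](Ex_cst pi 1) -!ExD; apply: eq_Ex => x'.
rewrite -[X in X + _ + _](Ex_cst (ME bw l (x, x')) 1) -!ExD /mean_size.
rewrite -[X in _ + X](Ex_cst (ME bw l (x, x'))) -ExD; apply: eq_Ex => ll.
rewrite -[X in X + _](Ex_cst (ME fw r (x, x'))) -ExD; apply: eq_Ex => rr.
by rewrite -natr1 natrD; ring.
Qed.

Lemma covariance_bound (g : int -> R) : (forall j, `|g (j + 1) - g j| <= 1 :> R) ->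
  `|(window l r (fun y w => y%:~R * g w) - window l r (fun y _ => y%:~R) * window l r (fun=> g))
    - (window l r (fun y w => y%:~R * w%:~R)
       - window l r (fun y _ => y%:~R) * window l r (fun _ w => w%:~R))
      * window l r (fun _ w => g (w + 1) - g w)|
  <= 14 * z ^+ 3 * b * Ex (span_law l r) (fun t => t%:R ^+ 2).
Proof.
move=> g1; rewrite !(window_cov o q pi fw bw) swappedBZ.
set H := window l r _; set we := mean_wait bw l + mean_wait fw r.
have we0 : 0 <= we by rewrite addr_ge0 //; do 2 (apply: Ex_ge0 => ?); exact: mean_size_ge0.
pose K (t : nat) := 5 / 2 * b * z * (t%:R + we).
have K0 t : 0 <= K t.
  have : 0 <= b * z * (t%:R + we) by apply: mulr_ge0; [exact: mulr_ge0 | exact: addr_ge0].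
  by rewrite /K; lra.
apply: (@le_trans _ _ (Ex (span_law l r) (fun t =>
    b * (z * (2 * t%:R * z) ^+ 2) + K t * (z * (2 * t%:R * z))))); last first.
  (* The first summand gives 4 and [K] gives [5 (t + we)], whence 9 for [t ^ 2] and 5 for [we t]. As
     [we] is the mean of [t] less 1, and the squared mean is at most the second moment, the total is
     14. *)
  rewrite (eq_Ex _ (g := fun t => (9 * z ^+ 3 * b) * t%:R ^+ 2 + (5 * z ^+ 3 * b * we) * t%:R)).
    rewrite [leLHS]ExD !ExZ.
    have -> : we = Ex (span_law l r) (fun t => t%:R) - 1 by rewrite span_lawE /we; ring.
    have := Ex_sqr (span_law l r) (fun t => t%:R).
    set e := Ex _ (fun t => t%:R); set e2 := Ex _ _ => ee.
    have e0 : 0 <= e by apply: Ex_ge0.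
    have zb : 0 <= 5 * z ^+ 3 * b by rewrite !mulr_ge0 ?exprn_ge0.
    have := ler_wpM2l zb ee; have := mulr_ge0 zb e0; lra.
  by move=> t; rewrite /K; field.
apply: swapped_le => x x' ll rr; set t := (size ll + size rr).+1.
have wm := moments_le_pair (q_moments q1 q2 x')
  (moments_le_pair (pair_sums_moments q1 q2 ll) (pair_sums_moments q1 q2 rr)).
set c := (_ + _) in wm.
have c0 : 0 <= c by rewrite !addr_ge0 ?mulr_ge0.
have tE : t%:R = (size ll)%:R + (size rr)%:R + 1 :> R by rewrite /t -natr1 natrD.
have -> : 2 * t%:R * z = z + c by rewrite /c tE; ring.
apply: le_trans (cubic_moment x b_ge0 (K0 t) c0 wm).
apply: le_trans (Ex_norm _ _) _; apply: Ex_le => y; rewrite Ex_bind.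
apply: le_trans (Ex_norm _ _) _; apply: Ex_le => y'; rewrite Ex_map Ex_bind.
apply: le_trans (Ex_norm _ _) _; apply: Ex_le => a; rewrite Ex_map.
apply: le_trans (Ex_norm _ _) _; apply: Ex_le => d /=.
set l' := (l - size ll)%N; set r' := (r - size rr)%N.
pose G (k : int) := Ex (outer l' r') (fun v => g (k + v)).
have idE k : Ex (outer l' r') (fun v => (k + v)%:~R : R) =
    k%:~R + Ex (outer l' r') (fun v => v%:~R).
  rewrite -[X in X + _](Ex_cst (outer l' r')) -ExD; apply: eq_Ex => v.
  by rewrite rmorphD.
rewrite !idE -/(G _) -/(G _).
set A := y + (a.1 + d.1); set A' := y' + (a.2 + d.2).
(* With the identity in place of [g] the outer sum cancels and [A - A'] remains, so the two
   covariances together measure how far [G] is from having slope [H]. *)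
have -> : y%:~R * (G A - G A') - y%:~R * (A%:~R + Ex (outer l' r') (fun v => v%:~R) -
    (A'%:~R + Ex (outer l' r') (fun v => v%:~R))) * H =
    y%:~R * (G A - G A' - (A - A')%:~R * H) by rewrite rmorphB /=; ring.
rewrite normrM -mulrA ler_wpM2l //.
set D := (X in _ <= X * _).
have AD : `|A%:~R| + `|A'%:~R| <= D :> R.
  rewrite /A /A' /D !rmorphD /=.
  have := ler_normD (y%:~R : R) (a.1%:~R + d.1%:~R); have := ler_normD (a.1%:~R : R) (d.1%:~R).
  have := ler_normD (y'%:~R : R) (a.2%:~R + d.2%:~R); have := ler_normD (a.2%:~R : R) (d.2%:~R).
  by lra.
have D0 : 0 <= D by apply: le_trans AD; rewrite addr_ge0.
apply: (@le_trans _ _ (`|(A - A')%:~R| * (b * D + K t))).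
  (* The slope of [G] at [j] is the mean of the increments of [g] under [outer] shifted by [j],
     while [H] is their mean over a stationary window. *)
  apply: int_lipschitz => j jA.
  have := @near_stationary R S o q pi fw bw reversal z z_ge1 q1 q2 b m smooth_fw smooth_bw
    n l' r' j (fun w => g (w + 1) - g w) mE _ g1.
  rewrite ExB (eq_Ex _ (g := fun v => g (j + 1 + v))); last by move=> v; congr g; ring.
  rewrite -/(G (j + 1)) -/(G j).
  have lr : (l' + (n.-1 - l') = l + r)%N by rewrite nE /l'; lia.
  rewrite (window_eq _ reversal _ lr).
  rewrite -/H => /(_ _)/le_trans; apply; first by rewrite /l' /r' nE; lia.
  have jD : `|j%:~R| <= D :> R.
    by apply: le_trans AD; rewrite -!intr_norm -rmorphD ler_int.
  apply: lerD; first by rewrite ler_wpM2l.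
  apply: ler_wpM2l; first by have := mulr_ge0 b_ge0 z_ge0; lra.
  rewrite /we addrA;  apply: lerD; last first.
    by apply: mean_wait_o; [exact: (stationary_fw reversal) | rewrite leq_subr].
  apply: lerD; last by apply: mean_wait_o; [exact: (stationary_bw reversal) | rewrite leq_subr].
  by rewrite ler_nat /t /l' /r' nE; lia.
apply: ler_wpM2r; first by apply: addr_ge0; [exact: mulr_ge0 | exact: K0].
by rewrite rmorphB /=; apply: le_trans (ler_normB _ _) AD.
Qed.
End CovarianceBound.

(** * Stein's method for the translated Poisson law *)

Section PoissonStein.
Variables (R : realType) (lam : R).
Hypothesis lam_gt0 : 0 < lam.
Local Notation p := (poisson_pmf lam).
Local Notation F k := (\sum_(j < k) p j).

Lemma poisson_pmf_gt0 k : 0 < p k.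
Proof.
by rewrite /poisson_pmf divr_gt0 ?mulr_gt0 ?expR_gt0 ?exprn_gt0 // ltr0n fact_gt0.
Qed.

Let p_ge0 k : 0 <= p k. Proof. exact: ltW (poisson_pmf_gt0 k). Qed.

Lemma poisson_pmfS k : k.+1%:R * p k.+1 = lam * p k.
Proof.
rewrite /poisson_pmf factS exprS natrM.
have f0 : k`!%:R != 0 :> R by rewrite pnatr_eq0 -lt0n fact_gt0.
by field; rewrite f0 nat1r pnatr_eq0.
Qed.

Lemma poisson_cdfS k : F k.+1 = F k + p k.
Proof. by rewrite big_ord_recr. Qed.

Lemma poisson_cdf_cvg : (fun k => F k) @ \oo --> (1 : R).
Proof.
have -> : (fun k => F k) = (fun k => expR (- lam) * series (exp_coeff lam) k).
  apply/funext => k; rewrite /series /= big_mkord big_distrr /=; apply: eq_bigr => j _.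
  by rewrite /poisson_pmf /exp_coeff mulrA.
have -> : (1 : R) = expR (- lam) * expR lam by rewrite -expRD addNr expR0.
by apply: cvgMl_tmp; exact: is_cvg_series_exp_coeff.
Qed.

Lemma poisson_cdf_le1 k : F k <= 1.
Proof.
rewrite -(cvg_lim _ poisson_cdf_cvg) //; apply: nondecreasing_cvgn_le.
  by apply/nondecreasing_seqP => j; rewrite poisson_cdfS lerDl.
by apply/cvg_ex; exists 1; exact: poisson_cdf_cvg.
Qed.

Lemma poisson_cdf_ge0 k : 0 <= F k.
Proof. by apply: sumr_ge0 => j _. Qed.

(** Multiplication by [lam] shifts the weights: [lam * F k] is the sum of [j p j] over [j <= k]. *)
Lemma poisson_left_ratio k : lam * F k <= k%:R * F k.+1.
Proof.
elim: k => [|k IH]; first by rewrite big_ord0 mulr0 mul0r.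
rewrite (poisson_cdfS k.+1) mulrDr poisson_pmfS (poisson_cdfS k) mulrDr lerD2r.
rewrite -poisson_cdfS -natr1 mulrDl mul1r (le_trans IH) // lerDl.
exact: poisson_cdf_ge0.
Qed.

(** Likewise [lam (1 - F k)] is the sum of [j p j] over [j > k]. The induction treats the finite
    sections [F (k + N) - F k], and then [N] tends to infinity. *)
Lemma poisson_right_ratio k : k%:R * (1 - F k.+1) <= lam * (1 - F k).
Proof.
have H N : k%:R * (F (k + N).+1 - F k.+1) <= lam * (F (k + N) - F k).
  elim: N => [|N IH]; first by rewrite addn0; lra.
  have : k%:R * p (k + N).+1 <= lam * p (k + N).
    by rewrite -poisson_pmfS ler_wpM2r // ler_nat; lia.
  rewrite addnS (poisson_cdfS (k + N).+1) [X in _ -> _ <= _ * (X - _)](poisson_cdfS (k + N)).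
  move: IH; lra.
have c : (fun N => k%:R * (F (k + N).+1 - F k.+1)) @ \oo --> k%:R * (1 - F k.+1).
  apply: cvgMl_tmp; apply: cvgB; last exact: cvg_cst.
  have := poisson_cdf_cvg; rewrite -(cvg_shiftn k.+1).
  by under eq_fun do rewrite addnS addnC.
rewrite -(cvg_lim _ c) //; apply: limr_le; first by apply/cvg_ex; eexists; exact: c.
apply: nearW => N; apply: le_trans (H N) _.
by apply: ler_wpM2l; [exact: ltW | rewrite lerB // poisson_cdf_le1].
Qed.

(** The Stein equation is solved explicitly by partial sums. Only finite events will be tested, so
    [h] vanishes from [N] on and its Poisson mean is a finite sum. Extending [g] by 0 to negative
    arguments makes the right side 0 there. *)
Lemma poisson_stein (h : nat -> R) N : (forall k, 0 <= h k <= 1) ->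
  (forall k, (N <= k)%N -> h k = 0) ->
  exists g : int -> R, [/\ g 0 = 0, forall t, `|g (t + 1) - g t| <= lam^-1 &
    forall t : int, lam * g (t + 1) - t%:~R * g t =
      if t is Posz k then h k - \sum_(j < N) p j * h j else 0].
Proof.
move=> h01 hN; set Ph := \sum_(j < N) _.
have PhE M : (N <= M)%N -> Ph = \sum_(j < M) p j * h j.
  move=> NM; rewrite /Ph -!(big_mkord xpredT (fun j => p j * h j)) (big_cat_nat (leq0n N) NM) //=.
  rewrite [X in _ = _ + X]big1_seq ?addr0 // => j /andP[_].
  by rewrite mem_index_iota => /andP[Nj _]; rewrite hN ?mulr0.
have h0 k : 0 <= h k by case/andP: (h01 k).
have h1 k : h k <= 1 by case/andP: (h01 k).
pose H k := \sum_(j < k) p j * h j.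
have HS k : H k.+1 = H k + p k * h k by rewrite /H big_ord_recr.
have H0 k : 0 <= H k by apply: sumr_ge0 => j _; rewrite mulr_ge0.
have HD k j : H (k + j)%N - H k <= F (k + j)%N - F k.
  elim: j => [|j IH]; first by rewrite addn0; lra.
  rewrite addnS HS poisson_cdfS; have := ler_wpM2l (p_ge0 (k + j)%N) (h1 (k + j)%N); lra.
have HF k : H k <= F k by have := HD 0 k; rewrite add0n /H !big_ord0 !subr0.
have HP k : H k <= Ph.
  rewrite (PhE (k + N)%N) ?leq_addl // -/(H (k + N)%N) -subr_ge0.
  elim: (N) => [|j IH]; rewrite ?addn0 ?subrr // addnS HS.
  have := mulr_ge0 (p_ge0 (k + j)%N) (h0 (k + j)%N); lra.
have PH k : Ph - H k <= 1 - F k.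
  rewrite (PhE (k + N)%N) ?leq_addl //; apply: le_trans (HD k N) _.
  by rewrite lerD2r poisson_cdf_le1.
pose gn k := if k is k'.+1 then (H k'.+1 - F k'.+1 * Ph) / (lam * p k') else 0.
have lam0 : lam != 0 by rewrite gt_eqF.
have p0 k : p k != 0 by rewrite gt_eqF ?poisson_pmf_gt0.
have gnS k : gn k.+1 = (H k.+1 - F k.+1 * Ph) / (lam * p k) by [].
have gnE k : k%:R * gn k = (H k - F k * Ph) / p k.
  case: k => [|k]; first by rewrite /H !big_ord0 !mul0r subrr mul0r.
  rewrite gnS -poisson_pmfS; field.
  by rewrite ?p0 ?lam0 nat1r pnatr_eq0.
have stein k : lam * gn k.+1 - k%:R * gn k = h k - Ph.
  rewrite gnE gnS HS poisson_cdfS; field.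
  by rewrite p0 lam0.
have diff k : `|gn k.+1 - gn k| <= lam^-1.
  have [->|k0] := posnP k.
    have := stein 0; rewrite mul0r subr0 => e.
    rewrite subr0 -(ler_pM2l lam_gt0) mulfV // -[X in X * _](gtr0_norm lam_gt0) -normrM e.
    have := HP 0; rewrite {1}/H big_ord0 => Ph0.
    have := PH 0; rewrite /H !big_ord0 !subr0 => Ph1.
    rewrite ler_norml; have := h0 0%N; have := h1 0%N; lra.
  have k0' : (0 : R) < k%:R by rewrite ltr0n.
  have kp : 0 < lam * k%:R * p k by apply: mulr_gt0; [exact: mulr_gt0 | exact: poisson_pmf_gt0].
  rewrite -(ler_pM2l kp) -[X in X * `|_|](gtr0_norm kp) -normrM.
  have -> : lam * k%:R * p k * (gn k.+1 - gn k) =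
      k%:R * (H k.+1 - F k.+1 * Ph) - lam * (p k * (k%:R * gn k)).
    by rewrite gnS; field; rewrite p0 lam0.
  rewrite gnE [p k * (_ / _)]mulrC divfK //.
  have -> : lam * k%:R * p k / lam = k%:R * p k by field.
  have a := poisson_left_ratio k; have c := poisson_right_ratio k.
  have := PH k.+1; have := HP k.+1; have := H0 k; have := HF k; have := h1 k; have := h0 k.
  have := ltW (poisson_pmf_gt0 k); have := poisson_cdf_ge0 k; have := poisson_cdf_le1 k.+1.
  rewrite HS; move: a c; rewrite !poisson_cdfS.
  set f := F k; set P := p k; set S := H k; set x := h k; set K := k%:R => a c f1 f0 P0 x0 x1 Sf S0 SP PT.
  (* The increment is linear in the masses [S], [P x] and [T] of [h] below, at and above [k]. The
     ratio lemmas make the coefficients of [S] and [T] nonpositive, and that of [P x] is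
     nonnegative, so the extreme cases are the indicator of [k] and that of its complement. *)
  set T := Ph - (S + P * x).
  have -> : Ph = S + P * x + T by rewrite /T; ring.
  have T0 : 0 <= T by rewrite subr_ge0.
  have S1 : 0 <= S * (lam * (1 - f) - K * (1 - (f + P))) by rewrite mulr_ge0 // subr_ge0.
  have T1 : 0 <= T * (K * (f + P) - lam * f) by rewrite mulr_ge0 // subr_ge0.
  have S2 : S * (lam * (1 - f) - K * (1 - (f + P))) <= f * (lam * (1 - f) - K * (1 - (f + P))).
    by rewrite ler_wpM2r // subr_ge0.
  have T2 : T * (K * (f + P) - lam * f) <= (1 - (f + P)) * (K * (f + P) - lam * f).
    by rewrite ler_wpM2r // subr_ge0.
  have K0 : 0 <= K by exact: ltW.
  have C0 : 0 <= K * (1 - (f + P)) by rewrite mulr_ge0 // subr_ge0.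
  have C1 : 0 <= lam * f by apply: mulr_ge0 => //; exact: ltW.
  have X0 := mulr_ge0 (mulr_ge0 P0 x0) (addr_ge0 C0 C1).
  have X1 : P * x * (K * (1 - (f + P)) + lam * f) <= P * 1 * K.
    by apply: ler_pM (mulr_ge0 P0 x0) (addr_ge0 C0 C1) (ler_wpM2l P0 x1) _; lra.
  have X2 : P * (lam * f) <= P * (K * (f + P)) by rewrite ler_wpM2l.
  rewrite ler_norml; apply/andP; split; lra.
exists (fun t => if t is Posz k then gn k else 0); split => //.
  case=> [k|[|k]].
  - by rewrite -[Posz k + 1]/(Posz (k + 1)) addn1.
  - by rewrite subrr normr0 invr_ge0 ltW.
  - by rewrite (_ : Negz k.+1 + 1 = Negz k) ?subrr ?normr0 ?invr_ge0 ?ltW //; lia.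
case=> [k|[|k]].
- by rewrite -[Posz k + 1]/(Posz (k + 1)) addn1 stein.
- by rewrite !mulr0 subrr.
- by rewrite (_ : Negz k.+1 + 1 = Negz k) ?mulr0 ?subrr //; lia.
Qed.
End PoissonStein.

(** Growth class whose means under [W] need no more than a second moment. It contains [w * g w] for
    Lipschitz [g], which the Stein equation calls for. *)
Definition quadratic (R : realType) (f : int -> R) :=
  exists c : R, forall w, `|f w| <= c * (1 + w%:~R ^+ 2).

Section Quadratic.
Variable R : realType.
Implicit Types f g : int -> R.

Lemma sqr_gt0D1 (w : int) : 1 <= 1 + w%:~R ^+ 2 :> R.
Proof. by rewrite lerDl sqr_ge0. Qed.

Lemma quadratic_bounded f c : (forall w, `|f w| <= c) -> quadratic f.
Proof.
move=> fc; exists c => w; apply: le_trans (fc w) _; rewrite ler_peMr ?sqr_gt0D1 //.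
exact: le_trans (normr_ge0 _) (fc 0).
Qed.

Lemma quadratic_cst (c : R) : quadratic (fun=> c).
Proof. exact: (@quadratic_bounded _ `|c|). Qed.

Lemma quadraticD f g : quadratic f -> quadratic g -> quadratic (fun w => f w + g w).
Proof.
move=> [c fc] [d gd]; exists (c + d) => w; rewrite mulrDl.
by apply: le_trans (ler_normD _ _) _; apply: lerD.
Qed.

Lemma quadraticZ c f : quadratic f -> quadratic (fun w => c * f w).
Proof.
by move=> [d fd]; exists (`|c| * d) => w; rewrite normrM -mulrA ler_wpM2l.
Qed.

Lemma quadratic_lipschitz f : (forall j, `|f (j + 1) - f j| <= 1) ->
  forall w, `|f w| <= `|f 0| + `|w%:~R|.
Proof.
move=> f1 w.
have H k : `|f (Posz k)| <= `|f 0| + k%:R /\ `|f (- Posz k)| <= `|f 0| + k%:R.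
  elim: k => [|k [IH1 IH2]]; first by rewrite oppr0 addr0.
  rewrite -natr1; split.
    have := f1 k; rewrite (_ : k%:Z + 1 = k.+1) => [h|]; last lia.
    have := ler_normD (f k.+1 - f k) (f k); rewrite subrK; lra.
  have := f1 (- k.+1%:Z); rewrite (_ : - k.+1%:Z + 1 = - k%:Z) => [h|]; last lia.
  have := ler_normB (f (- k%:Z)) (f (- k%:Z) - f (- k.+1%:Z)); rewrite opprB addrC subrK.
  lra.
case: w => k; first by have [h _] := H k; rewrite -pmulrn normr_nat.
by have [_ h] := H k.+1; rewrite NegzE rmorphN normrN /= -pmulrn normr_nat.
Qed.

Lemma quadratic_lip f : (forall j, `|f (j + 1) - f j| <= 1) -> quadratic f.
Proof.
move=> f1; exists (`|f 0| + 1) => w; apply: le_trans (quadratic_lipschitz f1 w) _.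
rewrite -[w%:~R ^+ 2]real_normK ?num_real //.
have := normr_ge0 (f 0); have := normr_ge0 (w%:~R : R).
move: `|f 0| `|w%:~R| => a x x0 a0.
have := mulr_ge0 a0 (sqr_ge0 x); have := mulr_ge0 a0 (sqr_ge0 (x - 1)); have := sqr_ge0 (x - 1).
rewrite !expr2; lra.
Qed.

Lemma quadratic_lipM f : (forall j, `|f (j + 1) - f j| <= 1) ->
  quadratic (fun w => w%:~R * f w).
Proof.
move=> f1; exists (`|f 0| + 1) => w; rewrite normrM -[w%:~R ^+ 2]real_normK ?num_real //.
apply: le_trans (ler_wpM2l (normr_ge0 _) (quadratic_lipschitz f1 w)) _.
have := normr_ge0 (f 0); have := normr_ge0 (w%:~R : R).
move: `|f 0| `|w%:~R| => a x x0 a0.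
have := mulr_ge0 a0 (sqr_ge0 x); have := mulr_ge0 a0 (sqr_ge0 (x - 1)); have := sqr_ge0 (x - 1).
rewrite !expr2; lra.
Qed.

Lemma quadratic_id : quadratic (fun w => w%:~R : R).
Proof.
by apply: quadratic_lip => j; rewrite rmorphD /= addrC addKr normr1.
Qed.

Lemma quadratic_sqr : quadratic (fun w => w%:~R ^+ 2 : R).
Proof. by exists 1 => w; rewrite mul1r ger0_norm ?sqr_ge0 // lerDr. Qed.
End Quadratic.

(** * Distance of a mean functional from a translated Poisson law *)

Section TranslatedPoisson.
Variables (R : realType) (L : (int -> R) -> R).
Hypothesis LD : forall f g, quadratic f -> quadratic g -> L (fun w => f w + g w) = L f + L g.
Hypothesis LZ : forall c f, quadratic f -> L (fun w => c * f w) = c * L f.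
Hypothesis Lle : forall f g, quadratic f -> quadratic g -> (forall w, f w <= g w) -> L f <= L g.
Hypothesis L1 : L (fun=> 1) = 1.

Lemma Lcst c : L (fun=> c) = c.
Proof.
rewrite -[RHS]mulr1 -L1 -LZ; last exact: quadratic_cst.
by congr L; apply/funext => w; rewrite mulr1.
Qed.

Lemma LB f g : quadratic f -> quadratic g -> L (fun w => f w - g w) = L f - L g.
Proof.
move=> qf qg; rewrite -[- L g]mulN1r -LZ // -LD //; last exact: quadraticZ.
by congr L; apply/funext => w; rewrite mulN1r.
Qed.

Lemma Lnorm_le f g : quadratic f -> quadratic g -> (forall w, `|f w| <= g w) -> `|L f| <= L g.
Proof.
move=> qf qg fg; rewrite ler_norml -mulN1r -LZ //; apply/andP; split; apply: Lle => //.
- exact: quadraticZ.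
- by move=> w; rewrite mulN1r; have := fg w; rewrite ler_norml => /andP[].
- by move=> w; have := fg w; rewrite ler_norml => /andP[].
Qed.

Let mu := L (fun w => w%:~R).
Let s2 := L (fun w => (w%:~R - mu) ^+ 2).
Hypothesis s2_gt0 : 0 < s2.
Variable C : R.
Hypothesis stein_cov : forall g : int -> R, (forall j, `|g (j + 1) - g j| <= 1) ->
  `|L (fun w => w%:~R * g w) - mu * L g - s2 * L (fun w => g (w + 1) - g w)| <= C.

Let gam : int := Num.floor (mu - s2).
Let lam : R := s2 + (mu - s2 - gam%:~R).

Let lamE : lam = mu - gam%:~R. Proof. rewrite /lam; ring. Qed.

Let lam_itv : s2 <= lam <= s2 + 1.
Proof.
have := floor_itv (mu - s2) => /andP[]; rewrite -/gam rmorphD /= lamE => h1 h2.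
by apply/andP; split; lra.
Qed.

Lemma TP_sum (A : seq int) : uniq A ->
  exists N, (forall k, (N <= k)%N -> (gam + k%:Z \in A) = false) /\
    \sum_(w <- A) TP mu s2 w = \sum_(j < N) poisson_pmf lam j * (gam + j%:Z \in A)%:R.
Proof.
move=> uA; pose N := (\max_(w <- A) `|w - gam|%N).+1.
have NA w : w \in A -> (`|w - gam| < N)%N.
  by move=> wA; rewrite ltnS; apply: leq_bigmax_seq.
exists N; split => [k Nk|].
  apply/negP => /NA; rewrite addrAC subrr add0r; lia.
transitivity (\sum_(w <- A) \sum_(j < N) poisson_pmf lam j * (gam + j%:Z == w)%:R).
  rewrite !big_seq; apply: eq_bigr => w wA; rewrite /TP -/gam -/lam.
  have := NA _ wA; case E : (w - gam) => [k|k] kN.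
    rewrite (bigD1 (Ordinal kN)) //= big1 => [|j jk].
      have -> : gam + k%:Z = w by lia.
      by rewrite eqxx mulr1 addr0.
    rewrite (_ : (_ == _) = false) ?mulr0 //; apply/negP => /eqP jw.
    by move: jk; rewrite -val_eqE /= => /eqP; apply; move: E; rewrite -jw; lia.
  rewrite big1 // => j _; rewrite (_ : (_ == _) = false) ?mulr0 //; apply/negP => /eqP jw.
  by move: E; rewrite -jw; lia.
rewrite exchange_big /=; apply: eq_bigr => j _; rewrite -big_distrr /=; congr (_ * _).
rewrite -natr_sum; congr (_%:R); rewrite -(count_uniq_mem _ uA) -sum1_count [RHS]big_mkcond /=.
by apply: eq_bigr => w _; rewrite eq_sym; case: eqP.
Qed.

(** The Stein equation covers [w >= gam] and contributes [(1 + C) / s2], where 1 bounds the mismatch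
    [lam - s2] caused by the integer translation. Points below [gam] are at distance at least
    [lam >= s2] from [mu], so Chebyshev's inequality bounds their mass by [1 / s2]. *)
Lemma TP_event (A : seq int) : uniq A ->
  `|L (fun w => (w \in A)%:R) - \sum_(w <- A) TP mu s2 w| <= (2 + C) / s2.
Proof.
move=> uA; have /andP[lam1 lam2] := lam_itv.
have lam0 : 0 < lam by apply: lt_le_trans lam1.
have [N [hN ->]] := TP_sum uA.
pose h k : R := (gam + k%:Z \in A)%:R.
have h01 k : 0 <= h k <= 1 by rewrite /h; case: (_ \in _); rewrite !lexx ?ler01.
have [|g [g0 g1 gE]] := poisson_stein lam0 (h := h) (N := N) h01.
  by move=> k /hN Nk; rewrite /h Nk.
rewrite -/(h _); set Ph := \sum_(j < N) _ in gE *.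
have Ph01 : 0 <= Ph <= 1.
  have p0 k := ltW (poisson_pmf_gt0 lam0 k).
  rewrite sumr_ge0 => [|j _]; last by rewrite mulr_ge0 //; case/andP: (h01 j).
  apply: le_trans (poisson_cdf_le1 lam0 N); apply: ler_sum => j _.
  by rewrite -[leRHS]mulr1 ler_wpM2l //; case/andP: (h01 j).
(* The factor [lam] brings the increments down to the modulus 1 that [stein_cov] accepts. *)
pose G w := lam * g (w - gam).
have G1 j : `|G (j + 1) - G j| <= 1.
  rewrite -mulrBr normrM gtr0_norm // addrAC -(ler_pM2l (x := lam^-1)) ?invr_gt0 //.
  by rewrite mulKf ?gt_eqF // mulr1.
pose e (w : int) : R := (gam <= w)%R%:R * ((w \in A)%:R - Ph).
have eE w : lam * e w = lam * (G (w + 1) - G w) - (w%:~R * G w - mu * G w).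
  transitivity (lam * (lam * g (w - gam + 1) - (w - gam)%:~R * g (w - gam))).
    rewrite gE /e; congr (_ * _); case E : (w - gam) => [k|k].
      have -> : gam <= w by lia.
      rewrite mul1r /h (_ : gam + k%:Z = w) //; lia.
    have -> : (gam <= w) = false by lia.
    by rewrite mul0r.
  rewrite /G (_ : w + 1 - gam = w - gam + 1); last ring.
  by rewrite rmorphB /= lamE; ring.
have qG := quadratic_lip G1; have qwG := quadratic_lipM G1.
have qdG : quadratic (fun w => G (w + 1) - G w) := quadratic_bounded G1.
have e1 w : `|e w| <= 1.
  rewrite /e; case: (gam <= w); rewrite ?mul0r ?normr0 // mul1r ler_norml.
  by case: (_ \in _) => /=; lra.
have qe := quadratic_bounded e1.
have Le : `|L e| <= (1 + C) / s2.
  have qmG := quadraticZ mu qG.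
  have qn : quadratic (fun w => w%:~R * G w - mu * G w).
    by have := quadraticD qwG (quadraticZ (-1) qmG); under eq_fun do rewrite mulN1r.
  have H : lam * L e = (lam - s2) * L (fun w => G (w + 1) - G w) -
      (L (fun w => w%:~R * G w) - mu * L G - s2 * L (fun w => G (w + 1) - G w)).
    rewrite -LZ // (_ : (fun w => lam * e w) = fun w => lam * (G (w + 1) - G w) -
      (w%:~R * G w - mu * G w)); last by apply/funext.
    by rewrite [LHS]LB; [rewrite LZ // [X in _ - X = _]LB // (LZ mu) //; ring | exact: quadraticZ | ].
  have dG1 : `|L (fun w => G (w + 1) - G w)| <= 1.
    by rewrite -[leRHS](Lcst 1); apply: Lnorm_le => //; exact: quadratic_cst.
  have : `|lam * L e| <= 1 + C.
    rewrite H; apply: le_trans (ler_normB _ _) _; apply: lerD; last exact: stein_cov.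
    by rewrite normrM; apply: mulr_ile1 => //; rewrite ler_norml; lra.
  rewrite normrM gtr0_norm // ler_pdivlMr // mulrC => H'; apply: le_trans H'.
  by rewrite ler_wpM2l.
have qA : quadratic (fun w => (w \in A)%:R : R).
  by apply: (@quadratic_bounded _ _ 1) => w; case: (_ \in _); rewrite ?normr0 ?normr1.
have -> : L (fun w => (w \in A)%:R) - Ph =
    L (fun w => (w \in A)%:R - Ph - e w) + L e.
  rewrite LB //; last by apply: quadraticD => //; exact: quadratic_cst.
  by rewrite LB ?Lcst ?subrK //; exact: quadratic_cst.
apply: le_trans (ler_normD _ _) _.
have -> : (2 + C) / s2 = s2^-1 + (1 + C) / s2 by field; rewrite gt_eqF.
apply: lerD => //.
have qsq : quadratic (fun w : int => (w%:~R - mu) ^+ 2).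
  have -> : (fun w : int => (w%:~R - mu) ^+ 2) =
    fun w => w%:~R ^+ 2 + ((- 2 * mu) * w%:~R + mu ^+ 2) by apply/funext => w; ring.
  apply: quadraticD; first exact: quadratic_sqr.
  by apply: quadraticD; [apply: quadraticZ; exact: quadratic_id | exact: quadratic_cst].
have -> : s2^-1 = L (fun w => s2^-2 * (w%:~R - mu) ^+ 2).
  by rewrite LZ // -/s2; field; rewrite gt_eqF.
apply: Lnorm_le; [|exact: quadraticZ|].
  have := quadraticD (quadraticD qA (quadratic_cst (- Ph))) (quadraticZ (-1) qe).
  by under eq_fun do rewrite mulN1r.
move=> w; rewrite /e; have [gw|wg] := leP gam w.
  by rewrite mul1r subrr normr0 mulr_ge0 ?sqr_ge0 // invr_ge0 sqr_ge0.
rewrite mul0r subr0; apply: (@le_trans _ _ 1).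
  by rewrite ler_norml; case: (_ \in _) => /=; lra.
rewrite -(ler_pM2l (x := s2 ^+ 2)) ?exprn_gt0 // mulr1 mulVKf ?gt_eqF ?exprn_gt0 //.
have wg' : w%:~R <= gam%:~R :> R by rewrite ler_int ltW.
have mw : s2 <= mu - w%:~R by move: lam1; rewrite lamE; lra.
have s2p := ltW s2_gt0.
by rewrite -[leRHS]sqrrN opprB lerXn2r ?nnegrE // (le_trans s2p mw).
Qed.

(** The event bound is used once for the points where the difference is nonnegative and once for the
    others, hence the factor 2. *)
Lemma TP_distance (A : seq int) : uniq A ->
  \sum_(w <- A) `|L (fun v => (v == w)%:R) - TP mu s2 w| <= 2 * ((2 + C) / s2).
Proof.
move=> uA; pose D w := L (fun v => (v == w)%:R) - TP mu s2 w.
have DE (B : seq int) : uniq B -> `|\sum_(w <- B) D w| <= (2 + C) / s2.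
  move=> uB; rewrite sumrB.
  suff <- : L (fun w => (w \in B)%:R) = \sum_(w <- B) L (fun v => (v == w)%:R).
    exact: TP_event.
  have q1 P : quadratic (fun v : int => (P v : bool)%:R : R).
    by apply: (@quadratic_bounded _ _ 1) => v; case: (P v); rewrite ?normr0 ?normr1.
  elim: B uB => [|b B IH] /=; first by rewrite big_nil Lcst.
  move=> /andP[bB uB]; rewrite big_cons -IH // -LD //; congr L; apply/funext => v.
  by rewrite inE; case: eqP => [->|_]; rewrite ?(negPf bB) ?addr0 ?add0r.
have h1 := DE _ (filter_uniq (fun w => 0 <= D w) uA).
have h2 := DE _ (filter_uniq (fun w => ~~ (0 <= D w)) uA).
rewrite !big_filter in h1 h2; rewrite (bigID (fun w => 0 <= D w)) /=.
rewrite (eq_bigr D) => [|w]; last exact: ger0_norm.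
rewrite [X in _ + X](eq_bigr (fun w => - D w)) => [|w]; last first.
  by rewrite -ltNge; exact: ltr0_norm.
rewrite sumrN; have := ler_norm (\sum_(w <- A | 0 <= D w) D w).
have := ler_norm (- \sum_(w <- A | ~~ (0 <= D w)) D w); rewrite normrN; lra.
Qed.
End TranslatedPoisson.

(** * Truncation of the values *)

Section Esum.
Variables (R : realType) (T : choiceType).
Implicit Types (I : set T) (s : seq T).

Lemma esum_ge_seq I (a : T -> \bar R) s : uniq s -> (forall x, x \in s -> I x) ->
  (\sum_(x <- s) a x <= \esum_(x in I) a x)%E.
Proof.
move=> us sI; apply: esum_ge; exists [set` s].
  by split; [exact: finite_seq | move=> x /=; exact: sI].
by rewrite fsbig_seq.
Qed.

Lemma esum_le_seq I (a : T -> \bar R) c :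
  (forall s, uniq s -> (forall x, x \in s -> I x) -> (\sum_(x <- s) a x <= c)%E) ->
  (\esum_(x in I) a x <= c)%E.
Proof.
move=> H; apply: ge_ereal_sup => _ [A [finA AI] <-].
rewrite fsbig_finite //=; apply: H; first exact: fset_uniq.
by move=> x; rewrite in_fset_set // inE; exact: AI.
Qed.

(** The uniform bound [c] rules out an infinite sum, for which [fine] would return 0. *)
Lemma fine_esum_ge (f : T -> R) (c : R) s : (forall x, 0 <= f x) ->
  (forall s, uniq s -> \sum_(x <- s) f x <= c) -> uniq s ->
  \sum_(x <- s) f x <= fine (\esum_(x in [set: T]) (f x)%:E).
Proof.
move=> f0 fc us; have fin : (\esum_(x in [set: T]) (f x)%:E < +oo)%E.
  apply: (@le_lt_trans _ _ c%:E); last exact: ltry.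
  by apply: esum_le_seq => r ur _; rewrite sumEFin lee_fin fc.
have ge0 : (0 <= \esum_(x in [set: T]) (f x)%:E)%E.
  by apply: esum_ge0 => x _; rewrite lee_fin.
by rewrite -lee_fin fineK ?ge0_fin_numE // -sumEFin esum_ge_seq.
Qed.

Lemma sum_fine_esum_le (J : choiceType) (g : J -> T -> R) (F : seq J) c :
  (forall j x, 0 <= g j x) ->
  (forall s, uniq s -> \sum_(x <- s) \sum_(j <- F) g j x <= c) ->
  \sum_(j <- F) fine (\esum_(x in [set: T]) (g j x)%:E) <= c.
Proof.
move=> g0 gc; rewrite -lee_fin -sumEFin.
have fin j : j \in F -> (\esum_(x in [set: T]) (g j x)%:E \is a fin_num)%E.
  move=> jF; rewrite ge0_fin_numE; last by apply: esum_ge0 => x _; rewrite lee_fin.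
  apply: (@le_lt_trans _ _ c%:E); last exact: ltry.
  apply: esum_le_seq => s us _; rewrite sumEFin lee_fin; apply: le_trans (gc _ us).
  by apply: ler_sum => x _; rewrite (big_rem j) //= lerDl sumr_ge0.
rewrite big_seq (eq_bigr (fun j => \esum_(x in [set: T]) (g j x)%:E)%E); last first.
  by move=> j jF; rewrite fineK // fin.
rewrite -big_seq -(@esum_sum _ _ _ setT F xpredT (fun x j => (g j x)%:E)); last by move=> x j _ _; rewrite lee_fin.
by apply: esum_le_seq => s us _; under eq_bigr do rewrite sumEFin; rewrite sumEFin lee_fin gc.
Qed.
End Esum.

Section Box.
Variable R : realType.

(** Locking keeps simplification from unfolding the box into its first element and the rest. *)
Fact box_key : unit. Proof. by []. Qed.
Definition box : nat -> seq int :=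
  locked_with box_key (fun M => [seq i%:Z - M%:Z | i <- iota 0 (2 * M).+1]).

Lemma boxE M : box M = [seq i%:Z - M%:Z | i <- iota 0 (2 * M).+1].
Proof. by rewrite /box unlock. Qed.

Lemma mem_box M y : (y \in box M) = (`|y| <= M%:Z).
Proof.
rewrite boxE; apply/mapP/idP => [[i]|yM]; first by rewrite mem_iota; lia.
exists (absz (y + M%:Z)); last lia.
by rewrite mem_iota; lia.
Qed.

Lemma box_uniq M : uniq (box M).
Proof. by rewrite boxE map_inj_uniq ?iota_uniq // => i j; lia. Qed.

Lemma sum_sub_le (S T : eqType) (f : T -> R) (h : S -> T) s t : (forall x, 0 <= f x) ->
  uniq s -> uniq t -> injective h -> (forall x, x \in s -> h x \in t) ->
  \sum_(x <- s) f (h x) <= \sum_(y <- t) f y.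
Proof.
move=> f0 us ut hi hst; rewrite -(big_map h xpredT f) [leRHS](bigID (mem (map h s))) /=.
rewrite -[leLHS]addr0 lerD ?sumr_ge0 //.
rewrite le_eqVlt; apply/orP; left; apply/eqP; rewrite -[RHS]big_filter; apply: perm_big.
apply: uniq_perm; rewrite ?map_inj_uniq ?filter_uniq // => y.
rewrite mem_filter /=; apply/idP/idP => [ys|/andP[] //]; rewrite ys /=.
by have /mapP[x xs ->] := ys; exact: hst.
Qed.

Lemma pmf_sum_le1 (f : int -> R) s : int_pmf f -> uniq s -> \sum_(y <- s) f y <= 1.
Proof. by move=> [f0 f1] us; rewrite -lee_fin -f1 -sumEFin esum_ge_seq. Qed.

Lemma seq_sub_box (s : seq int) : exists M, forall y, y \in s -> y \in box M.
Proof.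
exists (\max_(y <- s) `|y|%N) => y ys; rewrite mem_box.
have : (`|y| <= \max_(y <- s) `|y|)%N by apply: leq_bigmax_seq.
by lia.
Qed.

Lemma pmf_box_cvg (f : int -> R) : int_pmf f ->
  (fun M => \sum_(y <- box M) f y) @ \oo --> (1 : R).
Proof.
move=> pf; have [f0 f1] := pf; apply/cvgrPdist_le => e e0.
have [s us se] : exists2 s, uniq s & 1 - e <= \sum_(y <- s) f y.
  apply: contrapT => H; suff : ((1 : R)%:E <= (1 - e)%:E)%E by rewrite lee_fin; lra.
  rewrite -f1; apply: esum_le_seq => s us _; rewrite sumEFin lee_fin leNgt.
  by apply/negP => /ltW se; apply: H; exists s.
have [M sM] := seq_sub_box s.
exists M => // N /= MN; rewrite ger0_norm ?subr_ge0 ?pmf_sum_le1 ?box_uniq //.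
suff : \sum_(y <- s) f y <= \sum_(y <- box N) f y by lra.
apply: (@sum_sub_le _ _ f id) => //; rewrite ?box_uniq // => y /sM.
by rewrite !mem_box; lia.
Qed.

Definition box_defect (f : int -> R) M : R := 1 - \sum_(y <- box M) f y.

Section Truncation.
Variables (f : int -> R) (pf : int_pmf f) (M : nat).

Fact trunc_ge0 : all (fun p => 0 <= p.1) ([seq (f y, y) | y <- box M] ++ [:: (box_defect f M, 0 : int)]).
Proof.
have [f0 _] := pf; rewrite all_cat; apply/andP; split; apply/allP => p.
  by move=> /mapP[y _ ->] /=.
by rewrite inE => /eqP -> /=; rewrite subr_ge0 pmf_sum_le1 ?box_uniq.
Qed.

Fact trunc_sum : \sum_(p <- [seq (f y, y) | y <- box M] ++ [:: (box_defect f M, 0 : int)]) p.1 = 1.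
Proof.
rewrite big_cat big_map big_seq1 -[LHS]/(_ + _) /box_defect; exact: subrKC.
Qed.

(* the law of [Y 1{|Y| <= M}] when [Y] has law [f] *)
Definition trunc_law : flaw R int := Flaw trunc_ge0 trunc_sum.

Lemma Ex_trunc F : Ex trunc_law F = \sum_(y <- box M) f y * F y + box_defect f M * F 0.
Proof. by rewrite /Ex big_cat big_map big_seq1. Qed.
End Truncation.

Section FinLaw.
Variables (S : finType) (f : S -> R).
Hypotheses (f0 : forall x, 0 <= f x) (f1 : \sum_x f x = 1).
Fact fin_ge0 : all (fun p => 0 <= p.1) [seq (f x, x) | x <- enum S].
Proof. by rewrite all_map; apply/allP => x _ /=. Qed.
Fact fin_sum : \sum_(p <- [seq (f x, x) | x <- enum S]) p.1 = 1.
Proof. by rewrite big_map big_enum. Qed.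
Definition fin_law : flaw R S := Flaw fin_ge0 fin_sum.
Lemma Ex_fin F : Ex fin_law F = \sum_x f x * F x.
Proof. by rewrite /Ex /= big_map big_enum. Qed.
End FinLaw.

Definition kernel_law (S : finType) (Q : S -> S -> R) (sQ : stochastic Q) (x : S) : flaw R S :=
  fin_law (sQ.1 x) (sQ.2 x).
End Box.

Section TruncatedChain.
Variables (R : realType) (S : finType) (Q : S -> S -> R) (sQ : stochastic Q).
Variables (q : S -> int -> R) (pq : forall k, int_pmf (q k)) (x0 : S) (M : nat).

Let st := kernel_law sQ.
Let qM k := trunc_law (pq k) M.

Let q0 k y : 0 <= q k y. Proof. by case: (pq k). Qed.
Let Q0 x y : 0 <= Q x y. Proof. by case: sQ. Qed.

Local Notation law0 := (law0 Q q x0).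

(* [law0] restricted to paths all of whose [Y]'s lie in [-M, M] *)
Fixpoint box_law m : S -> int -> R :=
  if m is m'.+1 then fun x' s =>
    \sum_(y <- box M) (\sum_x box_law m' x (s - y) * Q x x') * q x' y
  else fun x s => ((x == x0) && (s == 0))%:R.

Lemma box_law_ge0 m x s : 0 <= box_law m x s.
Proof.
elim: m x s => [|m IH] x s /=; first exact: ler0n.
by apply: sumr_ge0 => y _; rewrite mulr_ge0 ?sumr_ge0 // => k _; rewrite mulr_ge0.
Qed.

Lemma law0_ge0 m x s : 0 <= law0 m x s.
Proof.
elim: m x s => [|m IH] x s /=; first exact: ler0n.
apply: fine_ge0; apply: esum_ge0 => y _; rewrite lee_fin mulr_ge0 ?sumr_ge0 // => k _.
by rewrite mulr_ge0.
Qed.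

(** [A] is the law of [X_m]. Bounds on finite sums are the useful form: they make the infinite sums
    in [law0] converge, so that [fine] returns their true value. *)
Lemma law0_mass m : exists2 A : S -> R, \sum_x A x = 1 &
  forall x F, uniq F -> \sum_(s <- F) law0 m x s <= A x.
Proof.
elim: m => [|m [A A1 AF]].
  exists (fun x => (x == x0)%:R).
    by rewrite (bigD1 x0) //= eqxx big1 ?addr0 // => x /negPf ->.
  move=> x F uF /=; case: eqP => _ /=; last by rewrite big1.
  rewrite -natr_sum ler_nat; apply: (@leq_trans (count_mem 0 F)).
    by rewrite -sum1_count [leqRHS]big_mkcond /=; apply: leq_sum => s _; case: eqP.
  by rewrite count_uniq_mem //; case: (_ \in _).
have A0 x : 0 <= A x by apply: le_trans (AF x [::] isT); rewrite big_nil.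
exists (fun x' => \sum_x A x * Q x x').
  by rewrite exchange_big -[RHS]A1; apply: eq_bigr => x _; rewrite -big_distrr /= sQ.2 mulr1.
move=> x' F uF /=; apply: sum_fine_esum_le => [s y|r ur].
  by rewrite mulr_ge0 ?sumr_ge0 // => k _; rewrite mulr_ge0 ?law0_ge0.
apply: (@le_trans _ _ (\sum_(y <- r) (\sum_x A x * Q x x') * q x' y)).
  apply: ler_sum => y _; rewrite -big_distrl /= ler_wpM2r // exchange_big /=.
  apply: ler_sum => x _; rewrite -big_distrl /= ler_wpM2r //.
  rewrite -(big_map (fun s => s - y) xpredT (law0 m x)); apply: AF.
  by rewrite map_inj_uniq // => i j; lia.
rewrite -big_distrr /= -[leRHS]mulr1 ler_wpM2l ?pmf_sum_le1 //.
by apply: sumr_ge0 => x _; rewrite mulr_ge0.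
Qed.

Lemma box_law_le m x s : box_law m x s <= law0 m x s.
Proof.
elim: m x s => [|m IH] x' s //=.
apply: (@le_trans _ _ (\sum_(y <- box M) (\sum_x law0 m x (s - y) * Q x x') * q x' y)).
  apply: ler_sum => y _; rewrite ler_wpM2r //; apply: ler_sum => x _.
  by rewrite ler_wpM2r.
have [A A1 AF] := law0_mass m.
have law_le x t : law0 m x t <= A x by have := AF x [:: t] isT; rewrite big_seq1.
apply: (@fine_esum_ge _ _ _ (\sum_x A x * Q x x')); rewrite ?box_uniq //.
  by move=> y; rewrite mulr_ge0 ?sumr_ge0 // => k _; rewrite mulr_ge0 ?law0_ge0.
move=> r ur; apply: (@le_trans _ _ (\sum_(y <- r) (\sum_x A x * Q x x') * q x' y)).
  by apply: ler_sum => y _; rewrite ler_wpM2r //; apply: ler_sum => x _; rewrite ler_wpM2r.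
rewrite -big_distrr /= -[leRHS]mulr1 ler_wpM2l ?pmf_sum_le1 //.
by apply: sumr_ge0 => x _; rewrite mulr_ge0 //; apply: le_trans (law_le x 0); exact: law0_ge0.
Qed.

Variable eps : R.
Hypothesis eps01 : 0 <= eps <= 1.
Hypothesis eps_defect : forall k, box_defect (q k) M <= eps.

(** Whatever the state, each new value stays in the box with probability at least [1 - eps]. The
    condition on [N] makes [box N] hold every sum of [m] such values shifted by [c]. *)
Lemma box_law_mass m N c : (m * M + `|c| <= N)%N ->
  (1 - eps) ^+ m <= \sum_x \sum_(t <- box N) box_law m x (t - c).
Proof.
elim: m N c => [|m IH] N c mN.
  rewrite expr0 (bigD1 x0) //= [X in _ <= X + _](big_rem c) /=; last by rewrite mem_box; lia.
  rewrite eqxx subrr eqxx /= -addrA lerDl; apply: addr_ge0.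
    by apply: sumr_ge0 => t _; exact: ler0n.
  by apply: sumr_ge0 => x _; apply: sumr_ge0 => t _; exact: ler0n.
have {}IH N' c' : (m * M + `|c'| <= N')%N ->
    (1 - eps) ^+ m <= \sum_x \sum_(t <- box N') box_law m x (t - c') by exact: IH.
rewrite exprSr.
apply: (@le_trans _ _ (\sum_x' \sum_(y <- box M) q x' y *
    \sum_x Q x x' * \sum_(t <- box N) box_law m x (t - (c + y)))); last first.
  apply: ler_sum => x' _; rewrite /= exchange_big /=; apply: ler_sum => y _.
  rewrite mulrC -big_distrl /= ler_wpM2r // exchange_big /=; apply: ler_sum => x _.
  rewrite mulrC -big_distrl /= ler_wpM2r //; apply: ler_sum => t _.
  by rewrite opprD addrA.
pose B (x : S) := \sum_(t <- box (m * M)) box_law m x t.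
have BN x y : y \in box M -> B x <= \sum_(t <- box N) box_law m x (t - (c + y)).
  rewrite mem_box => yM; rewrite /B.
  rewrite (eq_bigr (fun t => box_law m x (t + (c + y) - (c + y)))); last first.
    by move=> t _; rewrite addrK.
  apply: (@sum_sub_le _ _ _ (fun t => box_law m x (t - (c + y))) (fun t => t + (c + y))) => //.
  - by move=> t; exact: box_law_ge0.
  - exact: box_uniq.
  - exact: box_uniq.
  - by move=> i j; lia.
  - by move=> t; rewrite !mem_box; move: mN yM; nia.
have B0 x : 0 <= B x by apply: sumr_ge0 => t _; exact: box_law_ge0.
apply: (@le_trans _ _ (\sum_x' \sum_(y <- box M) q x' y * \sum_x Q x x' * B x)); last first.
  apply: ler_sum => x' _; rewrite [leLHS]big_seq [leRHS]big_seq; apply: ler_sum => y yM.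
  by rewrite ler_wpM2l //; apply: ler_sum => x _; rewrite ler_wpM2l // BN.
apply: (@le_trans _ _ (\sum_x' (1 - eps) * \sum_x Q x x' * B x)); last first.
  apply: ler_sum => x' _; rewrite -big_distrl /= ler_wpM2r //.
    by apply: sumr_ge0 => x _; rewrite mulr_ge0.
  by have := eps_defect x'; rewrite /box_defect; lra.
rewrite -big_distrr /= mulrC ler_wpM2l //; first by case/andP: eps01; lra.
rewrite exchange_big /=; under eq_bigr do rewrite -big_distrl /= sQ.2 mul1r.
have /IH : (m * M + `|0 : int| <= m * M)%N by rewrite addn0.
move=> /le_trans; apply; apply: ler_sum => x _; rewrite le_eqVlt; apply/orP; left; apply/eqP.
by apply: eq_bigr => t _; rewrite subr0.
Qed.

Local Notation WK := (walk qM st).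

Lemma Ex_walk_rcons m u F : Ex (WK m.+1 u) F = Ex (WK m u) (fun p =>
  Ex (st p.1) (fun x => Ex (qM x) (fun y => F (x, p.2 + y)))).
Proof.
elim: m u F => [|m IH] u F.
  rewrite Ex_walkS [RHS]Ex_walk0; apply: eq_Ex => x; apply: eq_Ex => y.
  by rewrite Ex_walk0 addr0 add0r.
rewrite Ex_walkS [RHS]Ex_walkS; apply: eq_Ex => x; apply: eq_Ex => y; rewrite IH.
by apply: eq_Ex => p; apply: eq_Ex => x'; apply: eq_Ex => y' /=; rewrite addrA.
Qed.

(** Inside the box a truncated value has its original weight, and the extra atom at 0 can only add
    to the mean of a nonnegative function. *)
Lemma box_law_walk m N c (F : S -> int -> R) : (forall x t, 0 <= F x t) ->
  \sum_x \sum_(t <- box N) box_law m x (t - c) * F x t <=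
  Ex (WK m x0) (fun p => F p.1 (p.2 + c)).
Proof.
elim: m N c F => [|m IH] N c F F0.
  rewrite Ex_walk0 /= add0r (bigD1 x0) //= [X in _ + X]big1 => [|x /negPf xx0]; last first.
    by apply: big1 => t _; rewrite xx0 mul0r.
  rewrite addr0 (bigID (pred1 c)) /= [X in _ + X]big1 => [|t /negPf tc]; last first.
    by rewrite subr_eq0 tc andbF mul0r.
  rewrite addr0 big_mkcond /= (eq_bigr (fun t => (t == c)%:R * F x0 c)).
    rewrite -big_distrl /= -[leRHS]mul1r ler_wpM2r // -natr_sum.
    rewrite (ler_nat _ _ 1); apply: (@leq_trans (count_mem c (box N))).
      by rewrite -sum1_count [leqRHS]big_mkcond /=; apply: leq_sum => t _; case: eqP.
    by rewrite count_uniq_mem ?box_uniq //; case: (_ \in _).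
  by move=> t _; case: eqP => [->|_]; rewrite ?mul0r // subrr !eqxx.
pose F1 x t := \sum_x' Q x x' * \sum_(y <- box M) q x' y * F x' (t + y).
have F10 x t : 0 <= F1 x t.
  by rewrite sumr_ge0 // => *; rewrite mulr_ge0 ?sumr_ge0 // => *; rewrite mulr_ge0.
rewrite Ex_walk_rcons.
apply: (@le_trans _ _ (Ex (WK m x0) (fun p => F1 p.1 (p.2 + c)))); last first.
  apply: Ex_le => p; rewrite Ex_fin; apply: ler_sum => x' _; rewrite ler_wpM2l //.
  rewrite Ex_trunc addr0; apply: (@le_trans _ _ (\sum_(y <- box M) q x' y * F x' (p.2 + y + c))).
    by apply: ler_sum => y _; rewrite addrAC.
  rewrite lerDl; apply: mulr_ge0; last exact: F0.
  by rewrite /box_defect subr_ge0; apply: pmf_sum_le1 => //; exact: box_uniq.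
apply: le_trans (IH (N + M)%N c F1 F10).
pose f x' y x t := box_law m x (t - c) * (Q x x' * (q x' y * F x' (t + y))).
have -> : \sum_x \sum_(t <- box (N + M)) box_law m x (t - c) * F1 x t =
    \sum_x' \sum_(y <- box M) \sum_x \sum_(t <- box (N + M)) f x' y x t.
  under [RHS]eq_bigr do rewrite exchange_big /=.
  rewrite [RHS]exchange_big /=; apply: eq_bigr => x _.
  under [RHS]eq_bigr do rewrite exchange_big /=.
  rewrite [RHS]exchange_big /=; apply: eq_bigr => t _.
  rewrite big_distrr /=; apply: eq_bigr => x' _; rewrite mulrA big_distrr /=.
  by apply: eq_bigr => y _; rewrite /f [RHS]mulrA.
have -> : \sum_x' \sum_(t <- box N) box_law m.+1 x' (t - c) * F x' t =
    \sum_x' \sum_(y <- box M) \sum_x \sum_(t <- box N) f x' y x (t - y).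
  apply: eq_bigr => x' _; under [RHS]eq_bigr do rewrite exchange_big /=.
  rewrite [RHS]exchange_big /=; apply: eq_bigr => t _; rewrite big_distrl /=.
  apply: eq_bigr => y _; rewrite -mulrA big_distrl /=; apply: eq_bigr => x _.
  by rewrite /f subrK (addrAC t) -!mulrA.
apply: ler_sum => x' _; rewrite [leLHS]big_seq [leRHS]big_seq; apply: ler_sum => y yM.
apply: ler_sum => x _; apply: (@sum_sub_le _ _ _ (f x' y x) (fun t => t - y)).
- by move=> t; rewrite /f mulr_ge0 ?box_law_ge0 // mulr_ge0 // mulr_ge0.
- exact: box_uniq.
- exact: box_uniq.
- by move=> i j; lia.
- by move=> t; move: yM; rewrite !mem_box; lia.
Qed.

(* [box_law] is a common minorant of the truncated and of the original law, of mass [1 - eta]. *)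
Lemma walk_law0 m N c eta (H : S -> int -> R) : (m * M + `|c| <= N)%N ->
  1 - (1 - eps) ^+ m <= eta -> (forall x t, `|H x t| <= 1) ->
  `|Ex (WK m x0) (fun p => H p.1 (p.2 + c)) -
    \sum_x \sum_(t <- box N) law0 m x (t - c) * H x t| <= 2 * eta.
Proof.
move=> mN e H1; set E := Ex _ _.
pose Sb := \sum_x \sum_(t <- box N) box_law m x (t - c) * H x t.
pose mass := \sum_x \sum_(t <- box N) box_law m x (t - c).
have mass_ge : 1 - eta <= mass by have := box_law_mass mN; rewrite -/mass; lra.
have Hlo x t : 0 <= 1 + H x t by have := H1 x t; rewrite ler_norml; lra.
have Hhi x t : 0 <= 1 - H x t by have := H1 x t; rewrite ler_norml; lra.
(* The minorant applies to nonnegative functions only; using it for [1 + H] and for [1 - H] encloses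
   [E] from both sides. *)
have up : mass + Sb <= 1 + E.
  have := box_law_walk m N c Hlo; rewrite ExD Ex_cst -/E.
  under eq_bigr do under eq_bigr do rewrite mulrDr mulr1.
  by under eq_bigr do rewrite big_split /=; rewrite big_split /=.
have lo : mass - Sb <= 1 - E.
  have := box_law_walk m N c Hhi; rewrite ExB Ex_cst -/E.
  under eq_bigr do under eq_bigr do rewrite mulrBr mulr1.
  by under eq_bigr do rewrite sumrB; rewrite sumrB.
have close : `|\sum_x \sum_(t <- box N) law0 m x (t - c) * H x t - Sb| <= eta.
  have -> : \sum_x \sum_(t <- box N) law0 m x (t - c) * H x t - Sb =
      \sum_x \sum_(t <- box N) (law0 m x (t - c) - box_law m x (t - c)) * H x t.
    rewrite -sumrB; apply: eq_bigr => x _; rewrite -sumrB; apply: eq_bigr => t _.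
    by rewrite mulrBl.
  apply: (@le_trans _ _ (\sum_x \sum_(t <- box N) (law0 m x (t - c) - box_law m x (t - c)))).
    apply: le_trans (ler_norm_sum _ _ _) _; apply: ler_sum => x _.
    apply: le_trans (ler_norm_sum _ _ _) _; apply: ler_sum => t _.
    have d0 : 0 <= law0 m x (t - c) - box_law m x (t - c) by rewrite subr_ge0 box_law_le.
    by rewrite normrM (ger0_norm d0) ler_piMr.
  under eq_bigr do rewrite sumrB; rewrite sumrB -/mass.
  suff : \sum_x \sum_(t <- box N) law0 m x (t - c) <= 1 by lra.
  have [A A1 AF] := law0_mass m; rewrite -A1; apply: ler_sum => x _.
  rewrite -(big_map (fun t => t - c) xpredT (law0 m x)); apply: AF.
  by rewrite map_inj_uniq ?box_uniq // => i j; lia.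
move: close; rewrite !ler_norml; lra.
Qed.

Lemma walk_shift m eta (H : S -> int -> R) : (forall x t, `|H x t| <= 1) ->
  1 - (1 - eps) ^+ m <= eta -> (beta Q q x0 m < +oo)%E ->
  `|Ex (WK m x0) (fun p => H p.1 (p.2 + 1)) - Ex (WK m x0) (fun p => H p.1 p.2)| <=
    fine (beta Q q x0 m) + 4 * eta.
Proof.
move=> H1 e bfin; pose N := (m * M + 1)%N.
have h1 := @walk_law0 m N 1 eta H (leqnn _) e H1.
have N0 : (m * M + `|0 : int| <= N)%N by rewrite addn0 leq_addr.
have h0 := walk_law0 N0 e H1.
have -> : Ex (WK m x0) (fun p => H p.1 p.2) = Ex (WK m x0) (fun p => H p.1 (p.2 + 0)).
  by apply: eq_Ex => p; rewrite addr0.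
suff : `|\sum_x \sum_(t <- box N) law0 m x (t - 1) * H x t -
    \sum_x \sum_(t <- box N) law0 m x (t - 0) * H x t| <= fine (beta Q q x0 m).
  by move: h1 h0; rewrite !ler_norml; lra.
rewrite -sumrB; under eq_bigr do rewrite -sumrB.
apply: (@le_trans _ _ (\sum_x \sum_(t <- box N) `|law0 m x (t - 1) - law0 m x t|)).
  apply: le_trans (ler_norm_sum _ _ _) _; apply: ler_sum => x _.
  apply: le_trans (ler_norm_sum _ _ _) _; apply: ler_sum => t _.
  by rewrite subr0 -mulrBl normrM ler_piMr.
rewrite -lee_fin fineK; last first.
  by rewrite ge0_fin_numE // /beta esum_ge0 // => p _; rewrite lee_fin.
have -> : \sum_x \sum_(t <- box N) `|law0 m x (t - 1) - law0 m x t| =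
    \sum_(p <- [seq (x, t) | x <- enum S, t <- box N])
      `|law0 m p.1 (p.2 - 1) - law0 m p.1 p.2| by rewrite big_allpairs big_enum.
rewrite -sumEFin.
apply: esum_ge_seq => //; rewrite allpairs_uniq ?enum_uniq ?box_uniq //.
by move=> [a b] [c d].
Qed.

(** Since [beta] compares joint laws of state and sum, the values after time [m] can be averaged
    into a test function of both. *)
Lemma sum_from_smooth m eta : 1 - (1 - eps) ^+ m <= eta -> (beta Q q x0 m < +oo)%E ->
  smooth x0 qM (fine (beta Q q x0 m) + 4 * eta) m st.
Proof.
move=> e bfin r h mr h1; rewrite -(subnKC mr) !sum_from_walk.
pose H x (s : int) := Ex (sum_from qM st (r - m) x) (fun t => h (s + t)).
have H1 x s : `|H x s| <= 1 by exact: Ex_norm_le.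
apply: le_trans (walk_shift H1 e bfin).
rewrite le_eqVlt; apply/orP; left; apply/eqP; congr (`|_ - _|).
by apply: eq_Ex => p; apply: eq_Ex => t; congr h; ring.
Qed.
End TruncatedChain.

(** * Moments of the span between meetings *)

Section HittingTimes.
Variables (R : realType) (T : finType) (Q : T -> T -> R) (s0 : T).

Fixpoint hit (b : nat) (z : T) : R :=
  if b is b'.+1 then (z != s0)%:R * \sum_w Q z w * hit b' w else (z == s0)%:R.

Hypothesis sQ : stochastic Q.

Lemma hit_ge0 b z : 0 <= hit b z.
Proof.
elim: b z => [|b IH] z /=; first exact: ler0n.
by rewrite mulr_ge0 ?sumr_ge0 // => w _; rewrite mulr_ge0 //; case: sQ.
Qed.

Lemma avoid_ge0 N z : 0 <= avoid Q s0 N z.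
Proof.
elim: N z => [|N IH] z //=.
by rewrite mulr_ge0 ?sumr_ge0 // => w _; rewrite mulr_ge0 //; case: sQ.
Qed.

Lemma sum_hit N z : \sum_(b < N) hit b z + avoid Q s0 N z = 1.
Proof.
elim: N z => [|N IH] z; first by rewrite big_ord0 add0r.
rewrite big_ord_recl /=; have [_|zs] := eqVneq z s0.
  by rewrite !mul0r big1 ?addr0 // => i _; rewrite mul0r.
rewrite add0r mul1r (eq_bigr (fun i : 'I_N => \sum_w Q z w * hit i w)); last first.
  by move=> i _; rewrite mul1r.
rewrite exchange_big /= -big_split /= -[RHS](sQ.2 z); apply: eq_bigr => w _.
by rewrite -big_distrr /= -mulrDr IH mulr1.
Qed.
End HittingTimes.

Section MeetingSize.
Variables (R : realType) (S : finType) (Q : S -> S -> R) (sQ : stochastic Q) (o : S).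
Let st := kernel_law sQ.
Let oo := (o, o).
Local Notation PQ := (pair_kernel Q).

Lemma pair_kernel_stochastic : stochastic PQ.
Proof.
have [Q0 Q1] := sQ; split => [x y|x]; first by rewrite mulr_ge0.
rewrite -(pair_bigA _ (fun a b => Q x.1 a * Q x.2 b)) /=.
by under eq_bigr do rewrite -big_distrr /= Q1 mulr1.
Qed.

Lemma Ex_pair_step z F : Ex (st z.1) (fun x => Ex (st z.2) (fun x' => F (x, x'))) =
  \sum_w PQ z w * F w.
Proof.
rewrite Ex_fin (eq_bigr (fun x => \sum_x' Q z.1 x * Q z.2 x' * F (x, x'))); last first.
  by move=> x _; rewrite Ex_fin big_distrr /=; apply: eq_bigr => x' _; rewrite mulrA.
by rewrite pair_bigA /=; apply: eq_bigr => -[x x'].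
Qed.

(** The length of the run is the hitting time of [(o, o)] capped at [r]. The cut [N] is kept apart
    from [r] so that it can tend to infinity for a fixed window. *)
Lemma meeting_size (phi : nat -> R) r N z : (r <= N)%N ->
  Ex (meeting o st r z) (fun ls => phi (size ls)) =
  \sum_(b < N) hit PQ oo b z * phi (minn b r) + avoid PQ oo N z * phi r.
Proof.
elim: r N z phi => [|r IH] N z phi rN.
  rewrite Ex_meeting0 /=; under eq_bigr do rewrite minn0.
  by rewrite -big_distrl /= -mulrDl (sum_hit _ pair_kernel_stochastic) mul1r.
case: N rN => // N rN; rewrite big_ord_recl /= -/oo min0n.
have [->|zo] := eqVneq z oo.
  rewrite (Ex_meeting_oo o st r.+1 (fun ls => phi (size ls))) /=.
  by rewrite mul1r !mul0r addr0 big1 ?addr0 // => i _; rewrite !mul0r.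
rewrite Ex_meetingS // mul0r add0r mul1r.
rewrite (Ex_pair_step z (fun w => Ex (meeting o st r w) (fun ls => phi (size ls).+1))).
rewrite (eq_bigr (fun i : 'I_N => \sum_w PQ z w * (hit PQ oo i w * phi (minn i r).+1))); last first.
  move=> i _; rewrite mul1r big_distrl /=; apply: eq_bigr => w _.
  by rewrite /bump add1n minnSS mulrA.
rewrite exchange_big /= big_distrl /= -big_split /=; apply: eq_bigr => w _.
by rewrite (IH N w (fun k => phi k.+1)) // -big_distrr /= -mulrA -mulrDr.
Qed.
End MeetingSize.

(** * Probabilities of two-sided windows *)

Section WindowSum.
Variables (R : realType) (T : finType) (z0 : T).

Lemma big_tuple_cons N (f : N.+1.-tuple T -> R) :
  \sum_(w : N.+1.-tuple T) f w = \sum_x \sum_(v : N.-tuple T) f [tuple of x :: v].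
Proof.
rewrite pair_bigA /=; apply: (reindex (fun p : T * N.-tuple T => [tuple of p.1 :: p.2])).
exists (fun w => (thead w, [tuple of behead w])) => [[x v] _|w _] /=.
  by congr pair; apply: val_inj.
by rewrite [RHS]tuple_eta; apply: val_inj.
Qed.

Variable Q : T -> T -> R.

(** The requirement may vary with the position, because [tau_event] treats the ends and the interior
    of the window differently. *)
Fixpoint constrained (N : nat) (ok : nat -> pred T) (x : T) : R :=
  if N is N'.+1 then
    (ok 0%N x)%:R * \sum_y Q x y * constrained N' (fun i => ok i.+1) y
  else (ok 0%N x)%:R.

Lemma eq_constrained N ok ok' x : (forall i y, (i <= N)%N -> ok i y = ok' i y) ->
  constrained N ok x = constrained N ok' x.
Proof.
elim: N ok ok' x => [|N IH] ok ok' x e /=; rewrite e //; congr (_ * _).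
by apply: eq_bigr => y _; congr (_ * _); apply: IH => i u iN; exact: e.
Qed.

Lemma window_prob_constrained (mu : T -> R) N (ok : nat -> pred T) :
  \sum_(w : N.+1.-tuple T | [forall i : 'I_N.+1, ok i (nth z0 w i)]) window_prob mu Q w =
  \sum_x mu x * constrained N ok x.
Proof.
elim: N mu ok => [|N IH] mu ok; rewrite big_mkcond big_tuple_cons; apply: eq_bigr => x _.
  rewrite (big_pred1 [tuple]); last by move=> v; rewrite (tuple0 v) /= eqxx.
  rewrite /window_prob theadE big_ord0 mulr1.
  have -> : [forall i : 'I_1, ok i (nth z0 [tuple x] i)] = ok 0%N x.
    by apply/forallP/idP => [/(_ ord0)|h i] //; rewrite (ord1 i).
  by rewrite /=; case: (ok _ _); rewrite ?mulr1 ?mulr0.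
rewrite /= -IH [in RHS]big_mkcond /= !big_distrr /=; apply: eq_bigr => v _.
have -> : [forall i : 'I_N.+2, ok i (nth z0 [tuple of x :: v] i)] =
    ok 0%N x && [forall i : 'I_N.+1, ok i.+1 (nth z0 v i)].
  apply/forallP/andP => [h|[h0 /forallP h] i].
    by split; [exact: (h ord0) | apply/forallP => i; exact: (h (lift ord0 i))].
  by case: (unliftP ord0 i) => [j ->|->] //=; exact: h.
case: (ok 0%N x); rewrite ?mul0r ?mulr0 // mul1r.
case: [forall _, _]; rewrite ?mulr0 //= /window_prob theadE big_ord_recl /=; congr (_ * (_ * _)).
  by rewrite /thead (tnth_nth x).
apply: eq_bigr => i _; rewrite /bump add1n /=.
by rewrite add0n; congr Q; apply: set_nth_default; rewrite size_tuple; have := ltn_ord i; lia.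
Qed.

Lemma hit_constrained b z : hit Q z0 b z =
  constrained b (fun i y => if i == b then y == z0 else y != z0) z.
Proof.
elim: b z => [|b IH] z //=; congr (_ * _); apply: eq_bigr => w _; congr (_ * _).
by rewrite IH; apply: eq_constrained => i y _; rewrite eqSS.
Qed.

Definition taboo_step (G : T -> R) (w : T) : R := \sum_z Q w z * ((z != z0)%:R * G z).

Lemma iter_taboo_constrained a b f (g : pred T) w :
  (g w)%:R * iter a taboo_step (constrained b f) w =
  constrained (a + b) (fun i y => [&& (i == 0)%N ==> g y, (0 < i <= a)%N ==> (y != z0) &
    (a <= i)%N ==> f (i - a)%N y]) w.
Proof.
elim: a g w => [|a IH] g w /=.
  rewrite add0n; case: b => [|b] /=; rewrite subnn -mulnb natrM //.
  by rewrite mulrA.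
rewrite andbT; congr (_ * _); apply: eq_bigr => z _; congr (_ * _).
rewrite (IH (fun z => z != z0)); apply: eq_constrained => i y _; rewrite subSS !ltnS.
by case: i => [|i] //=; case: a {IH} => //=; rewrite ?andbT ?andbb; case: (y != z0).
Qed.

Variables (Qr : T -> T -> R) (mu : T -> R).
Hypothesis rev : forall x y, mu x * Q x y = mu y * Qr y x.

(** Read in reverse, a backward run from [z] to its first visit to [z0] is a forward run that starts
    in [z0] and avoids it for [a] steps until it is at [z]. *)
Lemma hit_reversed a G : \sum_z mu z * hit Qr z0 a z * G z =
  \sum_z mu z * ((z == z0)%:R * iter a taboo_step G z).
Proof.
elim: a G => [|a IH] G; first by apply: eq_bigr => z _; rewrite mulrA.
rewrite iterSr -IH; under eq_bigr do rewrite /= mulrCA -mulrA big_distrr /= big_distrl /= big_distrr /=.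
rewrite exchange_big /=; apply: eq_bigr => w _; rewrite /taboo_step big_distrr /=.
apply: eq_bigr => z _; rewrite mulrA [RHS]mulrA [_ * Q w z]mulrAC rev; ring.
Qed.

Lemma tau_window_sum a b :
  \sum_(w : (a + b).+1.-tuple T | tau_event z0 w) window_prob mu Q w =
  \sum_z mu z * hit Qr z0 a z * hit Q z0 b z.
Proof.
rewrite hit_reversed (eq_bigr (fun z => mu z * constrained (a + b) (fun i y =>
    [&& (i == 0)%N ==> (y == z0), (0 < i <= a)%N ==> (y != z0) &
    (a <= i)%N ==> (if (i - a == b)%N then y == z0 else y != z0)]) z)); last first.
  move=> z _; congr (_ * _).
  rewrite -(iter_taboo_constrained a b (fun i y => if i == b then y == z0 else y != z0) (pred1 z0)).
  by congr (_ * _); elim: a z => [|a IH] z /=; [rewrite hit_constrained |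
     apply: eq_bigr => u _; rewrite IH].
rewrite -window_prob_constrained; apply: eq_bigl => w; rewrite /tau_event.
apply/and3P/forallP => [[w0 wab /forallP H] i|H].
  have /implyP Hi := H i; apply/and3P; split; apply/implyP => hi.
  - by rewrite (eqP hi).
  - by apply: Hi; rewrite hi.
  - case: eqP => iab; first by rewrite (_ : nat_of_ord i = (a + b)%N) //; lia.
    by apply: Hi; apply/orP; right; have := ltn_ord i; lia.
split.
- by have /and3P[] := H ord0.
- by have /and3P[_ _] := H ord_max; rewrite /= leq_addr addKn eqxx.
- apply/forallP => i; apply/implyP => /orP[hi|/andP[ai iab]].
    by have /and3P[_ + _] := H i; rewrite hi.
  by have /and3P[_ _] := H i; rewrite ai /= ifF //; apply/negP => /eqP; lia.
Qed.
End WindowSum.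

Section SpanMoment.
Variables (R : realType) (K : nat) (P : 'M[R]_K.+1) (pi : 'I_K.+1 -> R).
Hypothesis sP : stochastic (fun i j => P i j).
Hypothesis sPr : stochastic (rev_kernel P pi).
Hypothesis spi : stationary_law P pi.
Hypothesis pi_gt0 : forall k, 0 < pi k.

Let pi_sum : \sum_k pi k = 1. Proof. by case: spi. Qed.
Definition stat_law := fin_law (fun k => ltW (pi_gt0 k)) pi_sum.

Lemma rev_kernelE x y : pi x * P x y = pi y * rev_kernel P pi y x.
Proof. by rewrite /rev_kernel mulrCA divff ?mulr1 // gt_eqF. Qed.

Let fw := kernel_law sP.
Let bw := kernel_law sPr.
Let o : 'I_K.+1 := ord0.
Let oo := (o, o).
Local Notation PF := (pair_kernel (fun i j => P i j)).
Local Notation PB := (pair_kernel (rev_kernel P pi)).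

Lemma stat_law_reversal (F : 'I_K.+1 -> 'I_K.+1 -> R) :
  Ex stat_law (fun x => Ex (fw x) (F x)) =
  Ex stat_law (fun x' => Ex (bw x') (fun x => F x x')).
Proof.
rewrite !Ex_fin; under eq_bigr do rewrite Ex_fin big_distrr /=.
rewrite exchange_big /=; apply: eq_bigr => y _; rewrite Ex_fin big_distrr /=.
by apply: eq_bigr => x _; rewrite mulrA rev_kernelE mulrA.
Qed.

Let mu (z : 'I_K.+1 * 'I_K.+1) := pi z.1 * pi z.2.

(** Capping the two hitting times at [l] and [r] only shortens the span. When a side has no meeting
    among its first [N] times, the capped span is still at most [l + r + 1]. *)
Lemma span_moment_window l r N : (l <= N)%N -> (r <= N)%N ->
  Ex (span_law o stat_law fw bw l r) (fun t => t%:R ^+ 2) <=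
  \sum_(a < N) \sum_(b < N) (a + b).+1%:R ^+ 2 * (\sum_z mu z * hit PB oo a z * hit PF oo b z)
  + (l + r).+1%:R ^+ 2 * \sum_z mu z * (avoid PB oo N z + avoid PF oo N z).
Proof.
move=> lN rN; rewrite Ex_span_law.
have sF := pair_kernel_stochastic sP; have sB := pair_kernel_stochastic sPr.
rewrite (Ex_fin _ _ (fun x => _)) (eq_bigr (fun x => \sum_x' mu (x, x') *
   Ex (meeting o bw l (x, x')) (fun ll => Ex (meeting o fw r (x, x')) (fun rr =>
    (size ll + size rr).+1%:R ^+ 2)))); last first.
  by move=> x _; rewrite Ex_fin big_distrr /=; apply: eq_bigr => x' _; rewrite mulrA.
rewrite pair_bigA /= (eq_bigr (fun z => mu z * Ex (meeting o bw l z) (fun ll =>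
  Ex (meeting o fw r z) (fun rr => (size ll + size rr).+1%:R ^+ 2)))); last by case.
have -> : \sum_(a < N) \sum_(b < N) (a + b).+1%:R ^+ 2 *
      (\sum_z mu z * hit PB oo a z * hit PF oo b z) =
    \sum_z mu z * \sum_(a < N) \sum_(b < N) (a + b).+1%:R ^+ 2 * (hit PB oo a z * hit PF oo b z).
  under eq_bigr do under eq_bigr do rewrite big_distrr /=.
  under eq_bigr do rewrite exchange_big /=; rewrite exchange_big /=; apply: eq_bigr => z _.
  rewrite big_distrr /=; apply: eq_bigr => a _; rewrite big_distrr /=; apply: eq_bigr => b _; ring.
rewrite [X in _ + X]big_distrr /= -big_split /=; apply: ler_sum => z _.
rewrite [X in _ + X]mulrCA -mulrDr; apply: ler_wpM2l; first by rewrite mulr_ge0 // ltW.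
set c : R := (l + r).+1%:R ^+ 2.
have cap a b : (minn a l + minn b r).+1%:R ^+ 2 <= c.
  by rewrite /c lerXn2r ?nnegrE // ler_nat; lia.
have cap' a b : (minn a l + minn b r).+1%:R ^+ 2 <= (a + b).+1%:R ^+ 2 :> R.
  by rewrite lerXn2r ?nnegrE // ler_nat; lia.
pose phi a := Ex (meeting o fw r z) (fun rr => (a + size rr).+1%:R ^+ 2) : R.
rewrite (meeting_size sPr o phi z lN) -/oo.
have phiE a : phi a = \sum_(b < N) hit PF oo b z * (a + minn b r).+1%:R ^+ 2
    + avoid PF oo N z * (a + r).+1%:R ^+ 2.
  exact: (meeting_size sP o (fun b => (a + b).+1%:R ^+ 2) z rN).
have hF0 := hit_ge0 oo sF; have hB0 := hit_ge0 oo sB.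
have aF0 := avoid_ge0 oo sF; have aB0 := avoid_ge0 oo sB.
have phi_c a : phi (minn a l) <= c.
  have cE : c = \sum_(b < N) hit PF oo b z * c + avoid PF oo N z * c.
    by rewrite -big_distrl -mulrDl (sum_hit oo sF) mul1r.
  rewrite phiE [leRHS]cE; apply: lerD.
    by apply: ler_sum => b _; apply: ler_wpM2l; [exact: hF0 | exact: cap].
  by apply: ler_wpM2l; [exact: aF0 | rewrite /c lerXn2r ?nnegrE // ler_nat; lia].
apply: (@le_trans _ _ (\sum_(a < N) \sum_(b < N) (a + b).+1%:R ^+ 2 * (hit PB oo a z * hit PF oo b z)
   + \sum_(a < N) hit PB oo a z * (avoid PF oo N z * c) + avoid PB oo N z * c)).
  apply: lerD; last first.
    by apply: ler_wpM2l; [exact: aB0 | have := phi_c l; rewrite minnn].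
  rewrite -big_split /=; apply: ler_sum => a _; rewrite phiE mulrDr; apply: lerD.
    rewrite big_distrr /=; apply: ler_sum => b _.
    rewrite mulrA [leRHS]mulrC; apply: ler_wpM2l; last exact: cap'.
    by apply: mulr_ge0; [exact: hB0 | exact: hF0].
  apply: ler_wpM2l; first exact: hB0.
  apply: ler_wpM2l; first exact: aF0.
  by rewrite /c lerXn2r ?nnegrE // ler_nat; lia.
rewrite -addrA lerD2l mulrDr [leRHS]addrC [c * avoid PB _ _ _]mulrC; apply: lerD => //.
rewrite -big_distrl /= mulrC [leRHS]mulrC; apply: ler_piMr.
  by apply: mulr_ge0; [exact: aF0 | rewrite /c exprn_ge0].
by have := sum_hit oo sB N z; have := aB0 N z; lra.
Qed.

(** The main term is a partial sum of [E_tau2], and the remainder decays like [rho ^- N] by the tail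
    bounds while [l] and [r] stay fixed. *)
Lemma span_moment_le (C Cb rho : R) l r : 1 < rho ->
  hitting_tail_bound PF (ord0, ord0) C rho -> hitting_tail_bound PB (ord0, ord0) Cb rho ->
  ((Ex (span_law o stat_law fw bw l r) (fun t => t%:R ^+ 2))%:E <= E_tau2 P pi)%E.
Proof.
move=> rho1 HC HCb.
pose c : R := (l + r).+1%:R ^+ 2.
have key N : (maxn l r <= N)%N ->
    ((Ex (span_law o stat_law fw bw l r) (fun t => t%:R ^+ 2))%:E <=
      E_tau2 P pi + (c * (Cb + C) * rho ^- N)%:E)%E.
  rewrite geq_max => /andP[lN rN].
  apply: (@le_trans _ _ ((\sum_(a < N) \sum_(b < N) (a + b).+1%:R ^+ 2 *
      (\sum_z mu z * hit PB oo a z * hit PF oo b z))%:E + (c * (Cb + C) * rho ^- N)%:E)%E).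
    rewrite -EFinD lee_fin; apply: le_trans (span_moment_window lN rN) _.
    rewrite lerD2l -mulrA; apply: ler_wpM2l; first by rewrite exprn_ge0.
    apply: (@le_trans _ _ (\sum_z mu z * ((Cb + C) * rho ^- N))).
      apply: ler_sum => z _; apply: ler_wpM2l; first by rewrite mulr_ge0 // ltW.
      by rewrite mulrDl; apply: lerD; [exact: HCb | exact: HC].
    rewrite -big_distrl /= -[leRHS]mul1r ler_wpM2r //.
      have := HC N oo; have := HCb N oo; have := avoid_ge0 oo (pair_kernel_stochastic sP) N oo.
      have := avoid_ge0 oo (pair_kernel_stochastic sPr) N oo; lra.
    rewrite /mu -(pair_bigA _ (fun a b => pi a * pi b)) /=.
    by under eq_bigr do rewrite -big_distrr /= pi_sum mulr1; rewrite pi_sum.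
  rewrite leeD2r //.
  have -> : \sum_(a < N) \sum_(b < N) (a + b).+1%:R ^+ 2 *
      (\sum_z mu z * hit PB oo a z * hit PF oo b z) =
    \sum_(p <- [seq (a, b) | a <- iota 0 N, b <- iota 0 N]) (p.1 + p.2).+1%:R ^+ 2 *
      (\sum_(w : (p.1 + p.2).+1.-tuple ('I_K.+1 * 'I_K.+1) | tau_event oo w)
        window_prob mu PF w).
    rewrite big_allpairs /=.
    have -> : iota 0 N = index_iota 0 N by rewrite /index_iota subn0.
    rewrite big_mkord; apply: eq_bigr => a _.
    rewrite big_mkord; apply: eq_bigr => b _ /=; congr (_ * _).
    rewrite (tau_window_sum oo (Qr := PB)) // => x y.
    by rewrite /mu /pair_kernel mulrACA !rev_kernelE mulrACA.
  rewrite -sumEFin; apply: esum_ge_seq => //.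
  by rewrite allpairs_uniq ?iota_uniq // => -[a b] [a' b'].
case E : (E_tau2 P pi) key => [e| |] key; [|by rewrite leey|by have := key _ (leqnn _)].
rewrite lee_fin; apply/ler_addgt0Pr => eps eps0.
have : (fun N => c * (Cb + C) * rho ^- N) @ \oo --> c * (Cb + C) * 0.
  apply: cvgMl_tmp; under eq_fun do rewrite -exprVn; apply: cvg_expr.
  by rewrite ger0_norm ?invr_ge0 ?invf_lt1 //; lra.
rewrite mulr0 => /cvgrPdist_le /(_ _ eps0) [N _ HN].
have := key (maxn (maxn l r) N) (leq_maxl _ _); rewrite -EFinD lee_fin => /le_trans; apply.
rewrite lerD2l; have /= := HN (maxn (maxn l r) N) (leq_maxr _ _).
by rewrite sub0r normrN; apply: le_trans; exact: ler_norm.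
Qed.
End SpanMoment.

(** * Windows as paths *)

Section PathLaw.
Variables (R : realType) (S : eqType) (q : S -> flaw R int).
Variables (pi : flaw R S) (fw bw : S -> flaw R S).
Hypothesis reversal : forall F : S -> S -> R,
  Ex pi (fun x => Ex (fw x) (F x)) = Ex pi (fun x' => Ex (bw x') (fun x => F x x')).

Definition zsum (s : seq int) : int := \sum_(y <- s) y.

Lemma zsum_takeS l ys : zsum (take l.+1 ys) = zsum (take l ys) + head 0 (drop l ys).
Proof.
elim: l ys => [|l IH] [|y ys]; rewrite /zsum.
- by rewrite !big_nil addr0.
- by rewrite /= take0 big_seq1 big_nil add0r.
- by rewrite !big_nil addr0.
by have := IH ys; rewrite /zsum /= !big_cons => ->; rewrite addrA.
Qed.

Fixpoint pathlaw (r : nat) (x : S) : flaw R (seq int) :=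
  if r is r'.+1 then fbind (q x) (fun y => fbind (fw x) (fun x' =>
    fmap (cons y) (pathlaw r' x')))
  else fmap (fun y => [:: y]) (q x).
Arguments pathlaw : simpl never.

Lemma Ex_path0 x F : Ex (pathlaw 0 x) F = Ex (q x) (fun y => F [:: y]).
Proof. exact: Ex_map. Qed.

Lemma Ex_pathS r x F : Ex (pathlaw r.+1 x) F =
  Ex (q x) (fun y => Ex (fw x) (fun x' => Ex (pathlaw r x') (fun l => F (y :: l)))).
Proof.
rewrite [LHS]Ex_bind; apply: eq_Ex => y; rewrite Ex_bind; apply: eq_Ex => x'.
exact: Ex_map.
Qed.

Lemma path_sum r x f : Ex (pathlaw r x) (fun l => f (zsum l)) =
  Ex (q x) (fun y => Ex (sum_from q fw r x) (fun t => f (y + t))).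
Proof.
elim: r x f => [|r IH] x f.
  by rewrite Ex_path0; apply: eq_Ex => y; rewrite Ex_sum_from0 /zsum big_seq1 addr0.
rewrite Ex_pathS; apply: eq_Ex => y; rewrite Ex_sum_fromS; apply: eq_Ex => x'.
under eq_Ex do rewrite /zsum big_cons -/(zsum _).
exact: (IH x' (fun t => f (y + t))).
Qed.

Lemma path_head r x F : Ex (pathlaw r x) (fun l => F (head 0 l) (zsum (behead l))) =
  Ex (q x) (fun y => Ex (sum_from q fw r x) (F y)).
Proof.
case: r => [|r]; first by rewrite Ex_path0; apply: eq_Ex => y; rewrite Ex_sum_from0 /zsum big_nil.
rewrite Ex_pathS; apply: eq_Ex => y; rewrite Ex_sum_fromS; apply: eq_Ex => x'.
exact: (path_sum r x' (F y)).
Qed.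

(** Seen from the state at position [l], the values before it form a backward sum. Each step of the
    induction carries one value across the mark by [reversal]. *)
Lemma path_split l r G :
  Ex pi (fun x => Ex (pathlaw (l + r) x) (fun ys => G (zsum (take l ys)) (drop l ys))) =
  Ex pi (fun x => Ex (sum_from q bw l x) (fun s => Ex (pathlaw r x) (G s))).
Proof.
elim: l r G => [|l IH] r G.
  apply: eq_Ex => x; rewrite Ex_sum_from0; apply: eq_Ex => ys.
  by rewrite take0 drop0 /zsum big_nil.
rewrite addSnnS; pose G' s ys := G (s + head 0 ys) (behead ys).
transitivity (Ex pi (fun x => Ex (pathlaw (l + r.+1) x) (fun ys =>
    G' (zsum (take l ys)) (drop l ys)))).
  apply: eq_Ex => x; apply: eq_Ex => ys; rewrite /G'; congr G.
    exact: zsum_takeS.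
  by rewrite -drop1 drop_drop add1n.
rewrite IH.
transitivity (Ex pi (fun x => Ex (fw x) (fun x' => Ex (q x) (fun y =>
   Ex (sum_from q bw l x) (fun s => Ex (pathlaw r x') (G (y + s))))))).
  apply: eq_Ex => x; under eq_Ex do rewrite Ex_pathS; rewrite Ex_swap.
  rewrite [RHS]Ex_swap; apply: eq_Ex => y; rewrite Ex_swap; apply: eq_Ex => x'.
  by apply: eq_Ex => s; apply: eq_Ex => ys; rewrite /G' /= addrC.
rewrite (reversal (fun x x' => Ex (q x) (fun y => Ex (sum_from q bw l x) (fun s =>
  Ex (pathlaw r x') (G (y + s)))))).
by apply: eq_Ex => x'; rewrite Ex_sum_fromS.
Qed.

Lemma window_path l r G : window q pi fw bw l r G =
  Ex pi (fun x => Ex (pathlaw (l + r) x) (fun ys => G (nth 0 ys l) (zsum ys))).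
Proof.
have := path_split l r (fun s ys => G (head 0 ys) (s + head 0 ys + zsum (behead ys))).
rewrite /window => E; transitivity (Ex pi (fun x => Ex (sum_from q bw l x) (fun s =>
    Ex (pathlaw r x) (fun ys => G (head 0 ys) (s + head 0 ys + zsum (behead ys)))))).
  apply: eq_Ex => x; rewrite Ex_swap; apply: eq_Ex => s.
  by rewrite (path_head r x (fun y t => G y (s + y + t))).
rewrite -E; apply: eq_Ex => x; apply: eq_Ex => ys.
rewrite -nth0 nth_drop addn0; congr G.
have : zsum (take l ys) + zsum (drop l ys) = zsum ys.
  by rewrite /zsum -big_cat cat_take_drop.
case: (ltnP l (size ys)) => lys; last first.
  by rewrite drop_oversize // nth_default // /zsum !big_nil !addr0.
by rewrite (drop_nth 0 lys) /zsum big_cons addrA.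
Qed.

Lemma eq_Ex_path_size r x F G : (forall ys, size ys = r.+1 -> F ys = G ys) ->
  Ex (pathlaw r x) F = Ex (pathlaw r x) G.
Proof.
elim: r x F G => [|r IH] x F G FG; first by rewrite !Ex_path0; apply: eq_Ex => y; exact: FG.
rewrite !Ex_pathS; apply: eq_Ex => y; apply: eq_Ex => x'; apply: IH => ys sy.
by apply: FG; rewrite /= sy.
Qed.

(** All the marked windows are one path with different marks, and the marked values add up to the
    total. This recovers the mean of [W g(W)] from the [n] covariances. *)
Lemma window_total n g : (0 < n)%N ->
  \sum_(l < n) window q pi fw bw l (n.-1 - l) (fun y w => y%:~R * g w) =
  window q pi fw bw 0 n.-1 (fun _ w => w%:~R * g w).
Proof.
move=> n0; rewrite window_path add0n.
have -> : \sum_(l < n) window q pi fw bw l (n.-1 - l) (fun y w => y%:~R * g w) =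
    \sum_(l < n) Ex pi (fun x => Ex (pathlaw n.-1 x) (fun ys => (nth 0 ys l)%:~R * g (zsum ys))).
  by apply: eq_bigr => l _; rewrite window_path subnKC // -ltnS prednK.
have Ex_sum A (d : flaw R A) (f : 'I_n -> A -> R) :
    \sum_(l < n) Ex d (f l) = Ex d (fun a => \sum_(l < n) f l a).
  rewrite /Ex exchange_big /=; apply: eq_bigr => p _.
  by rewrite big_distrr.
rewrite Ex_sum; apply: eq_Ex => x; rewrite Ex_sum; apply: eq_Ex_path_size => ys.
rewrite prednK // => sy; rewrite -big_distrl /= -rmorph_sum /=; congr (_%:~R * _).
by rewrite /zsum (big_nth 0) sy big_mkord.
Qed.

(** [W] starts at index 1 and the cylinders at index 0; stationarity lets the value at index 0 be
    dropped. *)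
Lemma path_behead r F : (forall G, Ex pi (fun x => Ex (fw x) G) = Ex pi G) -> Ex pi (fun x => Ex (pathlaw r.+1 x) (fun ys => F (behead ys))) =
  Ex pi (fun x => Ex (pathlaw r x) F).
Proof.
move=> statio; rewrite -[RHS]statio.
by apply: eq_Ex => x; rewrite Ex_pathS /= Ex_cst.
Qed.

Lemma path_sqr_moment (z : R) r x i : 0 <= z ->
  (forall k, Ex (q k) (fun y => `|y%:~R| ^+ 2) <= z) ->
  Ex (pathlaw r x) (fun ys => `|(nth 0 ys i)%:~R| ^+ 2) <= z.
Proof.
move=> z0 qz; elim: r x i => [|r IH] x i.
  rewrite Ex_path0; case: i => [|i]; first exact: qz.
  by under eq_Ex do rewrite /= nth_nil normr0 expr0n; rewrite Ex_cst.
rewrite Ex_pathS; case: i => [|i] /=.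
  by under eq_Ex do under eq_Ex do rewrite Ex_cst; under eq_Ex do rewrite Ex_cst.
rewrite Ex_cst -[leRHS](Ex_cst (fw x)); apply: Ex_le => x'; exact: IH.
Qed.
End PathLaw.
Arguments pathlaw : simpl never.

(** * The law of the sum *)

Section IntegerVariables.
Context d (T : measurableType d) (R : realType) (Pr : probability T R).
Variable Z : T -> int.
Hypothesis mZ : forall y, measurable [set t | Z t = y].

Lemma measurable_int_preimage (D : set int) : measurable [set t | D (Z t)].
Proof.
pose F (k : nat) : set T :=
  if (choice.unpickle k : option int) is Some y then [set t | Z t = y /\ D y] else set0.
have -> : [set t | D (Z t)] = \bigcup_k F k.
  apply/seteqP; split => [t Dt|t [k _]].
    by exists (choice.pickle (Z t)) => //; rewrite /F choice.pickleK.
  by rewrite /F; case: (choice.unpickle k) => // y [/= ->].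
apply: bigcup_measurable => k _; rewrite /F; case: (choice.unpickle k) => // y.
have [Dy|nDy] := pselect (D y).
  by rewrite (_ : [set t | _ /\ _] = [set t | Z t = y]) //; apply/seteqP; split => t // [].
by rewrite (_ : [set t | _ /\ _] = set0) //; apply/seteqP; split => t // [].
Qed.

Lemma measurable_int_fun (f : int -> R) : measurable_fun setT (fun t => f (Z t)).
Proof.
move=> _ B mB; rewrite setTI.
exact: (measurable_int_preimage (fun y => B (f y))).
Qed.

Lemma measure_int_partition (A : set T) (D : set int) : measurable A ->
  Pr (A `&` [set t | D (Z t)]) = (\esum_(y in D) Pr (A `&` [set t | Z t = y]))%E.
Proof.
move=> mA; pose F k : set T := A `&` [set t | choice.pickle (Z t) = k].
have mF k : measurable (F k).
  by apply: measurableI => //; exact: (measurable_int_preimage (fun y => choice.pickle y = k)).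
have -> : A `&` [set t | D (Z t)] = \bigcup_(k in choice.pickle @` D) F k.
  apply/seteqP; split => [t [At Dt]|t [k [y Dy <-] [At /= e]]].
    by exists (choice.pickle (Z t)) => //; exists (Z t).
  by split => //=; rewrite (pcan_inj choice.pickleK e).
rewrite measure_bigcup //; last first.
  by move=> i j _ _ [t [[_ /= <-] [_ /= <-]]].
rewrite nneseries_esum // set_mem_set esum_image; last first.
  by move=> x y _ _; exact: (pcan_inj choice.pickleK).
apply: eq_esum => y _; congr (Pr _); apply/seteqP; split => t [At /= e]; split => //=.
  exact: (pcan_inj choice.pickleK e).
by rewrite e.
Qed.
End IntegerVariables.

Section PmfTotals.
Variables (R : realType) (f : int -> R).
Hypothesis pf : int_pmf f.

Lemma pmf_esumZ (c : R) : 0 <= c -> (\esum_(y in [set: int]) (c * f y)%:E = c%:E)%E.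
Proof.
move=> c0; apply/eqP; rewrite eq_le; apply/andP; split.
  apply: esum_le_seq => s us _; rewrite sumEFin lee_fin -big_distrr /=.
  by rewrite -[leRHS]mulr1 ler_wpM2l // pmf_sum_le1.
have cv : (fun M => c * \sum_(y <- box M) f y) @ \oo --> c * 1.
  by apply: cvgMl_tmp; exact: pmf_box_cvg.
rewrite mulr1 in cv.
case E : (\esum_(y in _) _)%E => [e| |]; [|exact: leey|].
- rewrite lee_fin -(cvg_lim _ cv) //; apply: limr_le; first by apply/cvg_ex; exists c.
  apply: nearW => M; rewrite -lee_fin -E big_distrr /= -sumEFin.
  by apply: esum_ge_seq => //; exact: box_uniq.
- have : (0 <= \esum_(y in [set: int]) (c * f y)%:E)%E.
    by apply: esum_ge0 => y _; rewrite lee_fin mulr_ge0 //; case: pf.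
  by rewrite E.
Qed.

Lemma esum_seq (a : int -> \bar R) (s : seq int) : uniq s -> (forall y, 0 <= a y)%E ->
  (\esum_(y in [set` s]) a y = \sum_(y <- s) a y)%E.
Proof.
move=> us a0; rewrite esum_fset //; last exact: finite_seq.
by rewrite -fsbig_seq.
Qed.

Lemma pmf_esum_box_compl (c : R) M : 0 <= c ->
  (\esum_(y in [set y | y \notin box M]) (c * f y)%:E = (c * box_defect f M)%:E)%E.
Proof.
move=> c0; have a0 y : (0 <= (c * f y)%:E)%E by rewrite lee_fin mulr_ge0 //; case: pf.
have := pmf_esumZ c0; rewrite (esumID [set` box M]) // !setTI esum_seq ?box_uniq //.
rewrite (_ : ~` _ = [set y | y \notin box M]); last first.
  by apply/seteqP; split => y /= /negP.
rewrite sumEFin -big_distrr /= => H.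
have : (\esum_(y in [set y | y \notin box M]) (c * f y)%:E =
   c%:E - (c * \sum_(y <- box M) f y)%:E)%E by rewrite -H addeAC subee // add0e.
by move=> ->; rewrite -EFinB /box_defect mulrBr mulr1.
Qed.
End PmfTotals.

(** * Cylinders with truncated values *)

Section Letters.
Variable M : nat.

(* [None] stands for all values outside [-M, M] *)
Definition letter (y : int) : option int := if y \in box M then Some y else None.
Definition letters : seq (option int) := None :: map Some (box M).
Definition letter_prob (R : realType) (f : int -> R) (c : option int) : R :=
  if c is Some y then f y else box_defect f M.

Lemma letters_uniq : uniq letters.
Proof.
rewrite /letters cons_uniq map_inj_uniq ?box_uniq ?andbT; last by move=> x y [].
by apply/negP => /mapP [y _].
Qed.

Lemma letter_in y : letter y \in letters.
Proof. by rewrite /letter inE; case: ifP => // yM; rewrite map_f ?orbT. Qed.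

Lemma Ex_trunc_letters (R : realType) (f : int -> R) (pf : int_pmf f) F :
  Ex (trunc_law pf M) F = \sum_(c <- letters) letter_prob f c * F (odflt 0 c).
Proof. by rewrite Ex_trunc /letters big_cons big_map [RHS]addrC. Qed.
End Letters.
Arguments letters : simpl never.

Section Cylinders.
Context d (T : measurableType d) (R : realType) (Pr : probability T R).
Variables (K : nat) (P : 'M[R]_K.+1) (pi : 'I_K.+1 -> R) (q : 'I_K.+1 -> int -> R).
Variables (X : nat -> T -> 'I_K.+1) (Y : nat -> T -> int) (M : nat).
Hypothesis P0 : forall i j, 0 <= P i j.
Hypothesis pi0 : forall i, 0 <= pi i.
Hypothesis pq : forall k, int_pmf (q k).
Hypothesis mX : forall i x, measurable [set t | X i t = x].
Hypothesis mY : forall i y, measurable [set t | Y i t = y].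
Hypothesis cylinder : forall (m : nat) (xs : nat -> 'I_K.+1) (ys : nat -> int),
  Pr [set t | forall i, (i <= m)%N -> X i t = xs i /\ Y i t = ys i]
  = (pi (xs 0%N) * \prod_(i < m) P (xs i) (xs i.+1) * \prod_(i < m.+1) q (xs i) (ys i))%:E.

Local Notation letter_p x c := (letter_prob M (q x) c).

Let q0 k y : 0 <= q k y. Proof. by case: (pq k). Qed.

Lemma letter_prob_ge0 k c : 0 <= letter_p k c.
Proof.
case: c => [y|] /=; first exact: q0.
by rewrite /box_defect subr_ge0 pmf_sum_le1 ?box_uniq.
Qed.

(* the first [k] values are only known up to [letter], the others exactly *)
Definition mixed m k xs (cs : nat -> option int) ys : set T :=
  [set t | forall i, (i <= m)%N -> X i t = xs i /\
    if (i < k)%N then letter M (Y i t) = cs i else Y i t = ys i].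

Definition mixed_prob m k (xs : nat -> 'I_K.+1) (cs : nat -> option int) (ys : nat -> int) : R :=
  pi (xs 0%N) * \prod_(i < m) P (xs i) (xs i.+1) *
  \prod_(i < m.+1) (if (i < k)%N then letter_p (xs i) (cs i) else q (xs i) (ys i)).

Lemma measurable_forall_le m (A : nat -> set T) : (forall i, measurable (A i)) ->
  measurable [set t | forall i, (i <= m)%N -> A i t].
Proof.
move=> mA; rewrite (_ : [set t | _] = \bigcap_(i in [set i | (i <= m)%N]) A i) //.
exact: bigcap_measurableType.
Qed.

Lemma mixed_measurable m k xs cs ys : measurable (mixed m k xs cs ys).
Proof.
apply: (@measurable_forall_le m (fun i => [set t | X i t = xs i /\
    if (i < k)%N then letter M (Y i t) = cs i else Y i t = ys i])) => i.
apply: (@measurableI _ _ [set t | X i t = xs i] [set t | if (i < k)%N then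
  letter M (Y i t) = cs i else Y i t = ys i]) => //; case: (i < k)%N => //.
exact: (measurable_int_preimage (mY i) (fun y => letter M y = cs i)).
Qed.

Definition upd (ys : nat -> int) k y i := if i == k then y else ys i.

(** The value at index [k] is left free: fixing it exactly gives [mixed] at [k], and fixing its
    letter gives [mixed] at [k + 1]. *)
Definition unmixed m k xs (cs : nat -> option int) ys : set T :=
  [set t | forall i, (i <= m)%N -> X i t = xs i /\
    if (i < k)%N then letter M (Y i t) = cs i else i != k -> Y i t = ys i].

Lemma unmixed_measurable m k xs cs ys : measurable (unmixed m k xs cs ys).
Proof.
apply: (@measurable_forall_le m (fun i => [set t | X i t = xs i /\
    if (i < k)%N then letter M (Y i t) = cs i else i != k -> Y i t = ys i])) => i.
apply: (@measurableI _ _ [set t | X i t = xs i] [set t | if (i < k)%N then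
  letter M (Y i t) = cs i else i != k -> Y i t = ys i]) => //; case: (i < k)%N.
  exact: (measurable_int_preimage (mY i) (fun y => letter M y = cs i)).
exact: (measurable_int_preimage (mY i) (fun y => i != k -> y = ys i)).
Qed.

Lemma unmixed_exact m k xs cs ys y : (k <= m)%N ->
  unmixed m k xs cs ys `&` [set t | Y k t = y] = mixed m k xs cs (upd ys k y).
Proof.
move=> km; apply/seteqP; split => [t [H /= Yk] i im|t H].
  have [Xi Yi] := H i im; split => //; rewrite /upd; move: Yi.
  by have [->|_] := eqVneq i k; rewrite ?ltnn //; case: ifP => // _; apply.
split => [i im|]; last by have [_] := H k km; rewrite ltnn /upd eqxx.
have [Xi Yi] := H i im; split => //; move: Yi; rewrite /upd.
by have [->|_] := eqVneq i k; rewrite ?ltnn //; case: ifP.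
Qed.

Lemma unmixed_letter m k xs cs ys : (k <= m)%N ->
  unmixed m k xs cs ys `&` [set t | letter M (Y k t) = cs k] = mixed m k.+1 xs cs ys.
Proof.
move=> km; apply/seteqP; split => [t [H /= Yk] i im|t H].
  have [Xi Yi] := H i im; split => //; rewrite ltnS leq_eqVlt; move: Yi.
  by have [->|_] := eqVneq i k => //=; case: ifP => // _; apply.
split => [i im|]; last by have [_] := H k km; rewrite ltnSn.
have [Xi Yi] := H i im; split => //; move: Yi; rewrite ltnS leq_eqVlt.
by have [->|_] := eqVneq i k; rewrite ?ltnn //=; case: ifP.
Qed.

Lemma mixed_prob_split m k xs cs ys : (k <= m)%N -> exists2 c : R, 0 <= c &
  mixed_prob m k.+1 xs cs ys = c * letter_p (xs k) (cs k) /\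
  forall y, mixed_prob m k xs cs (upd ys k y) = c * q (xs k) y.
Proof.
move=> km; have km' : (k < m.+1)%N by [].
exists (pi (xs 0%N) * \prod_(i < m) P (xs i) (xs i.+1) *
  \prod_(i < m.+1 | i != Ordinal km') (if (i < k)%N then letter_p (xs i) (cs i) else q (xs i) (ys i))).
  rewrite !mulr_ge0 ?prodr_ge0 // => i _.
  by case: ifP => _; [exact: letter_prob_ge0 | exact: q0].
split=> [|y]; rewrite /mixed_prob (bigD1 (Ordinal km')) //=.
  rewrite ltnSn [RHS]mulrAC -[RHS]mulrA; congr (_ * (_ * _)).
  apply: eq_bigr => i ik; rewrite ltnS leq_eqVlt.
  by have -> : (nat_of_ord i == k) = false by apply/negP => /eqP e; move: ik; rewrite -val_eqE /= e eqxx.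
rewrite ltnn /upd eqxx [RHS]mulrAC -[RHS]mulrA; congr (_ * (_ * _)).
apply: eq_bigr => i ik.
by have -> : (nat_of_ord i == k) = false by apply/negP => /eqP e; move: ik; rewrite -val_eqE /= e eqxx.
Qed.

(** Coordinates are coarsened one at a time. Countable additivity over the values with a given
    letter replaces the weight of the value by that of the letter. *)
Lemma mixed_measure m k xs cs ys : (k <= m.+1)%N -> (forall i, cs i \in letters M) ->
  Pr (mixed m k xs cs ys) = (mixed_prob m k xs cs ys)%:E.
Proof.
move=> + csL; elim: k ys => [|k IH] ys km; first exact: cylinder.
have {}IH ys' := IH ys' (ltnW km).
have {}km : (k <= m)%N by [].
have [c c0 [-> cq]] := mixed_prob_split xs cs ys km.
rewrite -unmixed_letter //.
rewrite (measure_int_partition Pr (mY k) (fun y => letter M y = cs k) (unmixed_measurable _ _ _ _ _)).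
under eq_esum do rewrite unmixed_exact // IH cq.
have := csL k; rewrite /letters inE; case: (cs k) => [y|] /= csE.
  have yM : y \in box M by move: csE; rewrite mem_map // => a b [].
  rewrite (_ : (fun y0 => letter M y0 = Some y) = [set y]); last first.
    apply/seteqP; split => u /=; rewrite /letter; first by case: ifP => // _ [].
    by move=> ->; rewrite yM.
  by rewrite esum_set1 // lee_fin mulr_ge0.
rewrite (_ : (fun y0 => letter M y0 = None) = [set y | y \notin box M]); last first.
  by apply/seteqP; split => u /=; rewrite /letter; case: ifP.
exact: pmf_esum_box_compl.
Qed.
End Cylinders.

Lemma sqr_sum_le (R : realType) (s : seq nat) (a : nat -> R) :
  (\sum_(i <- s) a i) ^+ 2 <= (size s)%:R * \sum_(i <- s) a i ^+ 2.
Proof.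
apply: (@le_trans _ _ (\sum_(i <- s) \sum_(j <- s) (a i ^+ 2 + a j ^+ 2) / 2)).
  rewrite expr2 big_distrl /=; apply: ler_sum => i _; rewrite big_distrr /=.
  by apply: ler_sum => j _; have := sqr_ge0 (a i - a j); rewrite !expr2; lra.
have e (c : R) : \sum_(j <- s) c = (size s)%:R * c by rewrite big_const_seq count_predT iter_addr_0 mulr_natl.
under eq_bigr do rewrite -big_distrl big_split /= e.
by rewrite -big_distrl big_split /= e -big_distrr /=; lra.
Qed.

Lemma int_sum_measurable d (T : measurableType d) (R : realType) (Z : nat -> T -> int) s :
  (forall i y, measurable [set t | Z i t = y]) ->
  forall w, measurable [set t | \sum_(i <- s) Z i t = w].
Proof.
move=> mZ w; have mR : measurable_fun setT (fun t => \sum_(i <- s) (Z i t)%:~R : R).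
  apply: measurable_sum => i; exact: (measurable_int_fun (mZ i) (fun y => y%:~R)).
rewrite (_ : [set t | _] = setT `&` (fun t => \sum_(i <- s) (Z i t)%:~R : R) @^-1` [set w%:~R]).
  by apply: mR => //; exact: measurable_set1.
apply/seteqP; split => t /=; rewrite -rmorph_sum /=; first by move=> ->.
by move=> [_ /eqP]; rewrite eqr_int => /eqP.
Qed.

Section SumLaw.
Context d (T : measurableType d) (R : realType) (Pr : probability T R).
Variables (K : nat) (P : 'M[R]_K.+1) (pi : 'I_K.+1 -> R) (q : 'I_K.+1 -> int -> R).
Variables (X : nat -> T -> 'I_K.+1) (Y : nat -> T -> int).
Hypothesis sP : stochastic (fun i j => P i j).
Hypothesis pi0 : forall i, 0 <= pi i.
Hypothesis pi1 : \sum_i pi i = 1.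
Hypothesis pi_inv : forall k, \sum_j pi j * P j k = pi k.
Hypothesis pq : forall k, int_pmf (q k).
Hypothesis mX : forall i x, measurable [set t | X i t = x].
Hypothesis mY : forall i y, measurable [set t | Y i t = y].
Hypothesis cylinder : forall (m : nat) (xs : nat -> 'I_K.+1) (ys : nat -> int),
  Pr [set t | forall i, (i <= m)%N -> X i t = xs i /\ Y i t = ys i]
  = (pi (xs 0%N) * \prod_(i < m) P (xs i) (xs i.+1) * \prod_(i < m.+1) q (xs i) (ys i))%:E.

Let P0 i j : 0 <= P i j. Proof. by case: sP. Qed.
Let fw := kernel_law sP.
Let mu := fin_law pi0 pi1.
Let qM M k := trunc_law (pq k) M.

Let statio F : Ex mu (fun x => Ex (fw x) F) = Ex mu F.
Proof.
rewrite !Ex_fin; under eq_bigr do rewrite Ex_fin big_distrr /=.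
rewrite exchange_big /=; apply: eq_bigr => k _; rewrite -[in RHS]pi_inv big_distrl /=.
by apply: eq_bigr => j _; rewrite mulrA.
Qed.


Section Words.
Variable M : nat.
Local Notation letter_p x c := (letter_prob M (q x) c).
Local Notation S := 'I_K.+1.

Definition alphabet : seq (S * option int) := [seq (x, c) | x <- enum S, c <- letters M].

Fixpoint words (r : nat) : seq (seq (S * option int)) :=
  if r is r'.+1 then [seq a :: w | a <- alphabet, w <- words r'] else [:: [::]].

Fixpoint chain (x : S) (w : seq (S * option int)) : R :=
  if w is a :: w' then P x a.1 * letter_p a.1 a.2 * chain a.1 w' else 1.

Definition start (w : seq (S * option int)) : R :=
  if w is a :: w' then pi a.1 * letter_p a.1 a.2 * chain a.1 w' else 1.

Definition values (w : seq (S * option int)) : seq int := [seq odflt 0 a.2 | a <- w].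

Lemma alphabet_uniq : uniq alphabet.
Proof. by rewrite allpairs_uniq ?enum_uniq ?letters_uniq // => -[a b] [a' b']. Qed.

Lemma words_uniq r : uniq (words r).
Proof.
elim: r => //= r IH; rewrite allpairs_uniq ?alphabet_uniq //.
by move=> [a w] [a' w'] _ _ [-> ->].
Qed.

Lemma words_size r w : w \in words r -> size w = r.
Proof.
elim: r w => [|r IH] w /=; first by rewrite inE => /eqP ->.
by move=> /allpairsP[[a v] /= [_ vr ->]] /=; rewrite (IH v).
Qed.

Lemma words_letters r w i : w \in words r -> (nth (ord0, None) w i).2 \in letters M.
Proof.
elim: r w i => [|r IH] w i /=.
  by rewrite inE => /eqP ->; rewrite nth_nil /letters inE eqxx.
move=> /allpairsP[[a v] /= [/allpairsP[[x c] /= [_ cL ->]] vr ->]].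
by case: i => [|i] //=; exact: IH.
Qed.

Lemma Ex_path_words r x F : Ex (pathlaw (qM M) fw r x) F =
  \sum_(c <- letters M) letter_p x c * \sum_(w <- words r) chain x w * F (odflt 0 c :: values w).
Proof.
elim: r x F => [|r IH] x F.
  rewrite Ex_path0 Ex_trunc_letters; apply: eq_bigr => c _.
  by rewrite big_seq1 mul1r.
rewrite Ex_pathS Ex_trunc_letters; apply: eq_bigr => c _; congr (_ * _).
rewrite Ex_fin [RHS]big_allpairs_dep /= /alphabet [RHS]big_allpairs_dep /= [RHS]big_enum /=; apply: eq_bigr => x' _.
rewrite IH big_distrr /=; apply: eq_bigr => c' _; rewrite mulrA big_distrr /=.
by apply: eq_bigr => w _; rewrite mulrA.
Qed.

Lemma Ex_start_words r F : Ex mu (fun x => Ex (pathlaw (qM M) fw r x) F) =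
  \sum_(w <- words r.+1) start w * F (values w).
Proof.
rewrite Ex_fin [RHS]big_allpairs_dep /= /alphabet [RHS]big_allpairs_dep /= [RHS]big_enum /=; apply: eq_bigr => x _.
rewrite Ex_path_words big_distrr /=; apply: eq_bigr => c _; rewrite mulrA big_distrr /=.
by apply: eq_bigr => w _; rewrite mulrA.
Qed.

Definition word r t : seq (S * option int) := [seq (X i t, letter M (Y i t)) | i <- iota 0 r].

Lemma nth_word r t i : (i < r)%N -> nth (ord0, None) (word r t) i = (X i t, letter M (Y i t)).
Proof. by move=> ir; rewrite (nth_map 0%N) ?size_iota // nth_iota. Qed.

Lemma word_in r t : word r t \in words r.
Proof.
rewrite /word; elim: r 0%N => [|r IH] i //=.
apply/allpairsP; exists ((X i t, letter M (Y i t)), [seq (X j t, letter M (Y j t)) | j <- iota i.+1 r]).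
split => //=; apply/allpairsP; exists (X i t, letter M (Y i t)); split => //=.
  by rewrite mem_enum.
exact: letter_in.
Qed.

Lemma chain_prod a w : chain a.1 w =
  \prod_(i < size w) P (nth (ord0, None) (a :: w) i).1 (nth (ord0, None) w i).1 *
  \prod_(i < size w) letter_p (nth (ord0, None) w i).1 (nth (ord0, None) w i).2.
Proof.
elim: w a => [|b w IH] a /=; first by rewrite !big_ord0 mulr1.
by rewrite !big_ord_recl /= IH; ring.
Qed.

Lemma word_event r w : w \in words r.+1 -> [set t | word r.+1 t = w] =
  mixed X Y M r r.+1 (fun i => (nth (ord0, None) w i).1) (fun i => (nth (ord0, None) w i).2)
    (fun=> 0).
Proof.
move=> wr; have sw := words_size wr; apply/seteqP; split => [t /= e i ir|t H /=].
  by rewrite ltnS ir -e nth_word.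
apply: (@eq_from_nth _ (ord0, None)); rewrite size_map size_iota ?sw // => i ir.
by rewrite nth_word //; have [] := H i ir; rewrite ir => -> ->; case: (nth _ _ _).
Qed.

Lemma word_measure r w : w \in words r.+1 -> Pr [set t | word r.+1 t = w] = (start w)%:E.
Proof.
move=> wr; rewrite word_event // (mixed_measure P0 pi0 pq mX mY cylinder) //; last by move=> i; exact: words_letters wr.
rewrite /mixed_prob; congr (_%:E); have := words_size wr; case: (w) => // a v [<-] /=.
rewrite chain_prod big_ord_recl /= [X in _ * (_ * X) = _](eq_bigr (fun i : 'I_(size v) =>
  letter_p (nth (ord0, None) v i).1 (nth (ord0, None) v i).2)) => [|i _]; first ring.
by rewrite /bump add1n ltnS ltn_ord.
Qed.

Lemma word_measurable r w : w \in words r.+1 -> measurable [set t | word r.+1 t = w].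
Proof. by move=> wr; rewrite word_event //; exact: mixed_measurable. Qed.

(** The word takes finitely many values, so the integrand is a finite combination of indicators of
    cylinders. *)
Lemma integral_word r (F : seq int -> R) :
  (\int[Pr]_t (F (values (word r.+1 t)))%:E = (Ex mu (fun x => Ex (pathlaw (qM M) fw r x) F))%:E)%E.
Proof.
pose A w := if w \in words r.+1 then [set t | word r.+1 t = w] else set0.
have mA w : measurable (A w) by rewrite /A; case: ifP => // wr; exact: word_measurable.
transitivity (\int[Pr]_t (\sum_(w <- words r.+1) (F (values w))%:E * (\1_(A w) t)%:E))%E.
  apply: eq_integral => t _; rewrite (bigD1_seq (word r.+1 t)) ?words_uniq ?word_in //=.
  rewrite big_seq_cond big1 ?adde0 => [|w /andP[wr wt]].
    by rewrite indicE mem_set ?mule1 // /A word_in.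
  rewrite indicE memNset ?mule0 // /A wr /= => e; by rewrite e eqxx in wt.
have iA w : Pr.-integrable setT (fun t => (\1_(A w) t)%:E) by exact: integrable_indic.
rewrite integral_sum //; last by move=> w; exact: integrableZl.
rewrite Ex_start_words -sumEFin big_seq [RHS]big_seq; apply: eq_bigr => w wr.
have AE : A w = [set t | word r.+1 t = w] by rewrite /A wr.
by rewrite integralZl // integral_indic // setIT AE [X in (_ * X)%E](word_measure wr) -EFinM mulrC.
Qed.
End Words.

Lemma letterK M y : (odflt 0 (letter M y) : int) = if y \in box M then y else 0.
Proof. by rewrite /letter; case: ifP. Qed.

Variables (n : nat) (B : R).
Hypothesis n_gt0 : (0 < n)%N.
Hypothesis B0 : 0 <= B.
Hypothesis qB : forall M k, Ex (qM M k) (fun y => `|y%:~R| ^+ 2) <= B.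

Let W t := \sum_(1 <= i < n.+1) Y i t.
Let trunc M i t : int := if Y i t \in box M then Y i t else 0.
Let WM M t := \sum_(1 <= i < n.+1) trunc M i t.

Lemma values_word M r t : values (word M r t) = [seq trunc M i t | i <- iota 0 r].
Proof. by rewrite /values /word -map_comp; apply: eq_map => i /=; exact: letterK. Qed.

Lemma integral_trunc_sum M (f : int -> R) :
  (\int[Pr]_t (f (WM M t))%:E =
   (Ex mu (fun x => Ex (pathlaw (qM M) fw n.-1 x) (fun ys => f (zsum ys))))%:E)%E.
Proof.
rewrite -(path_behead _ _ _ statio) prednK //.
rewrite -(integral_word M n (fun ys => f (zsum (behead ys)))).
apply: eq_integral => t _; congr (f _)%:E; rewrite values_word /WM /zsum /=.
by rewrite big_map /index_iota subn1.
Qed.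

Lemma trunc_cvg i t : exists M0, forall M, (M0 <= M)%N -> trunc M i t = Y i t.
Proof.
exists `|Y i t|%N => M h; rewrite /trunc ifT // mem_box; lia.
Qed.

Lemma trunc_norm M i t : `|(trunc M i t)%:~R| <= `|(Y i t)%:~R| :> R.
Proof. by rewrite /trunc; case: ifP => // _; rewrite normr0. Qed.

(** The truncated squares increase to the full one and their means stay below [B], so monotone
    convergence applies. *)
Lemma integrable_sqr i : Pr.-integrable setT (fun t => (`|(Y i t)%:~R : R| ^+ 2)%:E).
Proof.
pose g M t := (`|(trunc M i t)%:~R : R| ^+ 2)%:E.
have gm M : measurable_fun setT (g M).
  apply/measurable_EFinP.
  exact: (measurable_int_fun (mY i) (fun y => `|(if y \in box M then y else 0)%:~R : R| ^+ 2)).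
apply/integrableP; split.
  by apply/measurable_EFinP; exact: (measurable_int_fun (mY i) (fun y : int => `|y%:~R : R| ^+ 2)).
apply: (@le_lt_trans _ _ B%:E); last exact: ltry.
have g0 M t : setT t -> (0 <= g M t)%E by move=> _; rewrite lee_fin exprn_ge0.
have gnd t : setT t -> nondecreasing_seq (g^~ t).
  move=> _ M N MN; rewrite lee_fin lerXn2r ?nnegrE // /trunc.
  case: ifP => [|_]; last by rewrite normr0.
  by rewrite !mem_box => YM; rewrite ifT //; lia.
have gcv t : limn (g^~ t) = (`|(Y i t)%:~R : R| ^+ 2)%:E.
  have [M0 HM] := trunc_cvg i t; apply: cvg_lim => //.
  by apply: cvg_near_cst; exists M0 => // M /= M0M; rewrite /g HM.
rewrite (eq_integral (fun t => limn (g^~ t))); last first.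
  by move=> t _; rewrite gcv gee0_abs // lee_fin exprn_ge0.
rewrite monotone_convergence //; apply: lime_le.
  apply: ereal_nondecreasing_is_cvgn => M N MN; apply: ge0_le_integral => //.
  - exact: g0.
  - by move=> t Dt; exact: gnd.
apply: nearW => M.
have := @integral_word M i (fun ys => `|(nth 0 ys i)%:~R| ^+ 2).
rewrite (_ : (fun t => _) = g M); last first.
  apply/funext => t; rewrite values_word (nth_map 0%N) ?size_iota // nth_iota //.
rewrite /g => ->; rewrite lee_fin -[leRHS](Ex_cst mu); apply: Ex_le => x.
exact: path_sqr_moment.
Qed.

Lemma W_measurable w : measurable [set t | W t = w].
Proof. exact: (int_sum_measurable R). Qed.

Lemma WM_measurable M w : measurable [set t | WM M t = w].
Proof.
apply: (int_sum_measurable R) => i y.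
exact: (measurable_int_preimage (mY i) (fun u => (if u \in box M then u else 0) = y)).
Qed.

(** By the Cauchy-Schwarz inequality the squared sum is at most [n] times the sum of squares, so
    this function dominates a quadratic functional of [W] and of all its truncations at once. *)
Let dom (c : R) t : \bar R :=
  (c%:E * (1%:E + n%:R%:E * \sum_(i <- index_iota 1 n.+1) (`|(Y i t)%:~R : R| ^+ 2)%:E))%E.

Let dom_integrable c : Pr.-integrable setT (dom c).
Proof.
apply: integrableZl => //; apply: integrableD => //.
  exact: finite_measure_integrable_cst.
apply: integrableZl => //; apply: integrable_sum => // i _; exact: integrable_sqr.
Qed.

Let dom_ge (f : int -> R) c (Z : nat -> T -> int) t : (forall w, `|f w| <= c * (1 + w%:~R ^+ 2)) ->
  (forall i, `|(Z i t)%:~R| <= `|(Y i t)%:~R| :> R) ->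
  (`|(f (\sum_(1 <= i < n.+1) Z i t))%:E| <= dom c t)%E.
Proof.
move=> fc ZY.
have -> : dom c t = (c * (1 + n%:R * \sum_(i <- index_iota 1 n.+1) `|(Y i t)%:~R| ^+ 2))%:E.
  by rewrite /dom sumEFin.
rewrite lee_fin; apply: le_trans (fc _) _.
have c0 : 0 <= c by have := le_trans (normr_ge0 _) (fc 0); rewrite expr0n /= addr0 mulr1.
rewrite ler_wpM2l // lerD2l; have := @sqr_sum_le R (index_iota 1 n.+1) (fun i => `|(Z i t)%:~R|).
rewrite size_iota subn1 /= => H; apply: le_trans (le_trans _ H) _.
  rewrite -[leLHS]real_normK ?num_real // lerXn2r ?nnegrE ?sumr_ge0 // rmorph_sum /=.
  exact: ler_norm_sum.
by rewrite ler_wpM2l //; apply: ler_sum => i _; rewrite lerXn2r ?nnegrE.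
Qed.

Definition sum_mean (f : int -> R) : R := fine (\int[Pr]_t (f (W t))%:E)%E.

Lemma sum_integrable f : quadratic f -> Pr.-integrable setT (fun t => (f (W t))%:E).
Proof.
move=> [c fc]; apply: (le_integrable _ _ _ (dom_integrable c)) => //.
  by apply/measurable_EFinP; exact: (measurable_int_fun W_measurable).
move=> t _; apply: le_trans (dom_ge (Z := Y) fc _) _ => //.
exact: lee_abs.
Qed.

(** At each point the truncated sum equals [W] from some [M] on, and [dom] provides the
    domination. *)
Lemma sum_mean_cvg f : quadratic f ->
  (fun M => Ex mu (fun x => Ex (pathlaw (qM M) fw n.-1 x) (fun ys => f (zsum ys)))) @ \oo
    --> sum_mean f.
Proof.
move=> qf; have [c fc] := qf.
have mf M : measurable_fun setT (fun t => (f (WM M t))%:E).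
  by apply/measurable_EFinP; exact: (measurable_int_fun (WM_measurable M)).
have mfW : measurable_fun setT (fun t => (f (W t))%:E).
  by apply/measurable_EFinP; exact: (measurable_int_fun W_measurable).
have cv : {ae Pr, forall t, setT t -> (f (WM M t))%:E @[M --> \oo] --> (f (W t))%:E}.
  apply: aeW => t _; apply: cvg_near_cst.
  have [M0 HM] : exists M0, forall M, (M0 <= M)%N -> WM M t = W t.
    rewrite /WM /W; elim: (index_iota 1 n.+1) => [|i s [M0 HM]].
      by exists 0%N => M _; rewrite !big_nil.
    have [M1 HM1] := trunc_cvg i t; exists (maxn M0 M1) => M.
    by rewrite geq_max !big_cons => /andP[/HM -> /HM1 ->].
  by exists M0 => // M /= /HM ->.
have bd : {ae Pr, forall t M, setT t -> (`|(f (WM M t))%:E| <= dom c t)%E}.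
  by apply: aeW => t M _; apply: dom_ge => // i; exact: trunc_norm.
have [_ _] := dominated_convergence measurableT mf mfW cv (dom_integrable c) bd.
have -> : [sequence \int[Pr]_t (f (WM M t))%:E]_M%E = (fun M =>
    (Ex mu (fun x => Ex (pathlaw (qM M) fw n.-1 x) (fun ys => f (zsum ys))))%:E).
  by apply/funext => M; exact: integral_trunc_sum.
have fin : (\int[Pr]_t (f (W t))%:E \is a fin_num)%E.
  exact: integrable_fin_num (sum_integrable qf).
by rewrite -(fineK fin) => /fine_cvgP[_]; apply: cvg_trans.
Qed.
End SumLaw.

(** * Moments *)

Section TailMoments.
Variable R : realType.

Lemma esumZ_le (T : choiceType) (I : set T) (c : R) (a : T -> \bar R) :
  0 <= c -> (forall x, 0 <= a x)%E ->
  (c%:E * (\esum_(x in I) a x) <= \esum_(x in I) (c%:E * a x))%E.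
Proof.
rewrite le_eqVlt => /predU1P[<-|c0] a0.
  by rewrite mul0e esum1 // => x _; rewrite mul0e.
rewrite -lee_pdivlMl //; apply: esum_le_seq => s us sI; rewrite lee_pdivlMl //.
by rewrite ge0_sume_distrr //; apply: esum_ge_seq.
Qed.

Variables (fZ : nat -> R) (pZ : nat_pmf fZ) (fZ0 : fZ 0%N = 0).

Lemma third_moment_ge1 : (1%:E <= third_moment fZ)%E.
Proof.
have [f0 f1] := pZ; rewrite -f1; apply: le_esum => -[|k] _; rewrite lee_fin.
  by rewrite fZ0 mulr0.
by rewrite ler_peMl // exprn_ege1 // ler1n.
Qed.

Variables (f : int -> R) (pf : int_pmf f).
Hypothesis tails : forall r : R, 0 <= r ->
  (\esum_(y in [set y : int | (r <= y%:~R)%R]) (f y)%:E <= tail_ge fZ r)%E /\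
  (\esum_(y in [set y : int | (y%:~R <= - r)%R]) (f y)%:E <= tail_ge fZ r)%E.

(** Increments of the cubes, for summation by layers: a cube is the sum of these increments below
    its root, which turns third moments into weighted sums of tails. *)
Let cube_step (r : nat) : nat := (r.+1 ^ 3 - r ^ 3)%N.

Lemma sum_cube_step M k : (\sum_(r < M) cube_step r * (r < k) = minn M k ^ 3)%N.
Proof.
elim: M => [|M IH]; first by rewrite big_ord0 min0n.
rewrite big_ord_recr /= IH; case: (ltnP M k) => Mk.
  by rewrite muln1 (minn_idPl Mk) subnKC // leq_exp2r.
by rewrite muln0 addn0 (minn_idPr (leqW Mk)).
Qed.

Let tail (r : nat) : \bar R := tail_ge fZ r.+1%:R.

Let tail_ge0 r : (0 <= tail r)%E.
Proof. by apply: esum_ge0 => k _; rewrite lee_fin; case: pZ. Qed.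

Lemma sum_tail_le M : (\sum_(r < M) (cube_step r)%:R%:E * tail r <= third_moment fZ)%E.
Proof.
have fZ_ge0 k : 0 <= fZ k by case: pZ.
apply: (@le_trans _ _ (\sum_(r < M) \esum_(k in [set: nat])
    ((cube_step r * (r < k))%N%:R * fZ k)%:E)%E).
  apply: lee_sum => r _.
  apply: (le_trans (esumZ_le _ _ _)); [by [] | by move=> k; rewrite lee_fin |].
  rewrite esum_mkcond; apply: le_esum => k _; case: ifPn; rewrite ?lee_fin ?mulr_ge0 //.
  by rewrite inE /= ler_nat => rk; rewrite rk muln1.
rewrite -esum_sum; last by move=> k r _ _; rewrite lee_fin mulr_ge0.
apply: le_esum => k _; rewrite sumEFin lee_fin -big_distrl /= -natr_sum.
rewrite ler_wpM2r // sum_cube_step -natrX ler_nat leq_exp2r //; exact: geq_minr.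
Qed.

(** The upper and the lower tail are each bounded by the tail of [Z], hence the factor 2. *)
Lemma cube_moment M : (third_moment fZ < +oo)%E ->
  Ex (trunc_law pf M) (fun y => `|y%:~R| ^+ 3) <= 2 * fine (third_moment fZ).
Proof.
move=> fin; have f0 y : 0 <= f y by case: pf.
have third_fin : third_moment fZ \is a fin_num.
  by rewrite ge0_fin_numE //; apply: le_trans third_moment_ge1; rewrite lee_fin.
rewrite Ex_trunc normr0 expr0n mulr0 addr0.
have -> : \sum_(y <- box M) f y * `|y%:~R| ^+ 3 =
    \sum_(r < M) (cube_step r)%:R * \sum_(y <- box M) f y * (r < `|y|)%N%:R.
  under [RHS]eq_bigr do rewrite big_distrr /=.
  rewrite exchange_big /= !big_seq; apply: eq_bigr => y yM.
  under eq_bigr do rewrite mulrCA -natrM; rewrite -big_distrr /= -natr_sum sum_cube_step.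
  have -> : minn M `|y| = `|y|%N by apply/minn_idPr; move: yM; rewrite mem_box; lia.
  by rewrite natrX -intr_norm -abszE -pmulrn.
have inner (r : nat) : ((\sum_(y <- box M) f y * (r < `|y|)%N%:R)%:E <= tail r + tail r)%E.
  have [t1 t2] := tails (ler0n R r.+1).
  apply: (@le_trans _ _ ((\sum_(y <- box M | (r.+1%:R <= y%:~R :> R)) f y)%:E +
      (\sum_(y <- box M | (y%:~R <= - r.+1%:R :> R)) f y)%:E)%E).
    rewrite -EFinD lee_fin [X in _ <= X + _]big_mkcond [X in _ <= _ + X]big_mkcond -big_split /=.
    apply: ler_sum => y _; have -> : (r.+1%:R <= y%:~R :> R) = (r.+1%:Z <= y) by rewrite -(ler_int R).
    have -> : (y%:~R <= - r.+1%:R :> R) = (y <= - r.+1%:Z) by rewrite -(ler_int R) rmorphN.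
    case: (ltnP r `|y|) => ry; last first.
      by rewrite mulr0 addr_ge0 //; case: ifP.
    have [h|h] : r.+1%:Z <= y \/ y <= - r.+1%:Z by lia.
      by rewrite h mulr1 lerDl; case: ifP.
    by rewrite h mulr1 lerDr; case: ifP.
  apply: leeD; [apply: le_trans _ t1 | apply: le_trans _ t2].
  - rewrite -sumEFin -big_filter; apply: esum_ge_seq; first by rewrite filter_uniq ?box_uniq.
    by move=> y; rewrite mem_filter => /andP[].
  - rewrite -sumEFin -big_filter; apply: esum_ge_seq; first by rewrite filter_uniq ?box_uniq.
    by move=> y; rewrite mem_filter => /andP[].
rewrite -lee_fin EFinM fineK // -sumEFin.
apply: (@le_trans _ _ (\sum_(r < M) ((cube_step r)%:R%:E * tail r + (cube_step r)%:R%:E * tail r))%E).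
  apply: lee_sum => r _; rewrite EFinM -ge0_muleDr //; apply: lee_wpmul2l => //.
rewrite big_split /=.
have -> : (2%:E * third_moment fZ = third_moment fZ + third_moment fZ)%E.
  by rewrite -(fineK third_fin) -EFinM -EFinD mulr_natl.
by apply: leeD; exact: sum_tail_le.
Qed.
End TailMoments.

Section CubeRoot.
Variables (R : realType) (c : R).
Hypothesis c1 : 1 <= c.

Lemma cube_root : exists2 z : R, 1 <= z & z ^+ 3 = c.
Proof.
have c0 : 0 <= c by apply: le_trans c1.
exists (c `^ (3^-1)).
  have z3 : 0 <= 3^-1 :> R by rewrite invr_ge0.
  by have := ler_powR c1 z3; rewrite powRr0.
by rewrite -powR_mulrn ?powR_ge0 // -powRrM mulVf // powRr1.
Qed.

(** Young's inequality in the forms [z^2 x <= x^3 / 3 + 2 z^3 / 3] and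
    [z x^2 <= 2 x^3 / 3 + z^3 / 3]; the differences factor through [(x - z) ^ 2]. *)
Lemma lower_moments A (d : flaw R A) (f : A -> R) (z : R) : 0 < z -> (forall a, 0 <= f a) ->
  Ex d (fun a => f a ^+ 3) <= z ^+ 3 -> Ex d f <= z /\ Ex d (fun a => f a ^+ 2) <= z ^+ 2.
Proof.
move=> z0 f0 f3; split.
  have : Ex d (fun a => z ^+ 2 * f a) <= Ex d (fun a => 3^-1 * f a ^+ 3 + 2 / 3 * z ^+ 3).
    apply: Ex_le => a; have := f0 a; move: (f a) => x x0.
    have : 0 <= (x - z) ^+ 2 * (x + 2 * z) by rewrite mulr_ge0 ?sqr_ge0 // addr_ge0 // mulr_ge0 // ltW.
    rewrite !exprS !expr0; lra.
  rewrite ExZ ExD ExZ Ex_cst => H.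
  rewrite -(ler_pM2l (x := z ^+ 2)) ?exprn_gt0 //; apply: le_trans H _.
  by rewrite -exprSr; lra.
have : Ex d (fun a => z * f a ^+ 2) <= Ex d (fun a => 2 / 3 * f a ^+ 3 + 3^-1 * z ^+ 3).
  apply: Ex_le => a; have := f0 a; move: (f a) => x x0.
  have : 0 <= (x - z) ^+ 2 * (2 * x + z) by rewrite mulr_ge0 ?sqr_ge0 // addr_ge0 ?mulr_ge0 // ltW.
  rewrite !exprS !expr0; lra.
rewrite ExZ ExD ExZ Ex_cst => H.
rewrite -(ler_pM2l (x := z)) //; apply: le_trans H _.
by rewrite -exprS; lra.
Qed.
End CubeRoot.

(** * Removing the truncation *)

Section Stationary.
Variables (R : realType) (K : nat) (P : 'M[R]_K.+1) (pi : 'I_K.+1 -> R).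
Hypothesis sP : stochastic (fun i j => P i j).
Hypothesis iP : irreducible P.
Hypothesis spi : stationary_law P pi.

Lemma power_ge0 m i j : 0 <= (P ^+ m) i j.
Proof.
elim: m i j => [|m IH] i j; first by rewrite expr0 mxE; exact: ler0n.
rewrite exprSr -mulmxE mxE sumr_ge0 // => k _; rewrite mulr_ge0 //; by case: sP.
Qed.

Lemma stationary_power m k : \sum_j pi j * (P ^+ m) j k = pi k.
Proof.
have [_ _ inv] := spi; elim: m k => [|m IH] k.
  rewrite (bigD1 k) //= expr0 mxE eqxx mulr1 big1 ?addr0 // => j /negPf jk.
  by rewrite mxE jk mulr0.
rewrite -[RHS]inv; under eq_bigr do rewrite exprSr -mulmxE mxE big_distrr /=.
rewrite exchange_big /=; apply: eq_bigr => i _; rewrite -[in RHS](IH i) big_distrl /=.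
by apply: eq_bigr => j _; rewrite mulrA.
Qed.

Lemma stationary_gt0 k : 0 < pi k.
Proof.
have [pi0 pi1 _] := spi.
have [j pj] : exists j, 0 < pi j.
  apply: contrapT => H; have : \sum_j pi j <= 0.
    by apply: sumr_le0 => j _; rewrite leNgt; apply/negP => pj; apply: H; exists j.
  by rewrite pi1 ler10.
have [m Pm] := iP j k; rewrite -(stationary_power m) (bigD1 j) //=.
apply: ltr_pwDl; first exact: mulr_gt0.
by rewrite sumr_ge0 // => i _; rewrite mulr_ge0 // power_ge0.
Qed.

Lemma rev_kernel_stochastic : stochastic (rev_kernel P pi).
Proof.
have [pi0 _ inv] := spi; split => [i j|i].
  by rewrite /rev_kernel !mulr_ge0 ?invr_ge0 //; case: sP.
by rewrite /rev_kernel -big_distrl /= inv divff // gt_eqF // stationary_gt0.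
Qed.
End Stationary.

Lemma bernoulli_le (R : realType) (e : R) m : 0 <= e <= 1 -> 1 - (1 - e) ^+ m <= m%:R * e.
Proof.
move=> /andP[e0 e1]; elim: m => [|m IH]; first by rewrite expr0 subrr mul0r.
have : (1 - e) ^+ m <= 1 by rewrite exprn_ile1 // ?subr_ge0 // lerBlDr lerDl.
have : 0 <= (1 - e) ^+ m by rewrite exprn_ge0 // subr_ge0.
by move: IH; rewrite exprS -natr1; nra.
Qed.

Lemma smooth_le (R : realType) (S : eqType) (o : S) q (b b' : R) m st :
  b <= b' -> smooth o q b m st -> smooth o q b' m st.
Proof. by move=> bb sm r h mr h1; apply: le_trans bb; exact: sm. Qed.

Section Assembly.
Context (d : measure_display) (T : measurableType d) (R : realType) (Pr : probability T R).
Variables (K n : nat) (P : 'M[R]_K.+1) (pi : 'I_K.+1 -> R) (q : 'I_K.+1 -> int -> R).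
Variables (X : nat -> T -> 'I_K.+1) (Y : nat -> T -> int) (z rho C Cb : R).
Hypothesis sP : stochastic (fun i j => P i j).
Hypothesis iP : irreducible P.
Hypothesis spi : stationary_law P pi.
Hypothesis pq : forall k, int_pmf (q k).
Hypothesis mX : forall i x, measurable [set t | X i t = x].
Hypothesis mY : forall i y, measurable [set t | Y i t = y].
Hypothesis cylinder : forall (m : nat) (xs : nat -> 'I_K.+1) (ys : nat -> int),
  Pr [set t | forall i, (i <= m)%N -> X i t = xs i /\ Y i t = ys i]
  = (pi (xs 0%N) * \prod_(i < m) P (xs i) (xs i.+1) * \prod_(i < m.+1) q (xs i) (ys i))%:E.
Hypothesis n_gt0 : (0 < n)%N.
Hypothesis z1 : 1 <= z.
Hypothesis q3 : forall M k, Ex (trunc_law (pq k) M) (fun y => `|y%:~R| ^+ 3) <= z ^+ 3.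
Hypothesis rho1 : 1 < rho.
Hypothesis HC : hitting_tail_bound (pair_kernel (fun i j => P i j)) (ord0, ord0) C rho.
Hypothesis HCb : hitting_tail_bound (pair_kernel (rev_kernel P pi)) (ord0, ord0) Cb rho.

Local Notation beta1 := (beta (fun i j => P i j) q ord0 (n %/ 4)).
Local Notation beta2 := (beta (rev_kernel P pi) q ord0 (n %/ 4)).
Hypothesis beta1_fin : (beta1 < +oo)%E.
Hypothesis beta2_fin : (beta2 < +oo)%E.
Hypothesis tau_fin : (E_tau2 P pi < +oo)%E.

Let pi_gt0 := stationary_gt0 sP iP spi.
Let sPr := rev_kernel_stochastic sP iP spi.
Let pi0 k : 0 <= pi k. Proof. exact: ltW. Qed.
Let pi1 : \sum_k pi k = 1. Proof. by case: spi. Qed.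
Let pi_inv k : \sum_j pi j * P j k = pi k. Proof. by case: spi. Qed.
Let mu := stat_law spi pi_gt0.
Let fw := kernel_law sP.
Let bw := kernel_law sPr.
Let qM M k := trunc_law (pq k) M.
Let L f := sum_mean Pr Y n f.
Let m := (n %/ 4)%N.

Let q12 M k : Ex (qM M k) (fun y => `|y%:~R|) <= z /\
  Ex (qM M k) (fun y => `|y%:~R| ^+ 2) <= z ^+ 2.
Proof. by apply: lower_moments => //; [exact: lt_le_trans z1 | exact: q3]. Qed.

Let EM M (f : int -> R) := window (qM M) mu fw bw 0 n.-1 (fun=> f).

Lemma EM_path M f : EM M f =
  Ex mu (fun x => Ex (pathlaw (qM M) fw n.-1 x) (fun ys => f (zsum ys))).
Proof. by rewrite /EM (window_path _ (stat_law_reversal sP sPr spi pi_gt0)) add0n. Qed.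

Lemma EM_cvg f : quadratic f -> EM ^~ f @ \oo --> L f.
Proof.
move=> qf; have := sum_mean_cvg sP pi0 pi1 pi_inv (pq := pq) mX mY cylinder n_gt0 (sqr_ge0 z)
  (fun M k => (q12 M k).2) qf.
apply: cvg_trans; apply: near_eq_cvg; apply: nearW => M.
by rewrite EM_path !Ex_fin.
Qed.

(** Linearity and positivity of [L] are inherited through this limit from the finite means [EM]. *)
Lemma L_unique f (c : R) : quadratic f -> EM ^~ f @ \oo --> c -> L f = c.
Proof. by move=> qf cf; apply: (cvg_unique _ (EM_cvg qf) cf); exact: norm_hausdorff. Qed.

Lemma L_add f g : quadratic f -> quadratic g -> L (fun w => f w + g w) = L f + L g.
Proof.
move=> qf qg; apply: L_unique; first exact: quadraticD.
rewrite (_ : EM ^~ _ = fun M => EM M f + EM M g); first by apply: cvgD; exact: EM_cvg.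
by apply/funext => M; rewrite !EM_path -ExD; apply: eq_Ex => x; rewrite -ExD.
Qed.

Lemma L_scale c f : quadratic f -> L (fun w => c * f w) = c * L f.
Proof.
move=> qf; apply: L_unique; first exact: quadraticZ.
rewrite (_ : EM ^~ _ = fun M => c * EM M f); first by apply: cvgMl_tmp; exact: EM_cvg.
by apply/funext => M; rewrite !EM_path -ExZ; apply: eq_Ex => x; rewrite -ExZ.
Qed.

Lemma L_le f g : quadratic f -> quadratic g -> (forall w, f w <= g w) -> L f <= L g.
Proof.
move=> qf qg fg; apply: (ler_cvg_to (EM_cvg qf) (EM_cvg qg)); apply: nearW => M.
by rewrite !EM_path; apply: Ex_le => x; apply: Ex_le => ys.
Qed.

Lemma L_one : L (fun=> 1) = 1.
Proof.
apply: L_unique; first exact: quadratic_cst.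
rewrite (_ : EM ^~ _ = fun=> 1); first exact: cvg_cst.
by apply/funext => M; rewrite EM_path -[RHS](Ex_cst mu); apply: eq_Ex => x; rewrite Ex_cst.
Qed.

Lemma L_variance : L (fun w => (w%:~R - L intr) ^+ 2) = L (fun w => w%:~R ^+ 2) - L intr * L intr.
Proof.
set a := L intr; rewrite (_ : (fun w : int => _) = fun w => w%:~R ^+ 2 + ((- 2 * a) * w%:~R + a ^+ 2 * 1)).
  have qi := @quadratic_id R; have q1 := @quadratic_cst R 1.
  have qa := quadraticZ (- 2 * a) qi; have qb := quadraticZ (a ^+ 2) q1.
  rewrite L_add; [|exact: quadratic_sqr | exact: quadraticD].
  by rewrite L_add // !L_scale // L_one -/a; ring.
by apply/funext => w; ring.
Qed.

Let defect M : R := \sum_k box_defect (q k) M.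
(** The sum over the states dominates each single defect, and the cap at 1 keeps [1 - eps M] a
    probability, as Bernoulli's inequality requires. *)
Let eps M := Num.min 1 (defect M).

Let defect_ge0 M k : 0 <= box_defect (q k) M.
Proof. by rewrite /box_defect subr_ge0 pmf_sum_le1 ?box_uniq. Qed.

Lemma eps_cvg0 : eps M @[M --> \oo] --> (0 : R).
Proof.
have c : defect M @[M --> \oo] --> (0 : R).
  rewrite [X in _ --> X](_ : _ = \sum_(k : 'I_K.+1) (0 : R)); last by rewrite big1.
  apply: (@cvg_big R _ +%R 0 xpredT _) => [|k _]; first exact: add_continuous.
  rewrite -(subrr (1 : R)); apply: cvgB; first exact: cvg_cst.
  exact: pmf_box_cvg.
apply: (squeeze_cvgr _ (cvg_cst 0) c); apply: nearW => M.
rewrite /eps le_min ler01 /= sumr_ge0 //=; first by rewrite ge_min lexx orbT.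
Qed.

Let eps01 M : 0 <= eps M <= 1.
Proof. by rewrite /eps le_min ler01 ge_min lexx /= andbT sumr_ge0. Qed.

Let eps_defect M k : box_defect (q k) M <= eps M.
Proof.
rewrite /eps le_min; apply/andP; split.
  by rewrite /box_defect lerBlDr lerDl sumr_ge0 // => y _; case: (pq k).
by rewrite /defect (bigD1 k) //= lerDl sumr_ge0.
Qed.

Let bmax := Num.max (fine beta1) (fine beta2).
Let bM M := bmax + 4 * (m%:R * eps M).

Let bM_ge0 M : 0 <= bM M.
Proof.
rewrite addr_ge0 ?mulr_ge0 //; last by case/andP: (eps01 M).
by rewrite le_max fine_ge0 // esum_ge0.
Qed.

Lemma smooth_trunc M : smooth ord0 (qM M) (bM M) m fw /\ smooth ord0 (qM M) (bM M) m bw.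
Proof.
have e := bernoulli_le m (eps01 M).
have sf := sum_from_smooth sP pq (x0 := ord0) (eps01 M) (eps_defect M) e beta1_fin.
have sb := sum_from_smooth sPr pq (x0 := ord0) (eps01 M) (eps_defect M) e beta2_fin.
by split; [apply: smooth_le sf | apply: smooth_le sb]; rewrite lerD2r le_max lexx ?orbT.
Qed.

Let T2 := fine (E_tau2 P pi).

Lemma span_le_T2 l r : Ex (span_law ord0 mu fw bw l r) (fun t => t%:R ^+ 2) <= T2.
Proof.
have := span_moment_le sP sPr spi pi_gt0 l r rho1 HC HCb => H.
rewrite -lee_fin fineK // ge0_fin_numE //; apply: le_trans H.
by rewrite lee_fin; apply: Ex_ge0 => t; rewrite exprn_ge0.
Qed.

(** The covariance bounds for the [n] positions of the mark are added up. Their factors that depend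
    on the total alone are the same for every position, so they come out of the sum. *)
Lemma trunc_cov M (g : int -> R) : (forall j, `|g (j + 1) - g j| <= 1) ->
  `|(EM M (fun w => w%:~R * g w) - EM M (fun w => w%:~R) * EM M g) -
    (EM M (fun w => w%:~R ^+ 2) - EM M (fun w => w%:~R) * EM M (fun w => w%:~R)) *
      EM M (fun w => g (w + 1) - g w)| <= 14 * n%:R * z ^+ 3 * T2 * bM M.
Proof.
move=> g1; have rev := stat_law_reversal sP sPr spi pi_gt0; have [sf sb] := smooth_trunc M.
pose wl (l : nat) (G : int -> int -> R) := window (qM M) mu fw bw l (n.-1 - l) G.
have wE (l : 'I_n) f : wl l (fun=> f) = EM M f.
  by apply: window_eq => //; rewrite add0n subnKC // -ltnS prednK.
have tot h : \sum_(l < n) wl l (fun y w => y%:~R * h w) = EM M (fun w => w%:~R * h w).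
  exact: window_total.
have tot1 : \sum_(l < n) wl l (fun y _ => y%:~R) = EM M (fun w => w%:~R).
  have := tot (fun=> 1); rewrite (_ : (fun w : int => w%:~R * 1) = fun w => w%:~R :> R).
    by move=> <-; apply: eq_bigr => l _; congr wl; apply/funext => y; apply/funext => w; rewrite mulr1.
  by apply/funext => w; rewrite mulr1.
have tot2 : \sum_(l < n) wl l (fun y w => y%:~R * w%:~R) = EM M (fun w => w%:~R ^+ 2).
  by rewrite (tot (fun w => w%:~R)); congr EM; apply/funext => w; rewrite expr2.
rewrite -(tot g) -tot2 -[in X in `|_ - X * _ - _|]tot1 -[in X in (_ - X * _) * _]tot1.
rewrite !big_distrl /= -!sumrB big_distrl /= -sumrB.
apply: le_trans (ler_norm_sum _ _ _) _.
apply: (@le_trans _ _ (\sum_(l < n) 14 * z ^+ 3 * bM M * T2)); last first.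
  by rewrite sumr_const card_ord -mulr_natl; lra.
apply: ler_sum => l _.
have lr : n = (l + (n.-1 - l)).+1 by rewrite subnKC ?prednK // -ltnS prednK.
have := covariance_bound rev z1 (fun k => (q12 M k).1) (fun k => (q12 M k).2) (q3 M)
  sf sb (erefl : m = (n %/ 4)%N) lr g1.
rewrite -![window _ _ _ _ _ _ _]/(wl _ _) !wE => /le_trans; apply.
rewrite ler_wpM2l ?span_le_T2 // mulr_ge0 ?bM_ge0 // mulr_ge0 // exprn_ge0 //.
exact: le_trans z1.
Qed.

(** The bound for truncated values passes to the limit in [M]: the loss [4 m eps M] in smoothness
    tends to 0 because [m] is fixed. *)
Lemma L_stein g : (forall j, `|g (j + 1) - g j| <= 1) ->
  `|L (fun w => w%:~R * g w) - L intr * L g -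
    L (fun w => (w%:~R - L intr) ^+ 2) * L (fun w => g (w + 1) - g w)| <=
  14 * n%:R * z ^+ 3 * T2 * bmax.
Proof.
move=> g1; rewrite L_variance; set c := 14 * n%:R * z ^+ 3 * T2.
have ci := EM_cvg (@quadratic_id R).
have cd := EM_cvg (quadratic_bounded g1).
have cb : (fun M => c * bM M) @ \oo --> c * bmax.
  rewrite -[in X in _ --> X](addr0 bmax) -[in X in _ --> X](mulr0 4) -[in X in _ --> X](mulr0 m%:R).
  apply: cvgMl_tmp; apply: cvgD; first exact: cvg_cst.
  by apply: cvgMl_tmp; apply: cvgMl_tmp; exact: eps_cvg0.
apply: (ler_cvg_to _ cb); last by apply: nearW => M; exact: (trunc_cov M g1).
apply: cvg_norm; apply: cvgB.
  by apply: cvgB; [apply: EM_cvg; exact: quadratic_lipM |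
    apply: cvgM => //; apply: EM_cvg; exact: quadratic_lip].
apply: cvgM => //; apply: cvgB; last exact: cvgM.
by apply: EM_cvg; exact: quadratic_sqr.
Qed.

Lemma L_distance (A : seq int) : uniq A -> 0 < L (fun w => (w%:~R - L intr) ^+ 2) ->
  \sum_(w <- A) `|L (fun v => (v == w)%:R) - TP (L intr) (L (fun w => (w%:~R - L intr) ^+ 2)) w|
    <= 2 * ((2 + 14 * n%:R * z ^+ 3 * T2 * bmax) / L (fun w => (w%:~R - L intr) ^+ 2)).
Proof.
move=> uA s2; exact: (TP_distance L_add L_scale L_le L_one s2 L_stein uA).
Qed.
End Assembly.

(** * The final bound *)

Lemma hitting_constant_ge1 (R : realType) (S : finType) (Q : S -> S -> R) (s : S) (C rho : R) :
  hitting_tail_bound Q s C rho -> 1 <= C.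
Proof. by move=> /(_ 0%N s) /=; rewrite expr0 invr1 mulr1. Qed.

Lemma E_tau2_ge1 (R : realType) (K : nat) (P : 'M[R]_K.+1) (pi : 'I_K.+1 -> R) (C Cb rho : R) :
  stochastic (fun i j => P i j) -> irreducible P -> stationary_law P pi -> 1 < rho ->
  hitting_tail_bound (pair_kernel (fun i j => P i j)) (ord0, ord0) C rho ->
  hitting_tail_bound (pair_kernel (rev_kernel P pi)) (ord0, ord0) Cb rho ->
  (1 <= E_tau2 P pi)%E.
Proof.
move=> sP iP spi rho1 HC HCb.
have := span_moment_le sP (rev_kernel_stochastic sP iP spi) spi (stationary_gt0 sP iP spi) 0 0
  rho1 HC HCb.
apply: le_trans; rewrite lee_fin Ex_span_law -[leLHS](Ex_cst (stat_law spi (stationary_gt0 sP iP spi))).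
apply: Ex_le => x; rewrite -[leLHS](Ex_cst (stat_law spi (stationary_gt0 sP iP spi))).
apply: Ex_le => x'; rewrite !Ex_meeting0 /=; exact: exprn_ege1.
Qed.

Lemma sum_mean_eq d (T : measurableType d) (R : realType) (Pr : probability T R)
    (Y : nat -> T -> int) n w :
  (forall i y, measurable [set t | Y i t = y]) ->
  fine (Pr [set t | \sum_(1 <= i < n.+1) Y i t = w]) = sum_mean Pr Y n (fun v => (v == w)%:R).
Proof.
move=> mY; rewrite /sum_mean; set A := [set t | _].
rewrite -[in LHS](setIT A) -integral_indic //; last exact: int_sum_measurable.
congr fine; apply: eq_integral => t _; congr (_%:E); rewrite indicE.
by congr ((_ : bool)%:R); apply/idP/eqP; rewrite ?inE.
Qed.

Theorem theorem4p2
  (R : realType) (d : measure_display) (T : measurableType d)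
  (Pr : probability T R)
  (K n : nat) (P : 'M[R]_K.+1) (pi : 'I_K.+1 -> R)
  (q : 'I_K.+1 -> int -> R)
  (X : nat -> T -> 'I_K.+1) (Y : nat -> T -> int)
  (fZ : nat -> R) (rho C Cb : R) :
  (* X: aperiodic, irreducible, stationary Markov chain on E = {0..K} *)
  stochastic (fun i j => P i j) ->
  irreducible P -> aperiodic P ->
  stationary_law P pi ->
  (* conditional laws L(Y_i | X_i = k) = q k, with finite variance *)
  (forall k, int_pmf (q k)) ->
  (forall k, finite_variance (q k)) ->
  (forall i x, measurable [set t | X i t = x]) ->
  (forall i y, measurable [set t | Y i t = y]) ->
  (* joint law of (X_0..X_m, Y_0..Y_m): stationary Markov chain with
     kernel P, the Y_i conditionally independent given X with
     conditional law q (X_i) *)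
  (forall (m : nat) (xs : nat -> 'I_K.+1) (ys : nat -> int),
     Pr [set t | forall i, (i <= m)%N -> X i t = xs i /\ Y i t = ys i]
     = (pi (xs 0%N) * \prod_(i < m) P (xs i) (xs i.+1)
        * \prod_(i < m.+1) q (xs i) (ys i))%:E) ->
  (* (i) *)
  strongly_aperiodic (return_sum_law (fun i j => P i j) q ord0) ->
  (* (ii) Z positive integer valued with E Z^3 < oo dominating the tails *)
  nat_pmf fZ -> fZ 0%N = 0 ->
  (third_moment fZ < +oo)%E ->
  (forall (r : R) (l : 'I_K.+1), 0 <= r ->
     (\esum_(y in [set y : int | (r <= y%:~R)%R]) (q l y)%:E <= tail_ge fZ r)%E /\
     (\esum_(y in [set y : int | (y%:~R <= - r)%R]) (q l y)%:E <= tail_ge fZ r)%E) ->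
  (* constants rho > 1, C, Cbar *)
  1 < rho ->
  hitting_tail_bound (pair_kernel (fun i j => P i j)) (ord0, ord0) C rho ->
  hitting_tail_bound (pair_kernel (rev_kernel P pi)) (ord0, ord0) Cb rho ->
  let W := fun t => \sum_(1 <= i < n.+1) Y i t in
  let Wr := fun t => ((W t)%:~R : R) in
  let EW := fine ('E_Pr[Wr])%E in
  let VarW := fine ('V_Pr[Wr])%E in
  0 < VarW ->
  (\esum_(w in [set: int]) (`| fine (Pr [set t | W t = w]) - TP EW VarW w |)%:E
   <= (4%:E * (1 + (14 * n%:R)%:E * phi P pi q C Cb rho n
                   * E_tau2 P pi * third_moment fZ))
      * (VarW^-1)%:E)%E.
Proof.
move=> sP iP _ spi pq _ mX mY cylinder _ pZ fZ0 third_fin tails rho1 HC HCb W Wr EW VarW V0.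
have n_gt0 : (0 < n)%N.
  rewrite lt0n; apply/eqP => n0; move: V0; rewrite /VarW (_ : Wr = cst 0) ?variance_cst ?ltxx //.
  by apply/funext => t; rewrite /Wr /W n0 big_geq.
have EWE : EW = sum_mean Pr Y n intr by rewrite /EW unlock.
have VarWE : VarW = sum_mean Pr Y n (fun w => (w%:~R - sum_mean Pr Y n intr) ^+ 2).
  rewrite -EWE /VarW /variance !unlock (_ : fine (\int[Pr]_t (Wr t)%:E) = EW); last by rewrite /EW unlock.
  by congr fine; apply: eq_integral => t _; rewrite expr2.
have third1 := third_moment_ge1 pZ fZ0.
have thirdN : third_moment fZ \is a fin_num.
  by rewrite ge0_fin_numE //; apply: le_trans third1; rewrite lee_fin ler01.
have tau1 := E_tau2_ge1 sP iP spi rho1 HC HCb.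
have C1 := hitting_constant_ge1 HC.
set c := Num.max C Cb * n%:R * powR rho (- (n%:R / 4)).
(* Strict positivity keeps [phi] positive even where both [beta] vanish, so an infinite [E_tau2]
   makes the right side infinite, not the product of 0 and infinity, which is 0. *)
have c0 : 0 < c.
  apply: mulr_gt0; last by rewrite powR_gt0 // (lt_trans _ rho1).
  by rewrite mulr_gt0 ?ltr0n // lt_max (lt_le_trans _ C1).
rewrite /phi -/c; set b1 := beta _ _ _ _; set b2 := beta _ _ _ _.
have b10 : (0 <= b1)%E by apply: esum_ge0.
have b20 : (0 <= b2)%E by apply: esum_ge0.
have n14 : (0 < (14 * n%:R)%:E :> \bar R)%E by rewrite lte_fin mulr_gt0 ?ltr0n.
have tau0 : (0 < E_tau2 P pi)%E by apply: lt_le_trans tau1.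
have third0 : (0 < third_moment fZ)%E by apply: lt_le_trans third1.
have infinite : ((14 * n%:R)%:E * (maxe b1 b2 + c%:E) * E_tau2 P pi = +oo)%E ->
    (4%:E * (1 + (14 * n%:R)%:E * (maxe b1 b2 + c%:E) * E_tau2 P pi * third_moment fZ) *
      VarW^-1%:E = +oo)%E.
  move=> ->; rewrite gt0_mulye // addey // gt0_muley ?gt0_mulye ?lte_fin ?invr_gt0 //.
have max0 : (0 < maxe b1 b2 + c%:E)%E.
  by apply: lt_le_trans (_ : c%:E <= _)%E; rewrite ?lte_fin // leeDr // le_max b10.
have [tN|tN] := eqVneq (E_tau2 P pi) +oo%E.
  by rewrite infinite ?leey // tN gt0_muley // mule_gt0.
have [bN|bN] := eqVneq (maxe b1 b2) +oo%E.
  by rewrite infinite ?leey // bN addye // gt0_muley // gt0_mulye.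
have tfin : (E_tau2 P pi < +oo)%E by rewrite ltey.
have bfin : (maxe b1 b2 < +oo)%E by rewrite ltey.
move: (bfin); rewrite gt_max => /andP[b1fin b2fin].
(* Since [Z >= 1], the cube root [z] of twice its third moment is at least 1, as the estimates on
   windows require. *)
have third1' : 1 <= 2 * fine (third_moment fZ).
  by have : 1 <= fine (third_moment fZ); [rewrite -lee_fin fineK | lra].
have [z z1 z3] := cube_root third1'.
have q3 M k : Ex (trunc_law (pq k) M) (fun y => `|y%:~R| ^+ 3) <= z ^+ 3.
  by rewrite z3; apply: cube_moment => // r r0; case: (tails r k r0).
apply: esum_le_seq => A uA _; rewrite sumEFin.
have main := L_distance sP iP spi mX mY cylinder n_gt0 z1 q3 rho1 HC HCb b1fin b2fin tfin uA.
rewrite -VarWE -EWE in main.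
rewrite -(fineK thirdN) -[E_tau2 P pi]fineK ?ge0_fin_numE ?(ltW tau0) //.
rewrite -[b1]fineK ?ge0_fin_numE // -[b2]fineK ?ge0_fin_numE //.
rewrite -EFin_max; set b := Num.max _ _ in main *; set T2 := fine (E_tau2 _ _) in main *.
set z' := fine (third_moment fZ) in z3 *.
apply: (@le_trans _ _ (4 * (1 + 14 * n%:R * (b + c) * T2 * z') * VarW^-1)%:E); last exact: lexx.
rewrite lee_fin (eq_bigr _ (fun w _ => congr1 (fun x => `|x - TP EW VarW w|) (sum_mean_eq Pr n w mY))).
apply: le_trans (main V0) _; rewrite mulrA ler_wpM2r ?invr_ge0 ?(ltW V0) // z3.
have T20 : 0 <= T2 by rewrite fine_ge0 ?ltW.
have z'0 : 0 <= z' by rewrite fine_ge0 ?ltW.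
(* With [z ^+ 3 = 2 z'] both sides contain 4 and [56 n b T2 z']; their difference is the nonnegative
   contribution of [c]. *)
rewrite -subr_ge0 [leRHS](_ : _ = 56 * (n%:R * c * T2 * z')); last by ring.
by apply: mulr_ge0 => //; do 2 apply: mulr_ge0 => //; apply: mulr_ge0 => //; exact: ltW.
Qed.
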